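(* Let $f:\Gamma\to\Gamma'$ be a homeomorphism between metric graphs $\Gamma$ and $\Gamma'$, and let $A\subseteq\Gamma$. If $A$ is a rank-determining set of $\Gamma$, then $f(A)$ is a rank-determining set of $\Gamma'$.
   Context: A metric graph is the geometric realization of a finite connected multigraph without loop edges in which each edge is identified with a closed real interval of some positive length (the metric, and hence linear equivalence, depends on the lengths). Divisors are elements of the free abelian group on the points of the metric graph; a rational function is a continuous piecewise linear real function with integral slopes, $(f)=\sum_v\mathrm{ord}_v f\,(v)$ where $\mathrm{ord}_vf$ is the sum of outgoing slopes at $v$; $D\sim D'$ iff $D-D'=(f)$; $|D|$ is the set of effective divisors linearly equivalent to $D$. The rank $r(D)$ is $-1$ if $|D|=\emptyset$, otherwise $r(D)\ge s\ge0$ iff $|D-E|\neq\emptyset$ for all effective $E$ of degree $s$. For nonempty $A$, $r_A(D)$ is defined the same way with $E$ supported on $A$. $A$ is rank-determining if $r(D)=r_A(D)$ for all divisors $D$. *)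

(* Defs.v *)
From HB Require Import structures.
From mathcomp Require Import all_boot all_order all_algebra.
From mathcomp Require Import all_classical all_reals all_analysis.
From mathcomp Require Import freeg.

Set Implicit Arguments.
Unset Strict Implicit.
Unset Printing Implicit Defensive.
Import Order.TTheory GRing.Theory Num.Theory.
Import numFieldTopology.Exports numFieldNormedType.Exports.

Local Open Scope classical_set_scope.
Local Open Scope ring_scope.

(* The orientation of an edge, from [src] to [tgt], only fixes which end of
   the edge is identified with the end 0 of the interval [0, len e]. *)
Record metricGraph (R : realType) := MetricGraph {
  vert : finType;
  edge : finType;
  src : edge -> vert;
  tgt : edge -> vert;
  len : edge -> R;
  loopless : forall e, src e != tgt e;
  len_gt0 : forall e, 0 < len e;
  vert_nonempty : (0 < #|vert|)%N;
  vert_connected : forall u v : vert,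
    connect [rel x y | [exists e, ((src e == x) && (tgt e == y))
                               || ((src e == y) && (tgt e == x))]] u v }.

(* Normal forms for the points of the geometric realization
   (vert + sum_e [0, len e]) / (0_e ~ src e, (len e)_e ~ tgt e). *)
Inductive gpoint (R : realType) (G : metricGraph R) :=
| Vertex of vert G
| Inner (e : edge G) of {t : R | 0 < t < len e}.
Arguments Vertex {R G} v.
Arguments Inner {R G} e t.

HB.instance Definition _ (R : realType) (G : metricGraph R) :=
  gen_eqMixin (gpoint G).
HB.instance Definition _ (R : realType) (G : metricGraph R) :=
  gen_choiceMixin (gpoint G).

(* The image of t in [0, len e] in the geometric realization; extended to all
   of R by the retraction of R onto [0, len e]. *)
Definition edge_pt (R : realType) (G : metricGraph R) (e : edge G) (t : R) :
    gpoint G :=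
  match (insub t : option {t : R | 0 < t < len e}) with
  | Some u => Inner e u
  | None => if t <= 0 then Vertex (src e) else Vertex (tgt e)
  end.

(* The quotient topology of the geometric realization. Since R retracts onto
   [0, len e], a set is open in R for the extended [edge_pt] exactly when its
   trace on [0, len e] is relatively open. *)
Definition gpoint_open (R : realType) (G : metricGraph R) :
    set_system (gpoint G) :=
  [set U | forall e : edge G, open (edge_pt e @^-1` U)].

Section gpoint_topology.
Context (R : realType) (G : metricGraph R).

Let gpoint_openT : gpoint_open [set: gpoint G].
Proof. by move=> e; rewrite preimage_setT; exact: openT. Qed.

Let gpoint_openI : setI_closed (@gpoint_open R G).
Proof. by move=> U V oU oV e; rewrite preimage_setI; exact: openI. Qed.

Let gpoint_open_bigcup (I : Type) (U : I -> set (gpoint G)) :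
  (forall i, gpoint_open (U i)) -> gpoint_open (\bigcup_i U i).
Proof.
by move=> oU e; rewrite preimage_bigcup; apply: bigcup_open => i _; exact: oU.
Qed.

HB.instance Definition _ := isOpenTopological.Build (gpoint G)
  gpoint_openT gpoint_openI gpoint_open_bigcup.

End gpoint_topology.

Definition homeomorphism (T U : topologicalType) (f : T -> U) : Prop :=
  continuous f /\
  exists g : U -> T, [/\ cancel f g, cancel g f & continuous g].

Notation divisor G := {freeg (gpoint G)}.

Definition piecewise_linear_int (R : realType) (a b : R) (g : R -> R) : Prop :=
  exists s : seq R, itv_partition a b s /\
    forall i, (i < size s)%N -> exists m : int,
      forall t, nth b (a :: s) i <= t <= nth b s i ->
        g t = g (nth b (a :: s) i) + m%:~R * (t - nth b (a :: s) i).

Definition rational_function (R : realType) (G : metricGraph R)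
    (F : gpoint G -> R) : Prop :=
  continuous F /\
  forall e : edge G, piecewise_linear_int 0 (len e) (F \o edge_pt e).

(* The slope at 0+ of a germ that is affine with integral slope; the default
   value 0 is never taken on rational functions. *)
Definition init_slope (R : realType) (u : R -> R) : int :=
  xget 0 [set m : int | \forall h \near 0^'+, u h = u 0 + m%:~R * h].

Definition ord (R : realType) (G : metricGraph R) (F : gpoint G -> R)
    (x : gpoint G) : int :=
  match x with
  | Vertex v =>
      \sum_(e | src e == v) init_slope (fun h => F (edge_pt e h))
      + \sum_(e | tgt e == v) init_slope (fun h => F (edge_pt e (len e - h)))
  | Inner e t =>
      init_slope (fun h => F (edge_pt e (val t + h)))
      + init_slope (fun h => F (edge_pt e (val t - h)))
  end.

(* [\sum_(x \in _)] is the sum over the finite support of the summand (and 0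
   if the support is infinite, which does not happen for rational functions). *)
Definition principal (R : realType) (G : metricGraph R) (F : gpoint G -> R) :
    divisor G :=
  \sum_(x \in [set: gpoint G]) << ord F x *g x >>.

Definition lin_equiv (R : realType) (G : metricGraph R) (D D' : divisor G) :
    Prop :=
  exists2 F : gpoint G -> R, rational_function F & D - D' = principal F.

Definition effective (R : realType) (G : metricGraph R) (D : divisor G) : Prop :=
  forall x, 0 <= coeff x D.

Definition linear_system (R : realType) (G : metricGraph R) (D : divisor G) :
    set (divisor G) :=
  [set D' | effective D' /\ lin_equiv D' D].

Definition supported_on (R : realType) (G : metricGraph R) (A : set (gpoint G))
    (E : divisor G) : Prop :=
  forall x, coeff x E != 0 -> A x.

(* The clause "r_A(D) >= s", for s a natural number. *)
Definition rank_ge (R : realType) (G : metricGraph R) (A : set (gpoint G))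
    (D : divisor G) (s : nat) : Prop :=
  forall E : divisor G, effective E -> supported_on A E -> deg E = s%:Z ->
    linear_system (D - E) !=set0.

(* r_A(D). The natural number picked below exists and is unique when A is
   nonempty, which is the only case where r_A is meaningful. *)
Definition rank_on (R : realType) (G : metricGraph R) (A : set (gpoint G))
    (D : divisor G) : int :=
  if `[< linear_system D = set0 >] then -1
  else (xget 0%N [set r : nat | forall s : nat, (s <= r)%N <-> rank_ge A D s])%:Z.

Definition rank (R : realType) (G : metricGraph R) (D : divisor G) : int :=
  rank_on [set: gpoint G] D.

Definition rank_determining (R : realType) (G : metricGraph R)
    (A : set (gpoint G)) : Prop :=
  A !=set0 /\ forall D : divisor G, rank D = rank_on A D.

(* Main.v *)
Require Import Defs.
From mathcomp Require Import all_boot all_order all_algebra.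
From mathcomp Require Import ring lra zify.

Set Implicit Arguments.
Unset Strict Implicit.
Unset Printing Implicit Defensive.
Import Order.TTheory GRing.Theory Num.Theory.

(* [A] is rank-determining iff every linear system whose members cover [A] has
   members covering all points. This fails for [A] iff [A] misses a special open
   set: a nonempty connected open set [U] such that every component of the
   complement of [U] contains a point from which at least two rays start inside
   [U]. The latter notion is topological, whence the theorem.
   If the system of [D] covers [A] but not [x], take an [x]-reduced divisor and the
   component [U] of [x] in the complement of its support: were [U] not special,
   some component of its complement could be fired. Conversely, given [U], burn
   [U] first and then each component of its complement starting from a point with
   two rays into [U]; the divisor with (indegree - 1) chips at each point outside
   [U] covers exactly the complement of [U], by comparison with its reduced
   representatives. *)

Local Open Scope ring_scope.

(** * Burning on finite graphs *)

(** Linear equivalence depends on the edge lengths, so no divisor is carried along the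
    homeomorphism; only [U] is, and a divisor is built anew on the other graph. Members of the
    system of [D] are handled through functions [F] with [D + (F)] effective ([lsection]): where [F]
    is maximal its order is at most 0, which gives both non-covering statements. The obstacle is
    that the support of a reduced representative and the breakpoints of the function leading to it
    are unknown when the burning order is chosen on a finite subdivision. The order is therefore
    extended to a real-valued height, linear on the segments outside [U]: a point inserted later
    outside [U] has exactly one lower neighbor, hence indegree 1 and no chip, so indegree minus one
    describes the same divisor on every refinement. The comparison then becomes an edge count on a
    finite graph. *)

Lemma sum_le_mem (T : finType) (P : pred T) (f : T -> int) (x : T) : (forall y, P y -> 0 <= f y) ->
  P x -> f x <= \sum_(y | P y) f y.
Proof.
move=> f0 Px; rewrite (bigD1 x) //= lerDl; apply: sumr_ge0 => y /andP[Py _]; exact: f0.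
Qed.

Section FiniteGraph.
Context (V : finType) (m : V -> V -> int) (U : {set V}).
Context (m_ge0 : forall p q, 0 <= m p q).

(** The list [s] of burnt vertices grows by one vertex at a time. If some remaining vertex has an
    edge to [s], it burns next; otherwise the remaining set [Z] has no edge to the rest of the
    complement of [U], and the hypothesis provides a vertex with two edges into [U]. *)
Lemma burning_order :
  (forall Z : {set V}, Z != set0 -> [disjoint Z & U] ->
     (forall p q, p \in Z -> q \notin U -> q \notin Z -> m p q = 0) ->
     exists2 p, p \in Z & 2 <= \sum_(q in U) m p q) ->
  exists rho : V -> nat,
    [/\ forall p, (rho p == 0%N) = (p \in U),
        forall p q, p \notin U -> rho p = rho q -> p = q &
        forall p, p \notin U -> 2 <= \sum_(q in U) m p q \/
          exists q, [/\ q \notin U, (rho q < rho p)%N & 0 < m p q]].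
Proof.
move=> sp.
have [s [us sU ss gs]] : exists s : seq V, [/\ uniq s, all (fun p => p \notin U) s,
    size s = #|~: U| & forall p, p \in s -> 2 <= \sum_(q in U) m p q \/
          exists q, [/\ q \in s, (index q s < index p s)%N & 0 < m p q]].
  have : (#|~: U| <= #|~: U|)%N by [].
  elim: {1 3}#|~: U| => [|k IH] kU; first by exists [::].
  have [s [us sU ss gs]] := IH (ltnW kU).
  pose Z := ~: U :\: [set p in s].
  have Zs p : p \in Z = (p \notin s) && (p \notin U) by rewrite !inE.
  have Z0 : Z != set0.
    rewrite -card_gt0 cardsD; have : (#|~: U :&: [set p in s]| <= k)%N.
      by rewrite -ss; apply: leq_trans (subset_leq_card (subsetIr _ _)) _; rewrite cardsE card_size.
    by lia.
  suff [p pZ Hp] : exists2 p, p \in Z & 2 <= \sum_(q in U) m p q \/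
          exists2 q, q \in s & 0 < m p q.
    move: pZ; rewrite Zs => /andP[ps pU].
    exists (rcons s p); split.
    - by rewrite rcons_uniq ps us.
    - by rewrite all_rcons pU sU.
    - by rewrite size_rcons ss.
    - have idx q : q \in s -> index q (rcons s p) = index q s.
        by move=> qs; rewrite -cats1 index_cat qs.
      have idp : index p (rcons s p) = size s.
        by rewrite -cats1 index_cat (negPf ps) /= eqxx addn0.
      move=> q; rewrite mem_rcons inE => /orP[/eqP->|qs].
        case: Hp => [|[r rs mr]]; [by left|right; exists r; split=> //].
          by rewrite mem_rcons inE rs orbT.
        by rewrite idx // idp index_mem.
      case: (gs q qs) => [|[r [rs ri mr]]]; [by left|right; exists r; split=> //].
        by rewrite mem_rcons inE rs orbT.
      by rewrite !idx.
  have [/existsP[p /andP[pZ /existsP[q /andP[qs mpq]]]]|nE] :=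
      boolP [exists p, (p \in Z) && [exists q, (q \in s) && (0 < m p q)]].
    by exists p => //; right; exists q.
  have [||p q pZ qU qZ|p pZ Hp] := sp Z => //.
  - by rewrite -setI_eq0; apply/eqP/setP => p; rewrite !inE; case: (p \in U); rewrite ?andbF.
  - apply/eqP; rewrite eq_le m_ge0 andbT leNgt; apply: contra nE => mpq.
    apply/existsP; exists p; rewrite pZ; apply/existsP; exists q; rewrite mpq andbT.
    by move: qZ; rewrite Zs qU andbT negbK.
  - by exists p => //; left.
have sall p : p \notin U -> p \in s.
  move=> pU; have : [set q in s] = ~: U.
    have cs : #|[set q in s]| = #|~: U| by rewrite cardsE (card_uniqP us).
    apply/eqP; rewrite eqEcard cs leqnn andbT.
    by apply/subsetP => q; rewrite !inE => /(allP sU).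
  by move=> /setP/(_ p); rewrite !inE pU.
exists (fun p => if p \in U then 0%N else (index p s).+1); split.
- by move=> p; case: ifP.
- move=> p q pU; rewrite (negPf pU); case: ifPn => // qU [].
  have := @nth_index _ p p s (sall p pU); have := @nth_index _ p q s (sall q qU).
  by move=> Eq Ep pq; rewrite -Ep pq Eq.
- move=> p pU; case: (gs p (sall p pU)) => [|[q [qs qi mpq]]]; [by left|right].
  by have qU := allP sU q qs; exists q; rewrite (negPf pU) (negPf qU) ltnS.
Qed.

Section Burning.
Context (R : realDomainType) (H : V -> R).
Context (HU : forall p q, p \in U -> q \notin U -> H p < H q).
Context (H_burn : forall p, p \notin U -> 2 <= \sum_(q in U) m p q \/
  exists q, [/\ q \notin U, H q < H p & 0 < m p q]).

(** The number of arrows entering [B], every edge being oriented from its lower to its higher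
    end. *)
Let in_flow (B : {set V}) := \sum_(p in B) \sum_(q | (H q < H p) && (q \notin B)) m p q.

Lemma burn_minimum (B : {set V}) : B != set0 -> [disjoint B & U] ->
  exists2 p, p \in B & forall q, q \in B -> H p <= H q.
Proof.
move=> /set0Pn[x xB] _; have [p pB Hp] := @Order.TotalTheory.arg_minP _ _ _ x (mem B) H xB.
by exists p.
Qed.

(** A lowest vertex [p] of [B] either has two edges into [U], both of them entering arrows, or a
    lower neighbor outside [U], which by minimality lies outside [B]. In the second case an edge
    from [B] into [U] is another arrow, because that neighbor is not in [U]. *)
Lemma in_flow_ge1 (B : {set V}) : B != set0 -> [disjoint B & U] ->
  1 <= in_flow B /\ ((exists p q, [/\ p \in B, q \in U & 0 < m p q]) -> 2 <= in_flow B).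
Proof.
move=> B0 BU; have [p pB Hp] := burn_minimum B0 BU.
have BnU q : q \in B -> q \notin U by move=> qB; rewrite (disjointFr BU qB).
have UnB q : q \in U -> q \notin B by apply: contraL; exact: BnU.
pose f r := \sum_(q | (H q < H r) && (q \notin B)) m r q.
have f0 r : 0 <= f r by apply: sumr_ge0.
have fU r : r \in B -> \sum_(q in U) m r q <= f r.
  move=> rB; rewrite /f big_mkcond [leRHS]big_mkcond; apply: ler_sum => q _.
  case: ifP => qU; last by case: ifP.
  by rewrite HU ?BnU ?UnB.
have fI : f p <= in_flow B by apply: (@sum_le_mem _ (mem B)).
case: (H_burn (BnU p pB)) => [pU2|[q [qU qp mpq]]].
  have := fU p pB; split=> [|_]; lia.
have qB : q \notin B by apply/negP => /Hp; rewrite leNgt qp.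
have fq : m p q <= f p.
  by apply: sum_le_mem => //; rewrite qp.
split=> [|[r [u [rB uU mru]]]]; first by lia.
have [rp|rp] := eqVneq r p.
  subst r; have : m p q + m p u <= f p.
    rewrite /f (bigD1 q) ?qp //= lerD2l; apply: sum_le_mem => //.
    rewrite HU ?BnU // UnB //=; by apply: contraNneq qU => <-.
  by lia.
have : f p + f r <= in_flow B.
  rewrite /in_flow (bigD1 p) //= lerD2l.
  by apply: (@sum_le_mem _ (fun i => (i \in B) && (i != p)) f r) => [i _|]; rewrite ?f0 ?rB.
have : m r u <= \sum_(q in U) m r q by apply: sum_le_mem.
by have := fU r rB; lia.
Qed.

Context (D D' : V -> int) (y : V) (N : {set V}).
Context (m_sym : forall p q, m p q = m q p).
Context (H_neq : forall p q, p \notin U -> q \notin U -> 0 < m p q -> H p != H q).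
Context (D_indeg : forall p, p \notin U -> D p = \sum_(q | H q < H p) m p q - 1).

(** At a lowest vertex of [Z] every arrow arrives from outside [Z], so the indegree is at most the
    number of edges leaving [Z]; the summand -1 makes the inequality strict. *)
Lemma indegree_burns (Z : {set V}) : Z != set0 -> [disjoint Z & U] ->
  exists2 p, p \in Z & D p < \sum_(q | q \notin Z) m p q.
Proof.
move=> Z0 ZU; have [p pZ Hp] := burn_minimum Z0 ZU.
exists p => //; rewrite D_indeg ?(disjointFr ZU pZ) //.
suff : \sum_(q | H q < H p) m p q <= \sum_(q | q \notin Z) m p q by lia.
rewrite big_mkcond [leRHS]big_mkcond; apply: ler_sum => q _.
case: ifP => qp; last by case: ifP.
by case: ifPn => // /negPn/Hp; rewrite leNgt qp.
Qed.

(* Counting edges: a set burnt from [y] with respect to [D'] inside [N] is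
   entered by exactly one arrow of the orientation along [H], and no edge leaves
   [N] from it; the burning therefore continues inside [N] until it reaches [U],
   where a second arrow is found. *)
Lemma no_double_burning : U != set0 -> y \notin U -> y \in N -> D' y <= 0 ->
  (forall p, 0 <= D' p) ->
  (forall Z : {set V}, Z != set0 -> y \notin Z ->
     exists2 p, p \in Z & D' p < \sum_(q | q \notin Z) m p q) ->
  (forall p, p \in N -> p \notin U -> D p + \sum_(q | q \notin N) m p q <= D' p) ->
  False.
Proof.
move=> U0 yU yN D'y D'0 red DN.
(* [e B] counts every edge inside [B] once, at its higher end. The last clause of [good] sums what
   burning guarantees: a vertex catching fire has fewer chips than edges to the burnt set, which
   gains 1 for every vertex of [B] except [y]. *)
pose e (B : {set V}) := \sum_(p in B) \sum_(q | (H q < H p) && (q \in B)) m p q.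
pose good (B : {set V}) := [&& y \in B, [disjoint B & U], B \subset N &
  \sum_(p in B) D' p <= e B - #|B|%:Z + 1].
have good1 : good [set y].
  rewrite /good set11 sub1set yN disjoints1 yU big_set1 cards1 /= /e big_set1 big1 ?addNr //.
  by move=> q /andP[Hq /set1P qy]; rewrite qy ltxx in Hq.
have [B /and4P[yB BU BN BD] Bmax] := @arg_maxnP _ [set y] good (fun B => #|B|) good1.
have B0 : B != set0 by apply/set0Pn; exists y.
have BnU p : p \in B -> p \notin U by move=> pB; rewrite (disjointFr BU pB).
have [in1 in2] := in_flow_ge1 B0 BU.
(* After summing [DN] over [B] and inserting the indegrees, [e B] and the number of vertices cancel
   against the bound in [good]; the remaining 1 bounds the arrows entering [B] and the edges leaving
   [N] together. *)
have key : in_flow B + \sum_(p in B) \sum_(q | q \notin N) m p q <= 1.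
  have : \sum_(p in B) (D p + \sum_(q | q \notin N) m p q) <= \sum_(p in B) D' p.
    by apply: ler_sum => p pB; apply: DN; [exact: (subsetP BN)|exact: BnU].
  rewrite big_split /=; have -> : \sum_(p in B) D p = e B + in_flow B - #|B|%:Z.
    rewrite /e /in_flow -big_split /=.
    rewrite (eq_bigr (fun p => (\sum_(q | (H q < H p) && (q \in B)) m p q +
      \sum_(q | (H q < H p) && (q \notin B)) m p q) - 1)); last first.
      by move=> p pB; rewrite D_indeg ?BnU // [in LHS](bigID (mem B)).
    rewrite big_split /= sumrN sumr_const -[X in _ - X]/(#|B|%:R).
    by rewrite natz.
  by rewrite -/(in_flow B); lra.
have leave0 p q : p \in B -> q \notin N -> m p q = 0.
  move=> pB qN; apply/eqP; rewrite eq_le m_ge0 andbT.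
  apply: (@le_trans _ _ (\sum_(p in B) \sum_(q | q \notin N) m p q)).
    2: by rewrite -(lerD2l (in_flow B)) addr0; apply: le_trans key in1.
  apply: (@le_trans _ _ (\sum_(q | q \notin N) m p q)).
    by apply: (@sum_le_mem _ (fun q => q \notin N)).
  apply: (@sum_le_mem _ (mem B) (fun p => \sum_(q | q \notin N) m p q)) => // r _.
  exact: sumr_ge0.
(* The next vertex [p] to burn; it lies in [N] since by [leave0] no edge leaves [N] from [B]. *)
have [||p] := red (~: B).
- have /set0Pn[u uU] := U0; apply/set0Pn; exists u; rewrite inE.
  by apply: contraL uU; exact: BnU.
- by rewrite inE yB.
rewrite inE => pB; rewrite (eq_bigl (mem B)); last by move=> q; rewrite !inE negbK.
rewrite -/(\sum_(q in B) m p q) => D'p.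
have [q qB mpq] : exists2 q, q \in B & 0 < m p q.
  apply/exists_inP; apply: contraT => /exists_inPn nq.
  have : \sum_(q in B) m p q <= 0.
    by apply: sumr_le0 => q /nq; rewrite -leNgt.
  by have := D'0 p; move: D'p; rewrite /=; lia.
have pN : p \in N.
  by apply: contraT => pN; have := leave0 q p qB pN; rewrite m_sym => E; rewrite E ltxx in mpq.
have [pU|pU] := boolP (p \in U).
  have in_ge2 : 2 <= in_flow B.
    by apply: in2; exists q, p; split=> //; rewrite m_sym.
  have leave_ge0 : 0 <= \sum_(p in B) \sum_(q | q \notin N) m p q.
    by apply: sumr_ge0 => r _; exact: sumr_ge0.
  by have := le_trans (lerD in_ge2 leave_ge0) key; rewrite addr0.
suff /Bmax : good (p |: B) by rewrite /= cardsU1 pB add1n ltnn.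
rewrite /good; apply/and4P; split.
- by rewrite !inE yB orbT.
- rewrite -setI_eq0; apply/eqP/setP => r; rewrite !inE.
  by case: eqP => [->|_] /=; rewrite ?(negPf pU) //; apply/negP => /andP[/BnU/negPf->].
- by rewrite subUset sub1set pN.
rewrite cardsU1 pB /= big_setU1 //= PoszD.
(* The new edges join [p] to [B]. Each is counted at [p] or at its other end, whichever is higher;
   [H_neq] excludes ties. *)
suff -> : e (p |: B) = e B + \sum_(q in B) m p q.
  move: D'p BD; set S := \sum_(q in B) m p q; set S' := \sum_(q in B) D' q => D'p BD.
  rewrite -/S'; clearbody S S'; move: (e B) (D' p) #|B| D'p BD => a b c; clear; lia.
rewrite {1}/e big_setU1 //=.
have -> : \sum_(q0 | (H q0 < H p) && (q0 \in p |: B)) m p q0 =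
    \sum_(r in B) (if H r < H p then m p r else 0).
  rewrite -big_mkcondr; apply: eq_bigl => r; rewrite !inE andbC.
  by case: eqP => [->|_] //=; rewrite ltxx andbF.
have -> : \sum_(i in B) \sum_(q0 | (H q0 < H i) && (q0 \in p |: B)) m i q0 =
    e B + \sum_(r in B) (if H p < H r then m p r else 0).
  rewrite /e -big_split /=; apply: eq_bigr => r rB.
  rewrite [in LHS](bigID (fun q => q \in B)) /=; congr (_ + _).
    by apply: eq_bigl => s; rewrite !inE; case: (s \in B); rewrite ?orbT ?andbT ?andbF.
  have [pr|pr] := ifP.
    rewrite (big_pred1 p) ?(m_sym r) // => s; rewrite !inE.
    by case: eqP => [->|_] /=; [rewrite pr pB|case: (s \in B); rewrite ?andbF].
  rewrite big_pred0 // => s; rewrite !inE.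
  by case: eqP => [->|_] /=; [rewrite pr|case: (s \in B); rewrite ?andbF].
rewrite addrCA -big_split /=; congr (_ + _); apply: eq_bigr => r rB.
case: (ltgtP (H p) (H r)) => [||E]; rewrite ?addr0 ?add0r //.
apply/esym/eqP; rewrite eq_le m_ge0 andbT leNgt; apply/negP => mpr.
by have := H_neq pU (BnU r rB) mpr; rewrite E eqxx.
Qed.

End Burning.
End FiniteGraph.

(* Imported only here: the notations for sets of the classical library hide those
   for finite sets used above. *)
From mathcomp Require Import all_classical all_reals all_analysis.
From mathcomp Require Import freeg.
Import numFieldTopology.Exports numFieldNormedType.Exports.

Local Open Scope classical_set_scope.
Local Open Scope ring_scope.

(** * Piecewise linear functions *)

Definition affine_on (R : realType) (g : R -> R) (u v : R) : Prop :=
  exists m : int, forall t, u <= t <= v -> g t = g u + m%:~R * (t - u).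

(** The list [s] may be unsorted and contain irrelevant points, so that breakpoints can be added at
    will and sums only concatenate lists. *)
Definition pl_breaks (R : realType) (s : seq R) (a b : R) (g : R -> R) : Prop :=
  forall u v, a <= u -> u < v -> v <= b ->
    (forall w, w \in s -> ~~ (u < w < v)) -> affine_on g u v.

Definition pl (R : realType) (a b : R) (g : R -> R) : Prop :=
  exists s, pl_breaks s a b g.

Fixpoint pl_path (R : realType) (g : R -> R) (a : R) (l : seq R) : Prop :=
  if l is x :: l' then affine_on g a x /\ pl_path g x l' else True.

Section PiecewiseLinear.
Context (R : realType).
Implicit Types (g : R -> R) (a b u v t w : R) (s l : seq R).

Lemma min_le2 u v : Num.min u v <= u /\ Num.min u v <= v.
Proof. by rewrite !ge_min !lexx orbT. Qed.

Lemma affine_on_sub g a b u v : a <= u -> v <= b -> u <= v ->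
  affine_on g a b -> affine_on g u v.
Proof.
move=> au vb uv [m gm]; exists m => t /andP[ut tv].
by rewrite (gm t) ?(gm u); [ring|lra|lra].
Qed.

Lemma path_last_ge a l : path <%R a l -> a <= last a l.
Proof.
elim: l a => //= x l IH a /andP[ax /IH]; apply: le_trans; exact: ltW.
Qed.

Lemma pl_breaks_sub s s' a b g : {subset s <= s'} -> pl_breaks s a b g -> pl_breaks s' a b g.
Proof. by move=> ss' sg u v au uv vb H; apply: sg => // w /ss'; exact: H. Qed.

Lemma pl_sub a b u v g : a <= u -> v <= b -> pl a b g -> pl u v g.
Proof.
move=> au vb [s sg]; exists s => x y ux xy yv; apply: sg => //.
  exact: le_trans ux. exact: le_trans vb.
Qed.

Lemma pl_path_breaks g a l : path <%R a l -> pl_path g a l ->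
  pl_breaks l a (last a l) g.
Proof.
elim: l a => [a _ _ u v au uv vb _|x l IH a /= /andP[ax pl] [ga gl] u v au uv vb H].
  by have := le_lt_trans (le_trans au (ltW uv)) (le_lt_trans vb _); move: au uv vb => /=; lra.
have [ux|xu] := ltP u x.
  have vx : v <= x by have := H x (mem_head _ _); rewrite ux /= -leNgt.
  exact: affine_on_sub au vx (ltW uv) ga.
apply: (IH x) => // w wl; apply: H; by rewrite inE wl orbT.
Qed.

Lemma sorted_pl_path g s a b l : pl_breaks s a b g -> path <%R a l ->
  last a l = b -> (forall w, w \in s -> a < w < b -> w \in l) -> pl_path g a l.
Proof.
elim: l a => //= x l IH a sg /andP[ax pxl] lb H.
have xb : x <= b by rewrite -lb; exact: path_last_ge.
have xl w : w \in l -> x < w.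
  by move=> wl; move: pxl => /(order_path_min lt_trans)/allP; exact.
split.
  apply: sg => // w ws; apply/negP => /andP[aw wx].
  have := H w ws; rewrite aw (lt_le_trans wx xb) inE => /(_ isT)/orP[/eqP|/xl]; lra.
apply: IH => //.
  move=> u v xu; apply: sg; exact: le_trans (ltW ax) xu.
move=> w ws /andP[xw wb]; have := H w ws; rewrite wb (lt_trans ax xw) inE.
by move=> /(_ isT)/orP[/eqP wx|//]; rewrite wx ltxx in xw.
Qed.

Lemma pl_pl_path g a b : a < b -> pl a b g ->
  exists l, [/\ path <%R a l, last a l = b & pl_path g a l].
Proof.
move=> ab [s sg].
pose l := sort <=%R (undup [seq w <- s | a < w < b]).
have pl : path <%R a (rcons l b).
  rewrite rcons_path; apply/andP; split.
    rewrite (path_sortedE lt_trans); apply/andP; split.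
      by apply/allP => w; rewrite mem_sort mem_undup mem_filter => /andP[/andP[]].
    by rewrite sort_lt_sorted undup_uniq.
  have : last a l \in a :: l by exact: mem_last.
  rewrite inE => /orP[/eqP->//|].
  by rewrite mem_sort mem_undup mem_filter => /andP[/andP[]].
exists (rcons l b); split=> //; first by rewrite last_rcons.
apply: sorted_pl_path sg pl _ _; first by rewrite last_rcons.
by move=> w ws awb; rewrite mem_rcons inE mem_sort mem_undup mem_filter awb ws orbT.
Qed.

Lemma pl_path_nth (g : R -> R) a b l : pl_path g a l <->
  forall i, (i < size l)%N -> affine_on g (nth b (a :: l) i) (nth b l i).
Proof.
elim: l a => [|x l IH] a; first by split.
split=> [[ax /IH xl] [|i] //= il|H]; first exact: xl.
split; first exact: (H 0%N). by apply/IH => i il; exact: (H i.+1).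
Qed.

Lemma piecewise_linear_intP a b g : a < b -> piecewise_linear_int a b g <-> pl a b g.
Proof.
move=> ab; split=> [[s [[ps /eqP ls] sg]]|/(pl_pl_path ab)[l [pl ll gl]]].
  exists s; rewrite -[b]ls; apply: pl_path_breaks => //.
  by apply/(pl_path_nth _ _ b) => i /sg.
exists l; split; first by split; [|apply/eqP].
by move=> i il; exact: (pl_path_nth _ _ b _).1 gl i il.
Qed.

Lemma pl_right g a b t : pl a b g -> a <= t -> t < b ->
  exists e, [/\ 0 < e, t + e <= b & affine_on g t (t + e)].
Proof.
move=> [s sg] at' tb.
have [e [e0 teb He]] : exists e, [/\ 0 < e, t + e <= b &
    forall w, w \in s -> ~~ (t < w < t + e)].
  elim: s {sg} => [|x s [e [e0 teb He]]]; first by exists (b - t); split => //; lra.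
  have [xt|tx] := leP x t.
    exists e; split=> // w; rewrite inE => /orP[/eqP->|/He//].
    by rewrite (ltNge t x) xt.
  exists (Num.min e (x - t)).
  have [m1 m2] := min_le2 e (x - t).
  have m0 : 0 < Num.min e (x - t) by rewrite lt_min e0 /=; lra.
  set m := Num.min _ _ in m0 m1 m2 *; split=> //; first by lra.
  move=> w; rewrite inE => /orP[/eqP->|/He H]; apply/negP => H'; first by lra.
  by move/negP: H; apply; lra.
by exists e; split=> //; apply: sg => //; lra.
Qed.

Lemma pl_left g a b t : pl a b g -> a < t -> t <= b ->
  exists e, [/\ 0 < e, a <= t - e & affine_on g (t - e) t].
Proof.
move=> [s sg] at' tb.
have [e [e0 teb He]] : exists e, [/\ 0 < e, a <= t - e &
    forall w, w \in s -> ~~ (t - e < w < t)].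
  elim: s {sg} => [|x s [e [e0 teb He]]]; first by exists (t - a); split => //; lra.
  have [xt|tx] := leP t x.
    exists e; split=> // w; rewrite inE => /orP[/eqP->|/He//].
    by rewrite (ltNge x t) xt andbF.
  exists (Num.min e (t - x)).
  have [m1 m2] := min_le2 e (t - x).
  have m0 : 0 < Num.min e (t - x) by rewrite lt_min e0 /=; lra.
  set m := Num.min _ _ in m0 m1 m2 *; split=> //; first by lra.
  move=> w; rewrite inE => /orP[/eqP->|/He H]; apply/negP => H'; first by lra.
  by move/negP: H; apply; lra.
by exists e; split=> //; apply: sg => //; lra.
Qed.

Lemma plD a b g (h : R -> R) : pl a b g -> pl a b h -> pl a b (fun t => g t + h t).
Proof.
move=> [s sg] [s' sh]; exists (s ++ s') => u v au uv vb H.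
have [m gm] : affine_on g u v by apply: sg => // w ws; apply: H; rewrite mem_cat ws.
have [n hn] : affine_on h u v by apply: sh => // w ws; apply: H; rewrite mem_cat ws orbT.
by exists (m + n) => t tuv; rewrite gm // hn // intrD; ring.
Qed.

Lemma plN a b g : pl a b g -> pl a b (fun t => - g t).
Proof.
move=> [s sg]; exists s => u v au uv vb H; have [m gm] := sg u v au uv vb H.
by exists (- m) => t tuv; rewrite gm // intrN; ring.
Qed.

Lemma pl_cst a b c : pl a b (fun=> c : R).
Proof. by exists [::] => u v _ _ _ _; exists 0 => t _; rewrite mul0r addr0. Qed.

Lemma pl_eq a b g (h : R -> R) : (forall t, a <= t <= b -> g t = h t) -> pl a b g -> pl a b h.
Proof.
move=> gh [s sg]; exists s => u v au uv vb H; have [m gm] := sg u v au uv vb H.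
have ab x : u <= x <= v -> a <= x <= b by move=> /andP[ux xv]; lra.
exists m => t tuv; have E1 := gh t (ab t tuv); have E2 := gh u (ab u _).
by rewrite -E1 -E2 ?lexx ?(ltW uv) //; apply: gm.
Qed.

Definition slope_bounded (K a b : R) g : Prop :=
  forall u v, a <= u -> u < v -> v <= b -> forall m : int,
    (forall t, u <= t <= v -> g t = g u + m%:~R * (t - u)) -> `|m%:~R| <= K :> R.

Lemma pl_lipschitz K a b g : pl a b g -> slope_bounded K a b g ->
  forall u v, a <= u -> u <= v -> v <= b -> `|g v - g u| <= K * (v - u).
Proof.
move=> plg gK u v au uv vb; have [uv'|vu] := ltP u v; last first.
  have -> : v = u by lra. by rewrite !subrr normr0 mulr0.
have := pl_pl_path uv' (pl_sub au vb plg) => -[l [pl ll]].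
have : slope_bounded K u v g.
  by move=> x y ux xy yv; apply: gK => //; lra.
elim: l u v pl ll {au uv uv' vb gK plg} => [|x l IH] u v /= pul ll gK.
  by rewrite ll !subrr normr0 mulr0.
move=> [[m gm] gl]; move/andP: pul => [ux xl].
have xv : x <= v by rewrite -ll; exact: path_last_ge.
have := IH x v xl ll _ gl => /(_ _)IHx.
have Hm : `|m%:~R| <= K :> R by apply: (gK u x).
have Hx : g x - g u = m%:~R * (x - u) by rewrite gm ?lexx ?ltW //; ring.
have -> : g v - g u = (g v - g x) + (g x - g u) by ring.
apply: le_trans (ler_normD _ _) _.
have -> : K * (v - u) = K * (v - x) + K * (x - u) by ring.
apply: lerD.
  by apply: IHx => y z xy yz zv; apply: gK => //; lra.
rewrite Hx normrM (ger0_norm (_ : 0 <= x - u)); last by lra.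
by rewrite ler_wpM2r //; lra.
Qed.

Lemma pl_slope_bounded a b g : pl a b g -> exists2 K, 0 <= K & slope_bounded K a b g.
Proof.
move=> plg; have [ab|ba] := ltP a b; last first.
  exists 0 => // u v au uv vb; lra.
have [l [pl ll gl]] := pl_pl_path ab plg.
elim: l a pl ll gl {ab plg} => [|x l IH] a /= pal ll gl.
  by exists 0 => // u v au uv vb; lra.
case: gl => -[m gm] gl; move/andP: pal => [ax xl].
have [K K0 HK] := IH x xl ll gl.
exists (Num.max K `|m%:~R|); first by rewrite le_max K0.
move=> u v au uv vb n gn; rewrite le_max.
have [ux|xu] := ltP u x; last first.
  by rewrite (HK u v).
apply/orP; right.
have /andP[tu tv] : u < Num.min v x <= v by rewrite lt_min uv ux ge_min lexx.
have tx : Num.min v x <= x by rewrite ge_min lexx orbT.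
have := gn (Num.min v x); have := gm (Num.min v x); have := gm u.
rewrite !(ltW tu) tv tx /= au (ltW ux) (le_trans au (ltW tu)) => -> // -> // /(_ isT).
set t := Num.min _ _ in tu *; move=> E.
have {E} : (m%:~R - n%:~R) * (t - u) = 0 :> R by nra.
by move=> /eqP; rewrite mulf_eq0 subr_eq0 => /orP[/eqP->//|]; lra.
Qed.

(** Both slopes point away from [t], so [m + n] is the order at [t]: convexity is the nonnegativity
    of the order at interior points. *)
Definition locally_convex a b g : Prop :=
  forall t, a < t -> t < b -> forall (m n : int) e, 0 < e ->
    (forall h, 0 <= h <= e -> g (t + h) = g t + m%:~R * h) ->
    (forall h, 0 <= h <= e -> g (t - h) = g t + n%:~R * h) -> 0 <= m + n.

Lemma convex_right a b g : pl a b g -> locally_convex a b g ->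
  forall t, a <= t -> forall (m : int) e, 0 < e -> t + e <= b ->
    (forall h, 0 <= h <= e -> g (t + h) = g t + m%:~R * h) ->
    forall u, t <= u -> u <= b -> g t + m%:~R * (u - t) <= g u.
Proof.
move=> plg cvx t at' m e e0 teb gm u tu ub.
have tb : t < b by lra.
have [l [pl ll gl]] := pl_pl_path tb (pl_sub at' (lexx b) plg).
have {cvx} : locally_convex t b g by move=> x tx xb; apply: cvx => //; lra.
elim: l t pl ll gl {tb at'} m e e0 gm teb tu => [t|x l IH t] /= pl ll gl m e e0 gm teb tu cvx.
  by lra.
case: gl => -[n gn] gl; move/andP: pl => [tx xl].
have mn : m = n.
  pose d := Num.min e (x - t).
  have d0 : 0 < d by rewrite lt_min e0 /=; lra.
  have de : d <= e by rewrite ge_min lexx.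
  have dx : d <= x - t by rewrite ge_min lexx orbT.
  have := gm d; have := gn (t + d); rewrite de (ltW d0) => -> ; last by lra.
  move=> /(_ isT) E; have {E}/eqP : (m%:~R - n%:~R) * d = 0 :> R by nra.
  rewrite mulf_eq0 subr_eq0 => /orP[/eqP/intr_inj//|/eqP d00]; by move: d0; rewrite d00 ltxx.
subst n.
have [ux|xu] := leP u x; first by rewrite (gn u); [lra|rewrite tu ux].
have xb : x < b by lra.
case: l IH gl xl ll => [|y l] IH gl xl ll; first by move: ll => /=; lra.
case: (gl) => -[n' gn'] _; move: (xl) => /= /andP[xy yl].
have yb : y <= b by rewrite -ll; exact: path_last_ge.
have E := IH x xl ll gl n' (y - x).
have {E} : g x + n'%:~R * (u - x) <= g u.
  apply: E; try lra.
    by move=> h hy; rewrite gn'; [congr (_ + _ * _); ring|lra].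
  by move=> z xz; apply: cvx; lra.
have mn' : m%:~R <= n'%:~R :> R.
  rewrite ler_int -subr_ge0; apply: (cvx x _ _ _ _ (Num.min (y - x) (x - t))); try lra.
  - by rewrite lt_min; lra.
  - move=> h; rewrite le_min => hy; rewrite gn'; last by lra.
    by congr (_ + _ * _); ring.
  - move=> h; rewrite le_min => hy; rewrite intrN (gn (x - h)); last by lra.
    by rewrite (gn x); [ring|lra].
apply: le_trans; rewrite (gn x); last by lra.
nra.
Qed.

Lemma convex_left a b g : pl a b g -> locally_convex a b g ->
  forall t, t <= b -> forall (m : int) e, 0 < e -> a <= t - e ->
    (forall h, 0 <= h <= e -> g (t - h) = g t + m%:~R * h) ->
    forall u, a <= u -> u <= t -> g t + m%:~R * (t - u) <= g u.
Proof.
move=> [s sg] cvx t tb m e e0 aet gm u au ut.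
have := @convex_right (- b) (- a) (fun x => g (- x)) _ _ (- t) _ m e e0 _ _ (- u) _ _.
rewrite !opprK => H.
have -> : t - u = - u + t by ring.
apply: H; try lra.
- exists [seq - w | w <- s] => x y bx xy ya Hs.
  have [|||w ws|n gn] := sg (- y) (- x); try lra.
    have := Hs (- w); rewrite map_f // => /(_ isT); lra.
  exists (- n) => z xyz; rewrite (gn (- z)); last by lra.
  rewrite (gn (- x)); last by lra.
  by rewrite intrN; ring.
- move=> x bx xa n n' d d0 gn gn'.
  rewrite addrC; apply: (cvx (- x) _ _ _ _ d) => //; try lra.
    by move=> h hd; rewrite -gn' //; congr g; ring.
  by move=> h hd; rewrite -gn //; congr g; ring.
- by move=> h hd; rewrite -gm //; congr g; ring.
Qed.

(** The line is a one-sided tangent: to the right of [t], or to the left when [t = b]. The interval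
    [[u, v]] exhibits [m] as a slope of [g], so that bounds on slopes apply to it. *)
Lemma convex_support a b g t : a < b -> pl a b g -> locally_convex a b g ->
  a <= t <= b -> exists u v (m : int), [/\ a <= u, u < v, v <= b & 
    (forall x, u <= x <= v -> g x = g u + m%:~R * (x - u)) /\
    forall x, a <= x <= b -> g t + m%:~R * (x - t) <= g x].
Proof.
move=> ab plg cvx /andP[at' tb].
have [tb'|bt] := ltP t b; last first.
  have tE : t = b by lra.
  subst t; have [e [e0 abe [m gm]]] := pl_left plg ab (lexx b).
  exists (b - e), b, m; split; [lra|lra|lra|split=> // x /andP[ax xb]].
  have := @convex_left a b g plg cvx b (lexx b) (- m) e e0 abe _ x ax xb.
  rewrite intrN => H; apply: le_trans (H _); first by lra.
  move=> h he; rewrite (gm (b - h)); last by lra.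
  by rewrite (gm b); [ring|lra].
have [e [e0 abe [m gm]]] := pl_right plg at' tb'.
have gm' h : 0 <= h <= e -> g (t + h) = g t + m%:~R * h.
  by move=> he; rewrite gm; [congr (_ + _ * _); ring|lra].
exists t, (t + e), m; split; [lra|lra|lra|split=> // x /andP[ax xb]].
have [tx|xt] := leP t x; first exact: (convex_right plg cvx at' e0).
have [d [d0 ad [n gn]]] := pl_left plg (le_lt_trans ax xt) tb.
have gn' h : 0 <= h <= d -> g (t - h) = g t + (- n)%:~R * h.
  move=> hd; rewrite intrN (gn (t - h)); last by lra.
  by rewrite (gn t); [ring|lra].
have := @convex_left a b g plg cvx t tb (- n) d d0 ad gn' x ax (ltW xt).
apply: le_trans.
have : (n%:~R : R) <= m%:~R.
  rewrite ler_int -subr_ge0; apply: (cvx t _ _ _ _ (Num.min e d)); try lra.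
  - by rewrite lt_min e0 d0.
  - by move=> h; rewrite le_min => hd; apply: gm'; lra.
  - by move=> h; rewrite le_min => hd; apply: gn'; lra.
rewrite intrN; nra.
Qed.

(* Away from the pairwise crossing points, one of the lines dominates. *)
Lemma pl_max_lines a b g (C : int -> R) (I : seq int) :
  (forall t m, a <= t <= b -> m \in I -> C m + m%:~R * t <= g t) ->
  (forall t, a <= t <= b -> exists2 m, m \in I & g t = C m + m%:~R * t) ->
  pl a b g.
Proof.
move=> geC eqC.
exists [seq (C m.1 - C m.2) / (m.2%:~R - m.1%:~R) | m <- [seq (m, n) | m <- I, n <- I]].
move=> u v au uv vb H.
pose c := (u + v) / 2.
have cab : a <= c <= b by rewrite /c; lra.
have [m mI gc] := eqC c cab.
suff E t : u <= t <= v -> g t = C m + m%:~R * t.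
  exists m => t tuv; have Eu : g u = C m + m%:~R * u by apply: E; lra.
  by rewrite (E t tuv) Eu; ring.
move=> tuv; have tab : a <= t <= b by lra.
have [n nI gt] := eqC t tab.
apply/eqP; rewrite eq_le geC ?andbT //.
have [nm|mn] := eqVneq n m; first by rewrite gt nm.
pose w := (C m - C n) / (n%:~R - m%:~R).
have {H} /negP : ~~ (u < w < v).
  apply: H; apply/mapP; exists (m, n) => //; apply/allpairsP; by exists (m, n).
have nm0 : n%:~R - m%:~R != 0 :> R by rewrite subr_eq0 eqr_int.
have wE : w * (n%:~R - m%:~R) = C m - C n by rewrite /w mulfVK.
have cuv : u < c < v by rewrite /c; lra.
have gcn : C n + n%:~R * c <= C m + m%:~R * c by rewrite -gc; apply: geC => //; lra.
rewrite leNgt gt => H; apply/negP => H'; apply: H.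
have d1 : (n%:~R - m%:~R) * (c - w) <= 0 by lra.
have d2 : 0 < (n%:~R - m%:~R) * (t - w) by lra.
move: (n%:~R - m%:~R) nm0 d1 d2 => d d0 d1 d2.
have [dp|dn|d00] := ltgtP d 0; last by rewrite d00 eqxx in d0.
  by apply/andP; split; nra.
by apply/andP; split; nra.
Qed.

End PiecewiseLinear.

Section PiecewiseLinearGlue.
Context (R : realType).
Implicit Types (g : R -> R) (a b c u v t w : R) (s l : seq R).

Lemma pl_cat a b c g : a <= c -> c <= b -> pl a c g -> pl c b g -> pl a b g.
Proof.
move=> ac cb [s1 H1] [s2 H2]; exists (c :: s1 ++ s2) => u v au uv vb H.
have [uc|cu] := ltP u c.
  have vc : v <= c by have := H c (mem_head _ _); rewrite uc /= -leNgt.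
  by apply: H1 => // w ws; apply: H; rewrite inE mem_cat ws orbT.
by apply: H2 => // w ws; apply: H; rewrite inE mem_cat ws !orbT.
Qed.

Lemma pl_local s a b g :
  (forall u v, a <= u -> u < v -> v <= b -> (forall w, w \in s -> ~~ (u < w < v)) -> pl u v g) ->
  pl a b g.
Proof.
elim: s a b => [|x s IH] a b H.
  have [ab|ba] := ltP a b; first exact: H.
  by exists [::] => u v au uv vb; lra.
have Hx u v : a <= u -> v <= b -> ~~ (u < x < v) -> pl u v g.
  move=> au vb xuv; apply: IH => u' v' uu uv vv Hs; apply: H; [lra|lra|lra|].
  move=> w; rewrite inE => /orP[/eqP->|/Hs//].
  by apply: contra xuv => H'; lra.
have [/andP[ax xb]|] := boolP (a < x < b); last exact: Hx.
apply: (@pl_cat a b x); [exact: ltW|exact: ltW| |].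
- by apply: Hx => //; [exact: ltW|rewrite ltxx andbF].
- by apply: Hx => //; [exact: ltW|rewrite ltxx].
Qed.

End PiecewiseLinearGlue.

(** * Rays and neighborhoods *)

(* A direction at [p] is an edge together with an orientation of it ([true]
   from [src] to [tgt]). *)
Definition dir_at (R : realType) (G : metricGraph R) (p : gpoint G)
    (d : edge G * bool) : bool :=
  match p with
  | Vertex v => (if d.2 then src d.1 else tgt d.1) == v
  | Inner e _ => d.1 == e
  end.

(** At a vertex, the end of the edge from which [d] departs. The value is meaningful under
    [dir_at]. *)
Definition pos (R : realType) (G : metricGraph R) (p : gpoint G)
    (d : edge G * bool) : R :=
  match p with
  | Vertex v => if d.2 then 0 else len d.1
  | Inner e t => val t
  end.

Definition ray (R : realType) (G : metricGraph R) (p : gpoint G)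
    (d : edge G * bool) (h : R) : gpoint G :=
  edge_pt d.1 (if d.2 then pos p d + h else pos p d - h).

Definition ray_len (R : realType) (G : metricGraph R) (p : gpoint G)
    (d : edge G * bool) : R :=
  if d.2 then len d.1 - pos p d else pos p d.

Definition slope (R : realType) (G : metricGraph R) (F : gpoint G -> R)
    (p : gpoint G) (d : edge G * bool) : int :=
  init_slope (fun h => F (ray p d h)).

Section Rays.
Context (R : realType) (G : metricGraph R).
Implicit Types (p q : gpoint G) (d : edge G * bool) (e : edge G) (t h : R)
  (F : gpoint G -> R).

Lemma edge_pt_src e t : t <= 0 -> edge_pt e t = Vertex (src e).
Proof.
move=> t0; rewrite /edge_pt; case: insubP => [u /andP[]|_]; last by rewrite t0.
by rewrite ltNge t0.
Qed.

Lemma edge_pt_tgt e t : len e <= t -> edge_pt e t = Vertex (tgt e).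
Proof.
move=> t0; rewrite /edge_pt; case: insubP => [u /andP[_]|_].
  by rewrite ltNge t0.
by rewrite leNgt (lt_le_trans (len_gt0 e) t0).
Qed.

Lemma edge_pt_inner e t (H : 0 < t < len e) : edge_pt e t = Inner e (exist _ t H).
Proof.
rewrite /edge_pt; case: insubP => [u tu ut|]; last by rewrite H.
by congr Inner; apply: val_inj.
Qed.

Lemma edge_pt_val e (u : {t : R | 0 < t < len e}) : edge_pt e (val u) = Inner e u.
Proof. by case: u => t H; rewrite edge_pt_inner. Qed.

Lemma pos_inner e t d : 0 < t < len e -> pos (edge_pt e t) d = t.
Proof. by move=> H; rewrite (edge_pt_inner H). Qed.

Lemma dir_at_inner e t d : 0 < t < len e -> dir_at (edge_pt e t) d = (d.1 == e).
Proof. by move=> H; rewrite (edge_pt_inner H). Qed.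

Lemma pos_bound p d : dir_at p d -> 0 <= pos p d <= len d.1.
Proof.
case: p => [v|e [t /= /andP[t0 t1]]] /=.
  by move=> _; case: d.2; rewrite lexx ltW ?len_gt0.
by move=> /eqP->; rewrite !ltW.
Qed.

Lemma ray_len_gt0 p d : dir_at p d -> 0 < ray_len p d.
Proof.
rewrite /ray_len; case: p => [v|e [t /= /andP[t0 t1]]] /=.
  by move=> _; case: d.2; rewrite ?subr0 len_gt0.
by move=> /eqP->; case: d.2; rewrite ?subr_gt0.
Qed.

Lemma ray0 p d : dir_at p d -> ray p d 0 = p.
Proof.
rewrite /ray addr0 subr0 if_same; case: p => [v|e t] /=.
  by case: d => e [] /= /eqP<-; [rewrite edge_pt_src|rewrite edge_pt_tgt].
by move=> /eqP->; exact: edge_pt_val.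
Qed.

Lemma ray_inner p d h : dir_at p d -> 0 < h -> h < ray_len p d ->
  0 < (if d.2 then pos p d + h else pos p d - h) < len d.1.
Proof.
move=> /pos_bound/andP[p0 pl]; rewrite /ray_len; case: d.2 => h0 hl; lra.
Qed.

Lemma edge_pt_pos p d : dir_at p d -> edge_pt d.1 (pos p d) = p.
Proof. by move=> /ray0; rewrite /ray addr0 subr0 if_same. Qed.

Lemma pos_edge_pt d t : 0 <= t <= len d.1 -> (t == len d.1 -> ~~ d.2) ->
  (t == 0 -> d.2) -> dir_at (edge_pt d.1 t) d /\ pos (edge_pt d.1 t) d = t.
Proof.
move=> /andP[]; rewrite le_eqVlt => /orP[/eqP<- _ _ /(_ (eqxx _)) d2|t0].
  by rewrite edge_pt_src //= d2 eqxx.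
rewrite le_eqVlt => /orP[/eqP-> /(_ (eqxx _)) d2 _|t1 _ _].
  by rewrite edge_pt_tgt //= (negPf d2) eqxx.
by rewrite dir_at_inner ?t0 // pos_inner ?t0.
Qed.

Lemma edge_pt_inj e t u : 0 <= t <= len e -> 0 <= u <= len e ->
  edge_pt e t = edge_pt e u -> t = u.
Proof.
have l0 := len_gt0 e; have sv := loopless e.
move=> /andP[]; rewrite le_eqVlt => /orP[/eqP<- _|t0].
  move=> /andP[]; rewrite le_eqVlt => /orP[/eqP<- //|u0].
  rewrite edge_pt_src // le_eqVlt => /orP[/eqP->|u1].
    by rewrite edge_pt_tgt // => -[st]; rewrite st eqxx in sv.
  by rewrite edge_pt_inner ?u0.
rewrite le_eqVlt => /orP[/eqP->|t1].
  move=> /andP[]; rewrite le_eqVlt => /orP[/eqP<-|u0 ].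
    by rewrite edge_pt_tgt // edge_pt_src // => _ -[st]; rewrite st eqxx in sv.
  rewrite edge_pt_tgt // le_eqVlt => /orP[/eqP->//|u1].
  by rewrite edge_pt_inner ?u0.
have tt : 0 < t < len e by rewrite t0.
rewrite -{2}(pos_inner (e, true) tt) => /andP[u0 u1] E.
have uu : 0 < u < len e.
  move: u0 u1 E; rewrite (edge_pt_inner tt).
  rewrite le_eqVlt => /orP[/eqP<-|u0]; first by rewrite edge_pt_src.
  by rewrite le_eqVlt => /orP[/eqP->|u1]; [rewrite edge_pt_tgt|rewrite u0].
by rewrite E pos_inner.
Qed.

Lemma sum_dirE p (f : edge G * bool -> int) :
  \sum_(d | dir_at p d) f d =
  \sum_(e | dir_at p (e, true)) f (e, true) + \sum_(e | dir_at p (e, false)) f (e, false).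
Proof.
rewrite big_mkcond (eq_bigr (fun d : edge G * bool =>
  if dir_at p (d.1, d.2) then f (d.1, d.2) else 0)); last by case.
rewrite -(pair_bigA _ (fun e b => if dir_at p (e, b) then f (e, b) else 0)) /=.
rewrite [in RHS]big_mkcond [X in _ = _ + X]big_mkcond -big_split /=.
by apply: eq_bigr => e _; rewrite big_bool.
Qed.

Lemma ordE F p : ord F p = \sum_(d | dir_at p d) slope F p d.
Proof.
rewrite sum_dirE; case: p => [v|e t] /=.
  congr (_ + _); apply: eq_bigr => e _; rewrite /slope /ray //=.
  by congr init_slope; apply: funext => h; rewrite add0r.
by rewrite !big_pred1_eq.
Qed.

Lemma open_gpointE (U : set (gpoint G)) :
  open U = forall e : edge G, open (edge_pt e @^-1` U).
Proof. by []. Qed.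

Lemma edge_pt_continuous e : continuous (@edge_pt R G e).
Proof. by apply/continuousP => U; rewrite open_gpointE; exact. Qed.

Lemma gpoint_continuousP (T : topologicalType) (F : gpoint G -> T) :
  continuous F <-> forall e : edge G, continuous (F \o edge_pt e).
Proof.
split=> [cF e t|cF].
  by apply: continuous_comp; [exact: edge_pt_continuous|exact: cF].
apply/continuousP => U oU; rewrite open_gpointE => e.
by rewrite -comp_preimage; move: (cF e) => /continuousP; exact.
Qed.

Lemma ray_continuous p d : continuous (ray p d).
Proof.
move=> h; apply: (@continuous_comp _ _ _ (fun h => if d.2 then pos p d + h else pos p d - h)).
  by case: d.2; [apply: cvgD|apply: cvgB]; [exact: cvg_cst|exact: cvg_id|exact: cvg_cst|exact: cvg_id].
exact: edge_pt_continuous.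
Qed.

Lemma ray_nbhs p d (N : set (gpoint G)) : dir_at p d -> nbhs p N ->
  exists2 r : R, 0 < r & forall h, 0 <= h < r -> N (ray p d h).
Proof.
move=> pd; rewrite -{1}(ray0 pd) => nN.
have := @ray_continuous p d 0 N nN; rewrite /= => /nbhs_ballP[e /= e0 He].
exists e => // h /andP[h0 he]; apply: He.
by rewrite /ball /= sub0r normrN ger0_norm.
Qed.

(** The property is asked for all smaller radii, so that a minimum over finitely many [x] still has
    it. *)
Lemma pos_common (T : finType) (P : pred T) (Q : T -> R -> Prop) :
  (forall x, P x -> exists2 r : R, 0 < r & forall r', 0 < r' -> r' <= r -> Q x r') ->
  exists2 r : R, 0 < r & forall r', 0 < r' -> r' <= r -> forall x, P x -> Q x r'.
Proof.
move=> H; suff [e e0 He] : exists2 e : R, 0 < e & forall e' : R, 0 < e' -> e' <= e ->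
    forall x, x \in enum P -> Q x e'.
  by exists e => // e' e'0 ee' x Px; apply: He => //; rewrite mem_enum.
have : {in enum P, forall x, P x} by move=> x; rewrite mem_enum.
elim: (enum P) => [_|x s IH Hs]; first by exists 1.
have [|e e0 He] := IH; first by move=> y ys; apply: Hs; rewrite inE ys orbT.
have [e1 e10 He1] := H x (Hs x (mem_head _ _)).
exists (Num.min e e1) => [|e' e'0]; first by rewrite lt_min e0.
rewrite le_min => /andP[ee ee1] y; rewrite inE => /orP[/eqP->|ys].
  exact: He1. exact: He.
Qed.

(** Finitely many directions leave [p], so one radius [e], at most every ray length, serves all of
    them, and the star of that radius is open. Neighborhoods are thereby tested along rays. *)
Lemma nbhs_ray p (N : set (gpoint G)) : N p ->
  (forall d, dir_at p d -> exists2 r : R, 0 < r & forall h, 0 < h < r -> N (ray p d h)) ->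
  nbhs p N.
Proof.
move=> Np HN.
have [e e0 He] : exists2 e : R, 0 < e & forall e' : R, 0 < e' -> e' <= e -> forall d,
    dir_at p d -> e' <= ray_len p d /\ forall h, 0 < h < e' -> N (ray p d h).
  apply: pos_common => d pd; have [e e0 He] := HN d pd.
  exists (Num.min e (ray_len p d)).
    by rewrite lt_min e0 ray_len_gt0.
  move=> e' e'0; rewrite le_min => /andP[ee el]; split=> // h /andP[h0 he].
  by apply: He; rewrite h0 (lt_le_trans he).
have {He} := He e e0 (lexx e).
case: p Np {HN} => [v|e1 [t t01]] Np He.
  rewrite nbhsE; exists [set q | q = Vertex v \/ exists d h,
      [/\ dir_at (Vertex v) d, 0 < h, h < e & q = ray (Vertex v) d h]].
    split; last by left.
    rewrite open_gpointE => e1.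
    (* Since [edge_pt e1] is constant beyond the ends of the interval, the preimage is a half-line
       at every end equal to [v]. *)
    have -> : edge_pt e1 @^-1` [set q | q = Vertex v \/ exists d h,
      [/\ dir_at (Vertex v) d, 0 < h, h < e & q = ray (Vertex v) d h]] =
      [set t | src e1 = v /\ t < e] `|` [set t | tgt e1 = v /\ len e1 - e < t].
      apply/seteqP; split=> t /=.
        have [t0|t0] := leP t 0.
          rewrite edge_pt_src // => -[[sv]|[[e2 b] [h [pd h0 he]]]].
            by left; split=> //; exact: le_lt_trans e0.
          have /= H1 := @ray_inner (Vertex v) (e2, b) h pd h0 (lt_le_trans he (He (e2, b) pd).1).
          by rewrite /ray /= edge_pt_inner.
        have [t1|t1] := leP (len e1) t.
          rewrite edge_pt_tgt // => -[[sv]|[[e2 b] [h [pd h0 he]]]].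
            by right; split=> //; lra.
          have /= H1 := @ray_inner (Vertex v) (e2, b) h pd h0 (lt_le_trans he (He (e2, b) pd).1).
          by rewrite /ray /= edge_pt_inner.
        have t01 : 0 < t < len e1 by rewrite t0.
        move=> [|[[e2 b] [h [pd h0 he]]]]; first by rewrite (edge_pt_inner t01).
        have /= H1 := @ray_inner (Vertex v) (e2, b) h pd h0 (lt_le_trans he (He (e2, b) pd).1).
        rewrite /ray /= => E.
        have := dir_at_inner (e2, true) H1; rewrite -E dir_at_inner //= eqxx => /eqP E2.
        subst e2; have := edge_pt_inj _ _ E.
        rewrite !ltW //=; [|by case/andP: H1..].
        move=> /(_ isT isT) => {}E; move: pd E; case: b H1 => /= H1 /eqP<- E.
          by left; split=> //; lra.
        by right; split=> //; lra.
      move=> [[sv te]|[sv te]].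
        have [t0|t0] := leP t 0; first by left; rewrite edge_pt_src // sv.
        right; exists (e1, true), t; split=> //=; first exact/eqP.
        by rewrite /ray /= add0r.
      have [t0|t0] := leP (len e1) t; first by left; rewrite edge_pt_tgt // sv.
      right; exists (e1, false), (len e1 - t); split=> /=; [exact/eqP|by rewrite subr_gt0|by rewrite ltrBlDl -ltrBlDr|].
      by rewrite /ray /= opprB addrC subrK.
    apply: openU.
      have [->|sv] := eqVneq (src e1) v.
        rewrite (_ : mkset _ = [set t | t < e]); first exact: open_lt.
        by apply/seteqP; split=> t //= [].
      rewrite (_ : mkset _ = set0); first exact: open0.
      by apply/seteqP; split=> t //= [/eqP]; rewrite (negPf sv).
    have [->|sv] := eqVneq (tgt e1) v.
      rewrite (_ : mkset _ = [set t | len e1 - e < t]); first exact: open_gt.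
      by apply/seteqP; split=> t //= [].
    rewrite (_ : mkset _ = set0); first exact: open0.
    by apply/seteqP; split=> t //= [/eqP]; rewrite (negPf sv).
  move=> q [->//|[d [h [pd h0 he ->]]]].
  by apply: (He d pd).2; rewrite h0.
have [/= l1 N1] := He (e1, true) (eqxx _).
have [/= l2 N2] := He (e1, false) (eqxx _).
rewrite /ray_len /= in l1 l2.
rewrite nbhsE; exists [set q | dir_at q (e1, true) /\ `|pos q (e1, true) - t| < e /\ 0 < pos q (e1, true)].
  split; last by rewrite /= eqxx subrr normr0; split=> //; split=> //; case/andP: (t01).
  rewrite open_gpointE => e2.
  have [->|e21] := eqVneq e2 e1; last first.
    rewrite (_ : _ @^-1` _ = set0); first exact: open0.
    apply/seteqP; split=> s //= [].
    have [s0|s0] := leP s 0.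
      by rewrite edge_pt_src //= ltxx => _ [].
    have [s1|s1] := leP (len e2) s.
      by rewrite edge_pt_tgt //= ltxx => _ [].
    by rewrite dir_at_inner ?s0 //= eq_sym (negPf e21).
  rewrite (_ : _ @^-1` _ = [set s | t - e < s] `&` [set s | s < t + e]).
    by apply: openI; [exact: open_gt|exact: open_lt].
  apply/seteqP; split=> s /=.
    have [s0|s0] := leP s 0.
      by rewrite edge_pt_src //= ltxx => -[_ []].
    have [s1|s1] := leP (len e1) s.
      by rewrite edge_pt_tgt //= ltxx => -[_ []].
    by rewrite pos_inner ?s0 //= => -[_ [H _]]; move: H; rewrite ltr_distl; lra.
  move=> H; have s01 : 0 < s < len e1 by lra.
  rewrite dir_at_inner // pos_inner //= eqxx; split=> //; split; last by case/andP: s01.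
  by rewrite ltr_distl; lra.
move=> q /= [qd [H q0]]; rewrite -(edge_pt_pos qd) /=.
move: (pos q (e1, true)) H q0 => s; rewrite ltr_distl => H q0.
have [st|ts|->] := ltgtP s t; last by rewrite (edge_pt_inner t01).
  rewrite (_ : edge_pt e1 s = ray (Inner e1 (exist _ t t01)) (e1, false) (t - s)); last first.
    by rewrite /ray /=; congr edge_pt; ring.
  by apply: N2; lra.
rewrite (_ : edge_pt e1 s = ray (Inner e1 (exist _ t t01)) (e1, true) (s - t)); last first.
  by rewrite /ray /=; congr edge_pt; ring.
by apply: N1; lra.
Qed.

End Rays.

(** * Rational functions and subdivisions *)

Definition rev_dir (G : Type) (d : G * bool) : G * bool := (d.1, ~~ d.2).

Section RationalFunctions.
Context (R : realType) (G : metricGraph R).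
Implicit Types (p q : gpoint G) (d : edge G * bool) (e : edge G) (t h k r : R)
  (F : gpoint G -> R).

Lemma edge_pt_clamp e t : edge_pt e t = edge_pt e (Num.max 0 (Num.min t (len e))).
Proof.
have l0 := len_gt0 e; rewrite /Num.min; case: ltP => tl.
  by rewrite /Num.max; case: ltP => // t0; rewrite !edge_pt_src.
rewrite /Num.max; case: ltP => l0'; last by exfalso; lra.
by rewrite !edge_pt_tgt.
Qed.

Lemma edge_pt_lipschitz_continuous F K : 0 <= K ->
  (forall e t u, 0 <= t -> t <= u -> u <= len e ->
    `|F (edge_pt e u) - F (edge_pt e t)| <= K * (u - t)) ->
  continuous F.
Proof.
move=> K0 FK; apply/gpoint_continuousP => e t.
pose c s := Num.max 0 (Num.min s (len e)).
have cl s : 0 <= c s <= len e.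
  have l0 := len_gt0 e; rewrite /c /Num.min; case: ltP => sl; rewrite /Num.max; case: ltP => ?; lra.
have cc s u : s <= u -> c s <= c u /\ c u - c s <= u - s.
  by move=> su; have l0 := len_gt0 e; rewrite /c /Num.min; case: ltP => sl; case: ltP => ul;
    rewrite /Num.max; case: ltP => ?; case: ltP => ?; lra.
have L s u : s <= u -> `|F (edge_pt e u) - F (edge_pt e s)| <= K * (u - s).
  move=> su; rewrite (edge_pt_clamp e u) (edge_pt_clamp e s) -/(c u) -/(c s).
  have [c1 c2] := cc s u su; have /andP[c3 _] := cl s; have /andP[_ c4] := cl u.
  by apply: le_trans (FK _ _ _ c3 c1 c4) _; rewrite ler_wpM2l.
apply/cvgrPdist_le => /= eps eps0; near=> s.
have Ks : (K + 1) * `|t - s| <= eps.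
  rewrite mulrC -ler_pdivlMr ?(ltr_wpDl K0) //.
  near: s; apply: cvgr_dist_le; first exact: cvg_id.
  by rewrite divr_gt0 // ltr_wpDl.
have : `|F (edge_pt e t) - F (edge_pt e s)| <= K * `|t - s|.
  have [ts|/ltW st] := leP t s.
    by rewrite distrC (distrC t) (ger0_norm (_ : 0 <= s - t)) ?subr_ge0 //; exact: L.
  by rewrite (ger0_norm (_ : 0 <= t - s)) ?subr_ge0 //; exact: L.
move=> H; apply: le_trans H (le_trans _ Ks).
by rewrite mulrDl mul1r lerDl.
Unshelve. all: by end_near.
Qed.

(** Bounded slopes make [F] Lipschitz along every edge, which yields the continuity; the sum of the
    [K e] is a single constant for all edges. *)
Lemma rationalP F :
  rational_function F <-> forall e, pl 0 (len e) (F \o edge_pt e).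
Proof.
split=> [[_ H] e|H]; first exact/(piecewise_linear_intP _ (len_gt0 e)).
split; last by move=> e; apply/(piecewise_linear_intP _ (len_gt0 e)).
have /choice[K HK] : forall e, exists K,
    0 <= K /\ slope_bounded K 0 (len e) (F \o edge_pt e).
  by move=> e; have [K K0 HK] := pl_slope_bounded (H e); exists K.
apply: (@edge_pt_lipschitz_continuous F (\sum_e K e)).
  by apply: sumr_ge0 => e _; exact: (HK e).1.
move=> e t u t0 tu ul.
have := pl_lipschitz (H e) (HK e).2 t0 tu ul => /= /le_trans; apply.
rewrite ler_wpM2r ?subr_ge0 // (bigD1 e) //= lerDl.
by apply: sumr_ge0 => e' _; exact: (HK e').1.
Qed.

Lemma init_slope_eq (u : R -> R) (m : int) r : 0 < r ->
  (forall h, 0 <= h <= r -> u h = u 0 + m%:~R * h) -> init_slope u = m.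
Proof.
move=> r0 um; apply: xget_unique => /=.
  near=> h; apply: um; apply/andP; split; first exact: ltW.
  by near: h; exact: nbhs_right_le.
move=> n un; apply/eqP; rewrite -(@eqr_int R); apply/eqP.
have [h [h0 hr]] : exists h, [/\ 0 < h, h <= r & u h = u 0 + n%:~R * h].
  near (0 : R)^'+ => h; exists h; split=> //.
    by near: h; exact: nbhs_right_le.
  by near: h.
rewrite um; last by rewrite ltW // hr.
by move=> /addrI /mulIf -> //; rewrite gt_eqF.
Unshelve. all: by end_near.
Qed.

Lemma ray_rev p d h : dir_at p d -> 0 < h -> h <= ray_len p d ->
  [/\ dir_at (ray p d h) (rev_dir d), h <= ray_len (ray p d h) (rev_dir d) &
      forall k, ray (ray p d h) (rev_dir d) k = ray p d (h - k)].
Proof.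
move=> pd h0 hl; have /andP[p0 pl] := pos_bound pd.
pose t := if d.2 then pos p d + h else pos p d - h.
have [|||H1 H2] := @pos_edge_pt _ G (rev_dir d) t.
- by move: hl; rewrite /t /ray_len /=; case: d.2 => hl; lra.
- by rewrite /t /=; case: d.2 => //; move=> /eqP; lra.
- by rewrite /t /=; case: d.2 => //; move=> /eqP; lra.
split; first exact: H1.
  by rewrite /ray -/t /= in H2 *; rewrite /ray_len H2 /t /=; case: d.2 => /=; lra.
move=> k; rewrite /ray /= -/t in H2 *; rewrite H2 /t.
by case: d.2 => /=; congr edge_pt; ring.
Qed.

Lemma ray_shift p d h : dir_at p d -> 0 < h -> h < ray_len p d ->
  [/\ dir_at (ray p d h) d, ray_len (ray p d h) d = ray_len p d - h &
      forall k, ray (ray p d h) d k = ray p d (h + k)].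
Proof.
move=> pd h0 hl; have := ray_inner pd h0 hl.
set t := (X in 0 < X < _) => H; have E : ray p d h = edge_pt d.1 t by [].
split; first by rewrite E dir_at_inner.
  rewrite E /ray_len pos_inner // /t; case: d.2; ring.
move=> k; rewrite {1}/ray E pos_inner // /t /ray.
by case: d.2; congr edge_pt; ring.
Qed.

Lemma slope_eq F p d (m : int) r : dir_at p d -> 0 < r ->
  (forall h, 0 <= h <= r -> F (ray p d h) = F p + m%:~R * h) -> slope F p d = m.
Proof.
by move=> pd r0 H; apply: init_slope_eq r0 _ => h hr; rewrite (ray0 pd) H.
Qed.

Lemma slopeP F p d : rational_function F -> dir_at p d ->
  exists r, [/\ 0 < r, r <= ray_len p d &
    forall h, 0 <= h <= r -> F (ray p d h) = F p + (slope F p d)%:~R * h].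
Proof.
move=> /rationalP Frat pd.
suff [r [r0 rl [m Hm]]] : exists r, [/\ 0 < r, r <= ray_len p d &
    exists m : int, forall h, 0 <= h <= r -> F (ray p d h) = F p + m%:~R * h].
  by exists r; rewrite (slope_eq pd r0 Hm).
have l0 := ray_len_gt0 pd; have /andP[p0 pl] := pos_bound pd.
have Fp : F (edge_pt d.1 (pos p d)) = F p by rewrite edge_pt_pos.
move: l0; rewrite /ray_len /ray; case: d.2 => l0.
  have [|r [r0 rl [m Hm]]] := pl_right (Frat d.1) p0; first by lra.
  exists r; split=> //; first by lra.
  exists m => h hr; have /= -> := Hm (pos p d + h); last by lra.
  by rewrite Fp; congr (_ + _ * _); ring.
have [r [r0 rl [m Hm]]] := pl_left (Frat d.1) l0 pl.
exists r; split=> //; first by lra.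
exists (- m) => h hr; have /= -> := Hm (pos p d - h); last by lra.
have /= := Hm (pos p d); rewrite Fp intrN => ->; last by lra.
ring.
Qed.

Lemma slopeP2 F1 F2 p d : rational_function F1 -> rational_function F2 -> dir_at p d ->
  exists r, [/\ 0 < r, r <= ray_len p d & forall h, 0 <= h <= r ->
    F1 (ray p d h) = F1 p + (slope F1 p d)%:~R * h /\
    F2 (ray p d h) = F2 p + (slope F2 p d)%:~R * h].
Proof.
move=> r1 r2 pd; have [a [a0 al Ha]] := slopeP r1 pd; have [b [b0 bl Hb]] := slopeP r2 pd.
exists (Num.min a b); split; first by rewrite lt_min a0.
  by rewrite ge_min al.
by move=> h; rewrite le_min => /andP[h0 /andP[ha hb]]; rewrite Ha ?Hb ?h0.
Qed.

Lemma rationalD F1 F2 : rational_function F1 -> rational_function F2 ->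
  rational_function (fun x => F1 x + F2 x).
Proof. by rewrite !rationalP => H1 H2 e; exact: plD. Qed.

Lemma rationalN F : rational_function F -> rational_function (fun x => - F x).
Proof. by rewrite !rationalP => H e; exact: plN. Qed.

Lemma rational_cst (c : R) : rational_function (fun _ : gpoint G => c).
Proof. by rewrite rationalP => e; exact: pl_cst. Qed.

Lemma ordD F1 F2 p : rational_function F1 -> rational_function F2 ->
  ord (fun x => F1 x + F2 x) p = ord F1 p + ord F2 p.
Proof.
move=> r1 r2; rewrite !ordE -big_split /=; apply: eq_bigr => d pd.
have [r [r0 _ H]] := slopeP2 r1 r2 pd.
apply: (slope_eq pd r0) => h hr; have [-> ->] := H h hr.
by rewrite intrD; ring.
Qed.

Lemma ordN F p : rational_function F -> ord (fun x => - F x) p = - ord F p.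
Proof.
move=> r1; rewrite !ordE -sumrN; apply: eq_bigr => d pd.
have [r [r0 _ H]] := slopeP r1 pd.
apply: (slope_eq pd r0) => h hr; rewrite H // intrN; ring.
Qed.

Lemma ord_cst (c : R) p : ord (fun=> c) p = 0.
Proof.
rewrite ordE big1 // => d pd; apply: (slope_eq pd ltr01) => h _.
by rewrite mul0r addr0.
Qed.

Lemma ord_inner F e t : 0 < t < len e ->
  ord F (edge_pt e t) = slope F (edge_pt e t) (e, true) + slope F (edge_pt e t) (e, false).
Proof.
move=> H; rewrite ordE sum_dirE (big_pred1 e) ?(big_pred1 e) // => e'.
all: by rewrite dir_at_inner.
Qed.

Lemma locally_convex_edge F e a b : 0 <= a -> b <= len e ->
  (forall t, a < t < b -> 0 <= ord F (edge_pt e t)) ->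
  locally_convex a b (F \o edge_pt e).
Proof.
move=> a0 bl H t ta tb m n r r0 Hm Hn.
have tl : 0 < t < len e by lra.
have := H t; rewrite ta tb => /(_ isT); rewrite ord_inner //.
rewrite (_ : slope F _ (e, true) = m); last first.
  apply: slope_eq r0 _; first by rewrite dir_at_inner.
  by move=> h hr; rewrite /ray /= pos_inner //; exact: Hm.
rewrite (_ : slope F _ (e, false) = n) //.
apply: slope_eq r0 _; first by rewrite dir_at_inner.
by move=> h hr; rewrite /ray /= pos_inner //; exact: Hn.
Qed.

Lemma ray_convex F p d l : rational_function F -> dir_at p d -> l <= ray_len p d ->
  (forall h, 0 < h < l -> 0 <= ord F (ray p d h)) ->
  forall h, 0 <= h <= l -> F p + (slope F p d)%:~R * h <= F (ray p d h).
Proof.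
move=> rF pd ll H h hl.
have [r [r0 rl Hr]] := slopeP rF pd.
have [lr|rl'] := leP l r; first by rewrite Hr //; lra.
move/rationalP : rF => /(_ d.1) Fpl.
have /andP[p0 pl] := pos_bound pd.
have Fp : F (edge_pt d.1 (pos p d)) = F p by rewrite edge_pt_pos.
move: ll rl H Hr; rewrite /ray_len /ray; case: d.2 => ll rl H Hr.
  have /= := @convex_right R (pos p d) (pos p d + l) (F \o edge_pt d.1) _ _
     (pos p d) (lexx _) (slope F p d) r r0 _ _ (pos p d + h) _ _.
  rewrite Fp (_ : pos p d + h - pos p d = h); last by ring.
  apply; try lra.
  - by apply: pl_sub Fpl; lra.
  - apply: locally_convex_edge; try lra.
    move=> t tl; have -> : t = pos p d + (t - pos p d) by ring.
    by apply: H; lra.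
  - by move=> k kr; rewrite Hr.
have /= := @convex_left R (pos p d - l) (pos p d) (F \o edge_pt d.1) _ _
   (pos p d) (lexx _) (slope F p d) r r0 _ _ (pos p d - h) _ _.
rewrite Fp (_ : pos p d - (pos p d - h) = h); last by ring.
apply; try lra.
- by apply: pl_sub Fpl; lra.
- apply: locally_convex_edge; try lra.
  move=> t tl; have -> : t = pos p d - (pos p d - t) by ring.
  by apply: H; lra.
- by move=> k kr; rewrite Hr.
Qed.

End RationalFunctions.

(* A subdivision is given by lists of parameters [B e]; those outside
   [(0, len e)] are ignored. *)
Definition breaks (R : realType) (G : metricGraph R) (B : edge G -> seq R) (e : edge G) :=
  [seq t <- B e | 0 < t < len e].

Definition sub_verts (R : realType) (G : metricGraph R) (B : edge G -> seq R) :
    seq (gpoint G) :=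
  [seq Vertex v | v <- enum (vert G)] ++
  flatten [seq [seq edge_pt e t | t <- breaks B e] | e <- enum (edge G)].

(** Distance from [p] along [d] to the next vertex of the subdivision. The default [ray_len p d]
    leads to the end of the edge, which always is such a vertex; the test [0 < x] discards
    breakpoints at [p] or behind it. *)
Definition reach (R : realType) (G : metricGraph R) (B : edge G -> seq R)
    (p : gpoint G) (d : edge G * bool) : R :=
  foldr (fun x m => if 0 < x then Num.min x m else m) (ray_len p d)
    [seq (if d.2 then t - pos p d else pos p d - t) | t <- breaks B d.1].

Notation sub_vert B := (seq_sub (sub_verts B)).

Definition neighbor (R : realType) (G : metricGraph R) (B : edge G -> seq R)
    (p : sub_vert B) (d : edge G * bool) : sub_vert B :=
  insubd p (ray (val p) d (reach B (val p) d)).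

Definition adapted (R : realType) (G : metricGraph R) (B : edge G -> seq R)
    (F : gpoint G -> R) : Prop :=
  forall e, pl_breaks (B e) 0 (len e) (F \o edge_pt e).

Section Subdivision.
Context (R : realType) (G : metricGraph R) (B : edge G -> seq R).
Implicit Types (p q : gpoint G) (d : edge G * bool) (e : edge G) (t h k r : R)
  (F : gpoint G -> R).

Lemma vertex_sub_verts v : Vertex v \in sub_verts B.
Proof. by rewrite mem_cat map_f // mem_enum. Qed.

Lemma mem_sub_verts e t : 0 < t < len e ->
  (edge_pt e t \in sub_verts B) = (t \in B e).
Proof.
move=> H; rewrite mem_cat (_ : _ \in map _ _ = false) /=; last first.
  by apply/negP => /mapP[v _]; rewrite (edge_pt_inner H).
apply/flatten_mapP/idP => [[e' _ /mapP[t']]|te].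
  rewrite mem_filter => /andP[H' t'e'] E.
  have := dir_at_inner (e, true) H'; rewrite -E dir_at_inner // eqxx => /esym/eqP/= ee'.
  subst e'; have := pos_inner (e, true) H'; rewrite -E pos_inner //.
  by move=> ->.
exists e; first by rewrite mem_enum.
by apply/map_f; rewrite mem_filter H.
Qed.

Lemma reach_spec p d : dir_at p d ->
  [/\ 0 < reach B p d, reach B p d <= ray_len p d,
    (forall h, 0 < h < reach B p d -> ray p d h \notin sub_verts B) &
    ray p d (reach B p d) \in sub_verts B].
Proof.
move=> pd; have l0 := ray_len_gt0 pd.
have [H1 H2 H3 H4] : [/\ 0 < reach B p d, reach B p d <= ray_len p d,
    (forall t, t \in breaks B d.1 ->
       ~~ (0 < (if d.2 then t - pos p d else pos p d - t) < reach B p d)) &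
    reach B p d = ray_len p d \/
    exists2 t, t \in breaks B d.1 & reach B p d = (if d.2 then t - pos p d else pos p d - t)].
  rewrite /reach; elim: (breaks B d.1) => [|t s [H1 H2 H3 H4]] /=.
    by split=> //; left.
  set x := (if d.2 then _ else _) in H3 H4 *; set m := foldr _ _ _ in H1 H2 H3 H4 *.
  case: (ltP 0 x) => x0; last first.
    split=> //; last by case: H4 => [->|[u us ->]]; [left|right; exists u; rewrite ?inE ?us ?orbT].
    by move=> u; rewrite inE => /orP[/eqP->|/H3//]; rewrite -/x ltNge x0.
  split; first by rewrite lt_min x0.
  - by rewrite ge_min H2 orbT.
  - move=> u; rewrite inE lt_min => /orP[/eqP->|/H3 H]; first by rewrite -/x ltxx !andbF.
    by apply: contra H => /and3P[-> _ ->].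
  - rewrite /Num.min; case: ltP => _; first by right; exists t; rewrite ?mem_head.
    by case: H4 => [->|[u us ->]]; [left|right; exists u; rewrite ?inE ?us ?orbT].
split=> //.
  move=> h /andP[h0 hr]; have H := ray_inner pd h0 (lt_le_trans hr H2).
  rewrite /ray mem_sub_verts //; apply/negP => tB.
  have := H3 (if d.2 then pos p d + h else pos p d - h); rewrite mem_filter H tB.
  move=> /(_ isT)/negP; apply.
  have -> : (if d.2 then (if d.2 then pos p d + h else pos p d - h) - pos p d
     else pos p d - (if d.2 then pos p d + h else pos p d - h)) = h by case: d.2; ring.
  by rewrite h0.
case: H4 => [->|[t]].
  rewrite /ray /ray_len; case: d.2.
    by rewrite addrC subrK edge_pt_tgt // vertex_sub_verts.
  by rewrite subrr edge_pt_src // vertex_sub_verts.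
rewrite mem_filter => /andP[H tB] ->; rewrite /ray.
have -> : (if d.2 then pos p d + (if d.2 then t - pos p d else pos p d - t)
   else pos p d - (if d.2 then t - pos p d else pos p d - t)) = t by case: d.2; ring.
by rewrite mem_sub_verts.
Qed.

Lemma reach_unique p d r : dir_at p d -> 0 < r -> r <= ray_len p d ->
  (forall h, 0 < h < r -> ray p d h \notin sub_verts B) ->
  ray p d r \in sub_verts B -> reach B p d = r.
Proof.
move=> pd r0 rl Hr rB; have [s0 sl Hs sB] := reach_spec pd.
have [sr|rs|//] := ltgtP (reach B p d) r.
  by have := Hr (reach B p d); rewrite s0 sr sB => /(_ isT).
by have := Hs r; rewrite r0 rs rB => /(_ isT).
Qed.

Lemma val_neighbor (p : sub_vert B) d : dir_at (val p) d ->
  val (neighbor p d) = ray (val p) d (reach B (val p) d).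
Proof.
by move=> pd; rewrite /neighbor val_insubd; have [_ _ _ ->] := reach_spec pd.
Qed.

Lemma neighbor_rev (p : sub_vert B) d : dir_at (val p) d ->
  [/\ dir_at (val (neighbor p d)) (rev_dir d),
      reach B (val (neighbor p d)) (rev_dir d) = reach B (val p) d &
      neighbor (neighbor p d) (rev_dir d) = p].
Proof.
move=> pd; have [r0 rl Hr rB] := reach_spec pd.
have [H1 H2 H3] := ray_rev pd r0 rl.
have E : reach B (val (neighbor p d)) (rev_dir d) = reach B (val p) d.
  rewrite val_neighbor //; apply: reach_unique => //.
    by move=> h /andP[h0 hr]; rewrite H3 Hr // subr_gt0 hr ltrBlDr ltrDl.
  by rewrite H3 subrr ray0 //; exact: valP.
have D : dir_at (val (neighbor p d)) (rev_dir d) by rewrite val_neighbor.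
split=> //; apply: val_inj.
by rewrite val_neighbor // E val_neighbor // H3 subrr ray0.
Qed.

(** Traverses a segment backwards. Being the identity on pairs that are not a vertex with a
    direction at it, it is a total involution, as reindexing requires. *)
Definition flip (x : sub_vert B * (edge G * bool)) : sub_vert B * (edge G * bool) :=
  if dir_at (val x.1) x.2 then (neighbor x.1 x.2, rev_dir x.2) else x.

Lemma flipK : involutive flip.
Proof.
case=> p d; rewrite {2}/flip /=; case: (boolP (dir_at (val p) d)) => [pd|/negPf pd].
  by have [H1 _ H2] := neighbor_rev pd; rewrite /flip /= H1 H2 /rev_dir /= negbK -surjective_pairing.
by rewrite /flip /= pd.
Qed.

Lemma sum_flip (M : nmodType) (f : sub_vert B -> edge G * bool -> M) :
  \sum_p \sum_(d | dir_at (val p) d) f p d =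
  \sum_p \sum_(d | dir_at (val p) d) f (neighbor p d) (rev_dir d).
Proof.
rewrite pair_big_dep [RHS]pair_big_dep /=.
rewrite (reindex_onto flip flip) /=; last by move=> x _; exact: flipK.
apply: eq_big => [[p d]|[p d]] /=.
  rewrite flipK eqxx andbT /flip /=; case: ifP => //= pd.
  by have [-> _ _] := neighbor_rev pd.
by rewrite flipK eqxx andbT {1}/flip /=; case: ifP => pd; rewrite /flip /= ?pd.
Qed.

Lemma adapted_ray F p d h : rational_function F -> adapted B F -> dir_at p d ->
  0 <= h <= reach B p d -> F (ray p d h) = F p + (slope F p d)%:~R * h.
Proof.
move=> rF aF pd; have [r0 rl Hr rB] := reach_spec pd.
suff [m Hm] : exists m : int, forall h, 0 <= h <= reach B p d ->
    F (ray p d h) = F p + m%:~R * h.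
  by rewrite (slope_eq pd r0 Hm); exact: Hm.
have Fp : F (edge_pt d.1 (pos p d)) = F p by rewrite edge_pt_pos.
have /andP[p0 pl] := pos_bound pd.
have Hw w : 0 < w < len d.1 -> w \in B d.1 ->
    ~~ (0 < (if d.2 then w - pos p d else pos p d - w) < reach B p d).
  move=> wl wB; apply/negP => /Hr; rewrite /ray.
  have -> : (if d.2 then pos p d + (if d.2 then w - pos p d else pos p d - w)
   else pos p d - (if d.2 then w - pos p d else pos p d - w)) = w by case: d.2; ring.
  by rewrite mem_sub_verts // wB.
move: rl Hw; rewrite /ray_len /ray; case: d.2 => rl Hw {Hr rB}.
  have [||||m Hm] := aF d.1 (pos p d) (pos p d + reach B p d); try lra.
    move=> w wB; apply/negP => wr; have wl : 0 < w < len d.1 by lra.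
    by move/negP: (Hw w wl wB); apply; lra.
  exists m => {}h hr; have /= -> := Hm (pos p d + h); last by lra.
  by rewrite Fp; congr (_ + _ * _); ring.
have [||||m Hm] := aF d.1 (pos p d - reach B p d) (pos p d); try lra.
  move=> w wB; apply/negP => wr; have wl : 0 < w < len d.1 by lra.
    by move/negP: (Hw w wl wB); apply; lra.
exists (- m) => {}h hr; have /= -> := Hm (pos p d - h); last by lra.
have /= := Hm (pos p d); rewrite Fp intrN => ->; last by lra.
ring.
Qed.

Lemma adapted_neighbor F (p : sub_vert B) d : rational_function F -> adapted B F ->
  dir_at (val p) d ->
  F (val (neighbor p d)) = F (val p) + (slope F (val p) d)%:~R * reach B (val p) d.
Proof.
move=> rF aF pd; have [r0 _ _ _] := reach_spec pd.
by rewrite val_neighbor // (adapted_ray rF aF pd) // lexx ltW.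
Qed.

Lemma slope_rev F (p : sub_vert B) d : rational_function F -> adapted B F ->
  dir_at (val p) d ->
  slope F (val (neighbor p d)) (rev_dir d) = - slope F (val p) d.
Proof.
move=> rF aF pd; have [r0 _ _ _] := reach_spec pd.
have [H1 H2 H3] := neighbor_rev pd.
have := adapted_neighbor rF aF H1; rewrite H3 H2 adapted_neighbor // => E.
apply/eqP; rewrite -(@eqr_int R) intrN -subr_eq0 opprK.
have /eqP : ((slope F (val (neighbor p d)) (rev_dir d))%:~R +
   (slope F (val p) d)%:~R) * reach B (val p) d = 0 by lra.
by rewrite mulf_eq0 (gt_eqF r0) orbF.
Qed.

Lemma ord_off_verts F p : rational_function F -> adapted B F ->
  p \notin sub_verts B -> ord F p = 0.
Proof.
move=> rF aF; case: p => [v|e [t H] pB]; first by rewrite vertex_sub_verts.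
rewrite -(edge_pt_inner H) in pB *.
have d1 : dir_at (edge_pt e t) (e, true) by rewrite dir_at_inner.
have d2 : dir_at (edge_pt e t) (e, false) by rewrite dir_at_inner.
have [a0 al Ha _] := reach_spec d1; have [b0 bl Hb _] := reach_spec d2.
set a := reach _ _ _ in a0 al Ha; set b := reach _ _ _ in b0 bl Hb.
rewrite /ray_len !pos_inner //= in al bl.
have [||||m Hm] := aF e (t - b) (t + a); try lra.
  move=> w wB; apply/negP => wr; have wl : 0 < w < len e by lra.
  have [tw|wt|E] := ltgtP t w.
  - have := Ha (w - t); rewrite /ray /= pos_inner // (_ : t + (w - t) = w); last by ring.
    rewrite mem_sub_verts // wB.
    by move=> H'; have : false by apply: H'; lra.
  - have := Hb (t - w); rewrite /ray /= pos_inner // (_ : t - (t - w) = w); last by ring.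
    rewrite mem_sub_verts // wB.
    by move=> H'; have : false by apply: H'; lra.
  - by move: pB; rewrite mem_sub_verts // E wB.
rewrite ord_inner // (@slope_eq _ _ F _ _ m a) // ?(@slope_eq _ _ F _ _ (- m) b) ?subrr //.
  move=> h hb; rewrite /ray /= pos_inner //; have /= -> := Hm (t - h); last by lra.
  have /= -> := Hm t; last by lra.
  by rewrite intrN; ring.
move=> h hb; rewrite /ray /= pos_inner //; have /= -> := Hm (t + h); last by lra.
have /= -> := Hm t; last by lra.
by ring.
Qed.

(* The contributions of the segments with both ends in [N] cancel. *)
Lemma flux F (N : pred (sub_vert B)) : rational_function F -> adapted B F ->
  \sum_(p | N p) ord F (val p) =
  \sum_(p | N p) \sum_(d | dir_at (val p) d && ~~ N (neighbor p d)) slope F (val p) d.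
Proof.
move=> rF aF.
(* [f] keeps the segments inside [N] and changes sign under [flip], so its sum equals its own
   negative. *)
pose f (p : sub_vert B) d : int := if N p && N (neighbor p d) then slope F (val p) d else 0.
have f0 : \sum_p \sum_(d | dir_at (val p) d) f p d = 0.
  have : \sum_p \sum_(d | dir_at (val p) d) f p d =
       - \sum_p \sum_(d | dir_at (val p) d) f p d.
    rewrite {1}sum_flip -sumrN; apply: eq_bigr => p _; rewrite -sumrN.
    apply: eq_bigr => d pd; rewrite /f; have [_ _ ->] := neighbor_rev pd.
    by rewrite andbC slope_rev //; case: ifP; rewrite ?oppr0.
  lia.
transitivity (\sum_(p | N p) \sum_(d | dir_at (val p) d && ~~ N (neighbor p d)) slope F (val p) d
  + \sum_p \sum_(d | dir_at (val p) d) f p d); last by rewrite f0 addr0.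
rewrite [X in _ = _ + X](bigID N) /= [X in _ = _ + (_ + X)]big1 ?addr0; last first.
  by move=> p /negPf Np; rewrite big1 // => d _; rewrite /f Np.
rewrite -big_split; apply: eq_bigr => p Np /=; rewrite ordE.
rewrite (bigID (fun d => N (neighbor p d))) /= addrC; congr (_ + _).
by rewrite [LHS]big_mkcondr; apply: eq_bigr => d _; rewrite /f Np.
Qed.

End Subdivision.

Lemma adapted_sub (R : realType) (G : metricGraph R) (B B' : edge G -> seq R)
    (F : gpoint G -> R) :
  (forall e, {subset B e <= B' e}) -> adapted B F -> adapted B' F.
Proof. by move=> BB' aF e; exact: pl_breaks_sub (BB' e) (aF e). Qed.

Lemma adapted_exists (R : realType) (G : metricGraph R) (F : gpoint G -> R) :
  rational_function F -> exists B, adapted B F.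
Proof.
by move=> /rationalP rF; have [B HB] := choice rF; exists B.
Qed.

(** * Divisors and ranks *)

Definition lsection (R : realType) (G : metricGraph R) (D : divisor G)
    (F : gpoint G -> R) : Prop :=
  rational_function F /\ forall x, 0 <= coeff x D + ord F x.

(* [x] lies in the support of some member of the linear system of [D]. *)
Definition covers (R : realType) (G : metricGraph R) (D : divisor G)
    (x : gpoint G) : Prop :=
  exists2 F, lsection D F & 1 <= coeff x D + ord F x.

Section Divisors.
Context (R : realType) (G : metricGraph R).
Implicit Types (p q x y a : gpoint G) (F : gpoint G -> R) (D E : divisor G)
  (A : set (gpoint G)).

Lemma coeff_sum_seq (s : seq (gpoint G)) (c : gpoint G -> int) x : uniq s ->
  coeff x (\sum_(y <- s) << c y *g y >>) = if x \in s then c x else 0.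
Proof.
move=> us; rewrite raddf_sum /= (eq_bigr (fun y => if y == x then c y else 0)); last first.
  by move=> y _; rewrite coeffU; case: eqP; rewrite ?mulr1 ?mulr0.
rewrite -big_mkcond /=; case: ifP => xs.
  by rewrite (big_rem x) //= eqxx big_seq_cond big1 ?addr0 // => y /andP[];
    rewrite mem_rem_uniq // inE => /andP[/negPf->].
by rewrite big_seq_cond big1 // => y /andP[ys /eqP yx]; rewrite -yx ys in xs.
Qed.

Lemma coeff_sum_sub_val (s : seq (gpoint G)) (c : seq_sub s -> int) (p : seq_sub s) :
  coeff (val p) (\sum_(q : seq_sub s) << c q *g val q >>) = c p.
Proof.
rewrite raddf_sum /= (bigD1 p) //= coeffU eqxx mulr1 big1 ?addr0 // => q qp.
by rewrite coeffU (inj_eq val_inj) (negPf qp) mulr0.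
Qed.

Lemma coeff_sum_sub_off (s : seq (gpoint G)) (c : seq_sub s -> int) x : x \notin s ->
  coeff x (\sum_(q : seq_sub s) << c q *g val q >>) = 0.
Proof.
move=> xs; rewrite raddf_sum /= big1 // => q _; rewrite coeffU.
by case: eqP => [qx|_]; [rewrite -qx ssvalP in xs|rewrite mulr0].
Qed.

Lemma coeff_sum_sub (s : seq (gpoint G)) (c : gpoint G -> int) x :
  coeff x (\sum_(p : seq_sub s) << c (val p) *g val p >>) = if x \in s then c x else 0.
Proof.
case: ifPn => xs; last exact: (coeff_sum_sub_off (fun p : seq_sub s => c (val p))).
exact: (coeff_sum_sub_val (fun p : seq_sub s => c (val p)) (SeqSub xs)).
Qed.

Lemma coeff_principal F x : rational_function F -> coeff x (principal F) = ord F x.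
Proof.
move=> rF; have [B aF] := adapted_exists rF.
rewrite /principal (fsbigE (undup (sub_verts B))).
- rewrite (eq_bigl xpredT); last by move=> y; rewrite in_setT.
  rewrite coeff_sum_seq ?undup_uniq // mem_undup.
  by case: ifPn => // /(ord_off_verts rF aF).
- exact: undup_uniq.
- by [].
- by move=> y _; rewrite mem_undup => /(ord_off_verts rF aF) ->; rewrite freegU0.
Qed.

Lemma deg_principal F : rational_function F -> deg (principal F) = 0.
Proof.
move=> rF; have [B aF] := adapted_exists rF.
have -> : principal F = \sum_(p : sub_vert B) << ord F (val p) *g val p >>.
  apply/eqP/freeg_eqP => x; rewrite coeff_principal // coeff_sum_sub.
  by case: ifPn => // /(ord_off_verts rF aF).
rewrite raddf_sum /= (eq_bigr (fun p : sub_vert B => ord F (val p))); last by move=> p _; rewrite degU.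
rewrite (flux predT rF aF) big1 // => p _; rewrite big_pred0 // => d.
by rewrite andbF.
Qed.

Lemma degE D : deg D = \sum_(x <- dom D) coeff x D.
Proof.
by rewrite -{1}(freeg_sumE D) raddf_sum; apply: eq_bigr => x _; rewrite /= degU.
Qed.

Lemma effective_deg_ge0 D : effective D -> 0 <= deg D.
Proof. by move=> eD; rewrite degE; apply: sumr_ge0 => x _; exact: eD. Qed.

Lemma effective_pick D s : effective D -> deg D = s.+1%:Z ->
  exists2 x, 1 <= coeff x D & effective (D - << x >>).
Proof.
move=> eD dD.
have [x xD] : exists x, 1 <= coeff x D.
  apply: contrapT => H; have : deg D <= 0.
    rewrite degE; apply: sumr_le0 => x _; rewrite leNgt; apply/negP => x0.
    by apply: H; exists x; rewrite gtz0_ge1 in x0 *.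
  by rewrite dD.
exists x => // y; rewrite coeffB coeffU mul1r.
by case: eqP => [<-|_]; rewrite ?subr0 ?eD // subr_ge0.
Qed.

Lemma effective_deg0 D : effective D -> deg D = 0 -> D = 0.
Proof.
move=> eD dD; apply/eqP/freeg_eqP => x; rewrite coeff0; apply/eqP.
apply: contraT => xD.
have x0 : 1 <= coeff x D by rewrite -gtz0_ge1 lt_neqAle eq_sym xD eD.
have : 0 <= deg (D - << x >>).
  apply: effective_deg_ge0 => y; rewrite coeffB coeffU mul1r.
  by case: eqP => [<-|_]; rewrite ?subr0 ?eD // subr_ge0.
by rewrite degB degU dD.
Qed.

Lemma linear_systemP D : linear_system D !=set0 <-> exists F, lsection D F.
Proof.
split=> [[D' [eD' [F rF DD']]]|[F [rF FD]]].
  exists F; split=> // x; rewrite -coeff_principal // -DD' coeffB.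
  by rewrite addrC subrK; exact: eD'.
exists (D + principal F); split.
  by move=> x; rewrite coeffD coeff_principal.
by exists F => //; rewrite addrC addKr.
Qed.

Lemma linear_system_deg D : linear_system D !=set0 -> 0 <= deg D.
Proof.
move=> [D' [eD' [F rF /(congr1 (@deg _))]]].
by rewrite deg_principal // degB => /eqP; rewrite subr_eq0 => /eqP<-; exact: effective_deg_ge0.
Qed.

Lemma coversP D x : linear_system (D - << x >>) !=set0 <-> covers D x.
Proof.
rewrite linear_systemP; split=> [[F [rF FD]]|[F [rF FD] FDx]].
  have E y : coeff y (D - << x >>) = coeff y D - (x == y)%:R.
    by rewrite coeffB coeffU mul1r.
  exists F; first split=> // y.
    have := FD y; rewrite E; case: eqP => _; lia.
  by have := FD x; rewrite E eqxx; lia.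
exists F; split=> // y; rewrite coeffB coeffU mul1r.
have := FD y; case: eqP => [<-|_]; lia.
Qed.

Lemma lsection_shift D F F' : rational_function F -> rational_function F' ->
  lsection (D + principal F) F' <-> lsection D (fun x => F x + F' x).
Proof.
move=> rF rF'; split=> -[_ H]; split; rewrite //; first exact: rationalD.
  by move=> x; have := H x; rewrite coeffD coeff_principal // ordD // addrA.
by move=> x; have := H x; rewrite coeffD coeff_principal // ordD // addrA.
Qed.

Lemma covers_shift D F x : rational_function F ->
  covers (D + principal F) x <-> covers D x.
Proof.
move=> rF; split=> [[F' [rF' HF'] Hx]|[F' [rF' HF'] Hx]].
  exists (fun y => F y + F' y); first exact/lsection_shift.
  by move: Hx; rewrite coeffD coeff_principal // ordD // addrA.
pose F1 y := F' y + - F y.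
have rF1 : rational_function F1 by apply: rationalD => //; exact: rationalN.
have E y : ord F1 y = ord F' y - ord F y by rewrite ordD ?ordN //; exact: rationalN.
exists F1; first split=> // y.
  by have := HF' y; rewrite coeffD coeff_principal // E; lia.
by move: Hx; rewrite coeffD coeff_principal // E; lia.
Qed.

Lemma rank_ge0P A D : rank_ge A D 0 <-> linear_system D !=set0.
Proof.
split=> [/(_ 0)|DN E eE _ dE].
  rewrite subr0; apply; first by move=> x; rewrite coeff0.
    by move=> x; rewrite coeff0 eqxx.
  by rewrite deg0.
by rewrite (effective_deg0 eE dE) subr0.
Qed.

Lemma rank_geS A D s :
  rank_ge A D s.+1 <-> forall a, A a -> rank_ge A (D - << a >>) s.
Proof.
split=> [H a Aa E eE sE dE|H E eE sE dE].
  rewrite -addrA -opprD; apply: H.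
  - by move=> x; rewrite coeffD coeffU mul1r addr_ge0.
  - move=> x; rewrite coeffD coeffU mul1r; case: (eqVneq a x) => [<-//|_].
    by rewrite add0r; exact: sE.
  - by rewrite degD degU dE; lia.
have [x xE xeE] := effective_pick eE dE.
have -> : D - E = D - << x >> - (E - << x >>) by rewrite -addrA -opprD [_ + (E - _)]addrC subrK.
have Ax : A x by apply: sE; rewrite gt_eqF // gtz0_ge1.
apply: H => //; last by rewrite degB degU dE; lia.
move=> y; rewrite coeffB coeffU mul1r; case: (eqVneq x y) => [<-//|_].
by rewrite subr0; exact: sE.
Qed.

Lemma rank_ge_sub A D s : rank_ge [set: gpoint G] D s -> rank_ge A D s.
Proof. by move=> H E eE _ dE; exact: H. Qed.

Lemma rank_ge_succ A D s : A !=set0 -> rank_ge A D s.+1 -> rank_ge A D s.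
Proof.
move=> [a Aa] /rank_geS/(_ a Aa) H E eE sE dE.
have /linear_systemP[F [rF HF]] := H E eE sE dE.
apply/linear_systemP; exists F; split=> // x; have := HF x.
by rewrite !coeffB coeffU mul1r; case: eqP => _; lia.
Qed.

Lemma rank_ge_deg A D s : A !=set0 -> rank_ge A D s -> s%:Z <= deg D.
Proof.
move=> [a Aa] /(_ << s%:Z *g a >>) H.
have : linear_system (D - << s%:Z *g a >>) !=set0.
  apply: H; last by rewrite degU.
    by move=> x; rewrite coeffU mulr_ge0.
  by move=> x; rewrite coeffU; case: (eqVneq a x) => [<-//|_]; rewrite mulr0 eqxx.
by move=> /linear_system_deg; rewrite degB degU subr_ge0.
Qed.

Lemma rank_exists A D : A !=set0 -> linear_system D !=set0 ->
  exists r : nat, forall s : nat, (s <= r)%N <-> rank_ge A D s.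
Proof.
move=> A0 D0.
have ex : exists n, `[< rank_ge A D n >] by exists 0%N; apply/asboolP/rank_ge0P.
have bd n : `[< rank_ge A D n >] -> (n <= absz (deg D))%N.
  by move=> /asboolP/(rank_ge_deg A0); have := linear_system_deg D0; lia.
have [r /asboolP rA rmax] := ex_maxnP ex bd.
exists r => s; split=> [|sA]; last by apply: rmax; apply/asboolP.
move=> /subnK rE; move: (r - s)%N rE rA => k <- {rmax ex bd r}.
by elim: k => // k IH; rewrite addSn => /(rank_ge_succ A0)/IH.
Qed.

Lemma rank_onE A D r : linear_system D !=set0 ->
  (forall s : nat, (s <= r)%N <-> rank_ge A D s) -> rank_on A D = r%:Z.
Proof.
move=> D0 Hr; rewrite /rank_on; case: asboolP => [D00|_]; first by move: D0; rewrite D00 => -[].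
congr Posz; apply: xget_unique => // r' Hr'; apply/eqP; rewrite eqn_leq.
by apply/andP; split; [apply/Hr/Hr'|apply/Hr'/Hr].
Qed.

(** Covering is the clause of the rank for degree 1. Higher degrees are reached by exchanging points
    one at a time: [D' - E] covers every [a] in [A] by the induction hypothesis for [D' - << a >>],
    hence covers [x]. *)
Lemma rank_determiningP A : rank_determining A <->
  A !=set0 /\ forall D, (forall a, A a -> covers D a) -> forall x, covers D x.
Proof.
split=> -[A0 H]; split=> // D.
  move=> HA x; have A1 : rank_ge A D 1.
    by apply/rank_geS => a Aa; apply/rank_ge0P/coversP/HA.
  have D0 : linear_system D !=set0.
    by have [a /HA[F FD _]] := A0; apply/linear_systemP; exists F.
  have [r Hr] := rank_exists A0 D0.
  have T0 : [set: gpoint G] !=set0 by exists x.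
  have [r' Hr'] := rank_exists T0 D0.
  have := H D; rewrite /rank (rank_onE D0 Hr) (rank_onE D0 Hr') => -[rr'].
  have : rank_ge [set: gpoint G] D 1 by apply/Hr'; rewrite rr'; apply/Hr.
  by move=> /rank_geS/(_ x I)/rank_ge0P/coversP.
have E s D' : rank_ge A D' s <-> rank_ge [set: gpoint G] D' s.
  split; last exact: rank_ge_sub.
  elim: s D' => [|s IH] D'; first by rewrite !rank_ge0P.
  move=> /rank_geS HA; apply/rank_geS => x _ E eE sE dE.
  rewrite addrAC; apply/coversP/H => a Aa; apply/coversP; rewrite addrAC.
  exact: (IH _ (HA a Aa) E eE sE dE).
rewrite /rank /rank_on; case: ifP => // _; congr (Posz (xget _ _)).
by apply/seteqP; split=> r Hr s; rewrite Hr E.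
Qed.

End Divisors.

(** * Reduced divisors *)

Definition point_breaks (R : realType) (G : metricGraph R) (s : seq (gpoint G))
    (e : edge G) : seq R := [seq pos p (e, true) | p <- s].

(* For effective [D] this is the usual notion of an [x]-reduced divisor, in terms
   of rational functions instead of chip firing. *)
Definition reduced (R : realType) (G : metricGraph R) (D : divisor G)
    (x : gpoint G) : Prop :=
  forall F, lsection D F -> forall z, F z <= F x.

Section ReducedDivisors.
Context (R : realType) (G : metricGraph R).
Implicit Types (p q x y z : gpoint G) (d : edge G * bool) (e : edge G)
  (t h r u v w : R) (F : gpoint G -> R) (D : divisor G).

Lemma mem_point_breaks (s : seq (gpoint G)) (B : edge G -> seq R) p :
  (forall e, {subset point_breaks s e <= B e}) -> p \in s -> p \in sub_verts B.
Proof.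
case: p => [v|e [t H]] sB ps; first exact: vertex_sub_verts.
rewrite -(edge_pt_inner H) mem_sub_verts //; apply: sB.
by apply/mapP; exists (Inner e (exist _ t H)).
Qed.

Lemma sub_verts_sub (B B' : edge G -> seq R) :
  (forall e, {subset B e <= B' e}) -> {subset sub_verts B <= sub_verts B'}.
Proof.
move=> BB' [v|e [t H]]; first by rewrite !vertex_sub_verts.
by rewrite -(edge_pt_inner H) !mem_sub_verts //; exact: BB'.
Qed.

Lemma deg_sub_verts D (B : edge G -> seq R) : {subset dom D <= sub_verts B} ->
  deg D = \sum_(p : sub_vert B) coeff (val p) D.
Proof.
move=> DB; have {1}-> : D = \sum_(p : sub_vert B) << coeff (val p) D *g val p >>.
  apply/eqP/freeg_eqP => x; rewrite (coeff_sum_sub _ (fun y => coeff y D)).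
  by case: ifPn => // xB; apply: coeff_outdom; apply: contra xB; exact: DB.
by rewrite raddf_sum; apply: eq_bigr => p _; rewrite /= degU.
Qed.

(** Cut at the level of [F p]: the slopes leaving the set of vertices with [F >= F p] are all
    nonpositive, and a descending [d] is one of them. By [flux] they add up to the sum of the orders
    on that set, which is at least [- deg D]. *)
Lemma slope_ge_deg D F p d : effective D -> lsection D F -> dir_at p d ->
  - deg D <= slope F p d.
Proof.
move=> eD [rF HF] pd; have dD := effective_deg_ge0 eD.
have [m0|m0] := leP 0 (slope F p d); first by lia.
have [B0 aF0] := adapted_exists rF.
pose B e := B0 e ++ point_breaks (p :: dom D) e.
have aF : adapted B F.
  by apply: adapted_sub aF0 => e w; rewrite mem_cat => ->.
have sB e : {subset point_breaks (p :: dom D) e <= B e}.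
  by move=> w; rewrite mem_cat orbC => ->.
have pB : p \in sub_verts B by apply: mem_point_breaks sB _; rewrite mem_head.
have DB : {subset dom D <= sub_verts B}.
  by move=> q qD; apply: mem_point_breaks sB _; rewrite inE qD orbT.
pose P : sub_vert B := SeqSub pB.
pose N (q : sub_vert B) := F p <= F (val q).
have NP : N P by exact: lexx.
have := flux N rF aF.
have lhs : - deg D <= \sum_(q | N q) ord F (val q).
  rewrite (deg_sub_verts DB) (bigID N) /=.
  apply: (@le_trans _ _ (- \sum_(q | N q) coeff (val q) D)).
    by rewrite lerN2 lerDl; apply: sumr_ge0 => q _; exact: eD.
  rewrite -sumrN; apply: ler_sum => q _; by rewrite -subr_ge0 opprK addrC; exact: HF.
have neg (q : sub_vert B) d' : N q -> dir_at (val q) d' -> ~~ N (neighbor q d') ->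
    slope F (val q) d' <= 0.
  move=> Nq qd; rewrite /N adapted_neighbor // -ltNge => H.
  have [r0 _ _ _] := reach_spec B qd.
  rewrite -(@ler_int R); have : (slope F (val q) d')%:~R * reach B (val q) d' <= 0.
    by rewrite /N in Nq; lra.
  by rewrite pmulr_lle0.
have rhs : \sum_(q | N q) \sum_(d' | dir_at (val q) d' && ~~ N (neighbor q d'))
    slope F (val q) d' <= slope F p d.
  rewrite (bigD1 P) //= (bigD1 d) /=; last first.
    rewrite pd /N adapted_neighbor //= -ltNge -[X in _ < X]addr0 ltrD2l.
    have [r0 _ _ _] := reach_spec B pd.
    by rewrite nmulr_rlt0 // ltrz0.
  rewrite -addrA gerDl; rewrite -oppr_ge0 opprD addr_ge0 ?oppr_ge0 //=.
    by apply: sumr_le0 => d' /andP[/andP[qd nN] _]; exact: (neg P d' NP qd nN).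
  apply: sumr_le0 => q /andP[Nq _]; apply: sumr_le0 => d' /andP[qd nN].
  exact: neg.
by move=> E; rewrite E in lhs; exact: le_trans lhs rhs.
Qed.

(** The upper bound is the lower bound for the reversed direction at a nearby point of the ray. *)
Lemma slope_le_deg D F p d : effective D -> lsection D F -> dir_at p d ->
  `|slope F p d| <= deg D.
Proof.
move=> eD FD pd; rewrite ler_norml slope_ge_deg //=.
have [r [r0 rl Hr]] := slopeP FD.1 pd.
have [H1 H2 H3] := ray_rev pd r0 rl.
have := slope_ge_deg eD FD H1; rewrite (slope_eq (m := - slope F p d) H1 r0); first by lia.
move=> h hr; rewrite H3 !Hr ?intrN; [ring|lra|lra].
Qed.

Lemma lsection_slope_bounded D F e : effective D -> lsection D F ->
  slope_bounded (deg D)%:~R 0 (len e) (F \o edge_pt e).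
Proof.
move=> eD FD u v u0 uv vl m Hm.
have [||ul|H1 H2] := @pos_edge_pt _ G (e, true) u; rewrite /=; [lra|by move=> /eqP; lra|by []|].
rewrite -intr_norm ler_int -(slope_eq (F := F) (p := edge_pt e u) (d := (e, true))
   (m := m) (r := v - u)) ?slope_le_deg //; first by lra.
move=> h hr; rewrite /ray H2 /=; have /= -> := Hm (u + h); last by lra.
congr (_ + _ * _); ring.
Qed.

Lemma lsection_lipschitz D F e u v : effective D -> lsection D F ->
  0 <= u -> u <= v -> v <= len e ->
  `|F (edge_pt e v) - F (edge_pt e u)| <= (deg D)%:~R * (v - u).
Proof.
move=> eD FD; have /rationalP/(_ e) Fe := FD.1.
exact: (pl_lipschitz Fe (lsection_slope_bounded eD FD)).
Qed.

(** Slopes are bounded by [deg D], so a section vanishing at [x] is bounded along every chain of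
    edges, and connectedness reaches every [z]. *)
Lemma lsection_bounded D x : effective D ->
  forall z, exists K : R, forall F, lsection D F -> F x = 0 -> F z <= K.
Proof.
move=> eD; pose P z := exists K : R, forall F, lsection D F -> F x = 0 -> `|F z| <= K.
suff HP z : P z.
  move=> z; have [K HK] := HP z; exists K => F FD Fx.
  exact: le_trans (ler_norm _) (HK F FD Fx).
have Pe e t u : 0 <= t <= len e -> 0 <= u <= len e -> P (edge_pt e t) -> P (edge_pt e u).
  move=> /andP[t0 tl] /andP[u0 ul] [K HK]; exists (K + (deg D)%:~R * `|u - t|) => F FD Fx.
  rewrite -[F (edge_pt e u)](subrK (F (edge_pt e t))) addrC.
  apply: le_trans (ler_normD _ _) _; apply: lerD; first exact: HK.
  have [tu|/ltW ut] := leP t u.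
    by rewrite (ger0_norm (_ : 0 <= u - t)) ?subr_ge0 //; exact: lsection_lipschitz.
  rewrite distrC (distrC u t) (ger0_norm (_ : 0 <= t - u)) ?subr_ge0 //.
  exact: lsection_lipschitz.
have Psrc e : P (Vertex (src e)) <-> P (Vertex (tgt e)).
  have l0 := ltW (len_gt0 e).
  rewrite -(edge_pt_src e (lexx 0)) -(edge_pt_tgt (lexx (len e))).
  by split; apply: Pe; rewrite ?lexx ?l0.
have Px : P x by exists 0 => F _ ->; rewrite normr0.
have [v0 Pv0] : exists v0 : vert G, P (Vertex v0).
  have : exists y, x = y by exists x.
  case=> -[v|e [t H]] xE; first by exists v; rewrite -xE.
  exists (src e); rewrite -(edge_pt_src e (lexx 0)); apply: (Pe e t).
  - by case/andP: (H) => *; rewrite !ltW.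
  - by rewrite lexx ltW ?len_gt0.
  - by rewrite (edge_pt_inner H) -xE.
have Pv (v : vert G) : P (Vertex v).
  have /connectP[s sp ->] := vert_connected v0 v.
  elim: s v0 Pv0 sp => //= w s IH v0 Pv0 /andP[/existsP[e He] sp].
  apply: IH sp; move: He => /orP[]/andP[/eqP s1 /eqP t1].
    by rewrite -t1; apply/Psrc; rewrite s1.
  by rewrite -s1; apply/Psrc; rewrite t1.
case: z => [v|e [t H]]; first exact: Pv.
rewrite -(edge_pt_inner H); apply: (Pe e 0); last by rewrite edge_pt_src.
  by rewrite lexx ltW ?len_gt0.
by case/andP: (H) => *; rewrite !ltW.
Qed.

Lemma lt_finite_gap (I : eqType) (s : seq I) (a : I -> R) (b : R) :
  (forall m, m \in s -> a m < b) -> exists2 r : R, 0 < r & forall m, m \in s -> a m <= b - r.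
Proof.
elim: s => [|m s IH] H; first by exists 1.
have [|r r0 Hr] := IH; first by move=> n ns; apply: H; rewrite inE ns orbT.
have mb := H m (mem_head _ _).
exists (Num.min r (b - a m)); first by rewrite lt_min r0 subr_gt0.
have [m1 m2] := min_le2 r (b - a m).
move=> n; rewrite inE => /orP[/eqP->|/Hr]; lra.
Qed.

(* The reduced divisor is given by the pointwise supremum [F0] of the sections
   vanishing at [x]. Between the points of [D] sections are convex with bounded
   integral slopes, so [F0] is a maximum of finitely many lines; at a point, a
   section almost attaining [F0] has slopes less than those of [F0] plus one,
   hence at most those of [F0]. *)
Lemma reduced_exists_effective D x : effective D ->
  exists F, lsection D F /\ reduced (D + principal F) x.
Proof.
move=> eD; pose fam F := lsection D F /\ F x = 0.
pose F0 z := sup [set F z | F in fam].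
pose L := deg D.
have L0 : 0 <= L by exact: effective_deg_ge0.
have fam0 : fam (fun=> 0).
  by split=> //; split=> [|z]; [exact: rational_cst|rewrite ord_cst addr0; exact: eD].
have hs z : has_sup [set F z | F in fam].
  split; first by exists 0, (fun=> 0).
  have [K HK] := lsection_bounded x eD z; exists K => _ [F [FD Fx] <-]; exact: HK.
have le0 F z : fam F -> F z <= F0 z.
  by move=> FF; apply: (sup_upper_bound (hs z)); exists F.
have adh z r : 0 < r -> exists2 F, fam F & F0 z - r < F z.
  by move=> r0; have [_ [F FF <-] H] := sup_adherent r0 (hs z); exists F.
pose B := point_breaks (dom D).
have ord_off F z : lsection D F -> z \notin sub_verts B -> 0 <= ord F z.
  move=> FD zB; have := FD.2 z; rewrite coeff_outdom ?add0r //.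
  by apply: contra zB; apply: mem_point_breaks => e w.
have loc F e u v : lsection D F -> 0 <= u -> v <= len e ->
    (forall w, w \in B e -> ~~ (u < w < v)) -> locally_convex u v (F \o edge_pt e).
  move=> FD u0 vl Hs; apply: locally_convex_edge => // t tuv; apply: ord_off => //.
  by rewrite mem_sub_verts; [apply: contraL tuv => /Hs|lra].
have plF0 e : pl 0 (len e) (F0 \o edge_pt e).
  apply: (pl_local (s := B e)) => u v u0 uv vl Hs.
  pose I : seq int := [seq i%:Z - L | i <- iota 0 (2 * absz L).+1].
  have memI (m : int) : `|m| <= L -> m \in I.
    move=> mL; apply/mapP; exists (absz (m + L)); last by lia.
    by rewrite mem_iota; lia.
  (* Intercepts of the lines of slope [m] below some normalized section on [[u, v]]; their supremum
     [C m] gives a line below [F0]. *)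
  pose S (m : int) := [set c : R | exists2 F, fam F &
     forall t, u <= t <= v -> c + m%:~R * t <= F (edge_pt e t)].
  have ubS m t c : u <= t <= v -> S m c -> c <= F0 (edge_pt e t) - m%:~R * t.
    move=> tuv [F FF /(_ t tuv) H]; have := le0 F (edge_pt e t) FF; lra.
  have uuv : u <= u <= v by rewrite lexx ltW.
  have hS m : has_sup (S m).
    split; last by exists (F0 (edge_pt e u) - m%:~R * u) => c; exact: ubS.
    exists (- (`|m%:~R| * len e)), (fun=> 0) => // t tuv.
    have : m%:~R * t <= `|m%:~R| * len e :> R.
      apply: le_trans (ler_norm _) _; rewrite normrM ler_wpM2l //.
      by rewrite ger0_norm; lra.
    lra.
  pose C m := sup (S m).
  have CF m t : u <= t <= v -> C m + m%:~R * t <= F0 (edge_pt e t).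
    move=> tuv; rewrite -lerBrDr; apply: ge_sup; first by have [] := hS m.
    by move=> c; exact: ubS.
  apply: (@pl_max_lines _ _ _ _ C I); first by move=> t m tuv _; exact: CF.
  move=> t tuv; apply: contrapT => H.
  (* If all lines stayed below [F0] by [r] at [t], the support line at [t] of a section closer than
     [r] to [F0] would contradict this. *)
  have [|r r0 Hr] := @lt_finite_gap _ I (fun m => C m + m%:~R * t) (F0 (edge_pt e t)).
    move=> m mI; rewrite lt_neqAle CF // andbT; apply/eqP => E.
    by apply: H; exists m.
  have [F [FD Fx] HF] := adh (edge_pt e t) r r0.
  have /rationalP/(_ e)/(pl_sub u0 vl) plF := FD.1.
  have [a [b [m [ua ab bv [Fab Fm]]]]] := convex_support uv plF (loc F e u v FD u0 vl Hs) tuv.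
  have mI : m \in I.
    apply: memI; rewrite -(@ler_int R) intr_norm.
    by apply: (lsection_slope_bounded eD FD) Fab; lra.
  have := Hr m mI; apply/negP; rewrite -ltNge; apply: lt_le_trans HF _.
  rewrite -lerBlDr; apply: (sup_upper_bound (hS m)).
  exists F => // s suv; have /= := Fm s suv; lra.
have rF0 : rational_function F0 by apply/rationalP.
have lF0 : lsection D F0.
  split=> // p.
  have [r r0 Hr] : exists2 r : R, 0 < r & forall r', 0 < r' -> r' <= r ->
      forall d, dir_at p d -> r' <= reach B p d /\
        F0 (ray p d r') = F0 p + (slope F0 p d)%:~R * r'.
    apply: pos_common => d pd; have [r [r0 rl Hr]] := slopeP rF0 pd.
    have [s0 sl _ _] := reach_spec B pd.
    exists (Num.min r (reach B p d)); first by rewrite lt_min r0.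
    have [m1 m2] := min_le2 r (reach B p d).
    by move=> r' r'0 H; split; [lra|rewrite Hr //; lra].
  have {}Hr := Hr r r0 (lexx r).
  (* The same [r] is the distance travelled and the error allowed at [p]: divided by [r], the error
     becomes a difference of 1 in slope. *)
  have [F [FD Fx] HF] := adh p r r0.
  apply: le_trans (FD.2 p) _; rewrite lerD2l !ordE; apply: ler_sum => d pd.
  have [rr E] := Hr d pd.
  have [s0 sl Hs _] := reach_spec B pd.
  have H : F p + (slope F p d)%:~R * r <= F (ray p d r).
    apply: (ray_convex FD.1 pd (le_trans rr sl)); last by rewrite lexx ltW.
    move=> h hr; apply: ord_off => //; apply: Hs; lra.
  have := le0 F (ray p d r) (conj FD Fx); rewrite E => H2.
  have : (slope F p d)%:~R - 1 < (slope F0 p d)%:~R :> R.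
    by rewrite -(ltr_pM2r r0) mulrBl mul1r; lra.
  by rewrite -[1]/(1%:~R) -intrB ltr_int; lia.
have F0x : F0 x = 0.
  rewrite /F0 (_ : [set F x | F in fam] = [set 0]) ?sup1 //.
  by apply/seteqP; split=> [_ [F [_ Fx] <-]//|_ ->]; exists (fun=> 0).
exists F0; split=> // G0 G0D z.
have rG0 := G0D.1; have /lsection_shift := G0D; move=> /(_ rF0 rG0) [r1 H1].
have rc := rational_cst G (- G0 x).
(* A section [G0] of the new divisor, added to [F0] and normalized at [x], belongs to the family and
   thus stays below [F0]. *)
have : fam (fun y => F0 y + G0 y + - G0 x).
  split; last by rewrite F0x add0r subrr.
  split; first exact: rationalD.
  by move=> y; rewrite ordD // ord_cst addr0.
by move=> /(le0 _ z); lra.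
Qed.

Lemma reduced_exists D x F1 : lsection D F1 ->
  exists F, lsection D F /\ reduced (D + principal F) x.
Proof.
move=> [r1 H1]; have eD : effective (D + principal F1).
  by move=> z; rewrite coeffD coeff_principal.
have [F [FD Fred]] := reduced_exists_effective x eD.
exists (fun z => F1 z + F z); split; first by apply/lsection_shift => //; exact: FD.1.
rewrite (_ : _ + _ = D + principal F1 + principal F) //.
apply/eqP/freeg_eqP => z; rewrite !coeffD !coeff_principal ?ordD ?addrA //; try exact: FD.1.
by apply: rationalD => //; exact: FD.1.
Qed.

End ReducedDivisors.

(* The function with values [c] on the vertices of the subdivision and
   [f p q h k] on the segment from [p] to [q], at distance [h] from [p] and [k]
   from [q]. *)
Definition segment_ext (R : realType) (G : metricGraph R) (B : edge G -> seq R)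
    (c : gpoint G -> R) (f : gpoint G -> gpoint G -> R -> R -> R) (z : gpoint G) : R :=
  if z \in sub_verts B then c z else
  match z with
  | Vertex _ => 0
  | Inner e _ =>
      f (ray z (e, false) (reach B z (e, false))) (ray z (e, true) (reach B z (e, true)))
        (reach B z (e, false)) (reach B z (e, true))
  end.

Definition adj (R : realType) (G : metricGraph R) (B : edge G -> seq R)
    (p q : sub_vert B) : int :=
  \sum_(d | dir_at (val p) d) (neighbor p d == q)%:R.

(** * Functions defined segment by segment, and chip firing *)

Section Segments.
Context (R : realType) (G : metricGraph R) (B : edge G -> seq R).
Implicit Types (x y z : gpoint G) (d : edge G * bool) (e : edge G)
  (t h k r u v w : R) (F : gpoint G -> R) (D : divisor G) (p q : sub_vert B).

Lemma reach_shift p d h : dir_at (val p) d -> 0 < h -> h < reach B (val p) d ->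
  [/\ dir_at (ray (val p) d h) d, dir_at (ray (val p) d h) (rev_dir d),
      ray (val p) d h \notin sub_verts B,
      reach B (ray (val p) d h) d = reach B (val p) d - h /\
      reach B (ray (val p) d h) (rev_dir d) = h &
      (forall k, ray (ray (val p) d h) d k = ray (val p) d (h + k)) /\
      forall k, ray (ray (val p) d h) (rev_dir d) k = ray (val p) d (h - k)].
Proof.
move=> pd h0 hr; have [r0 rl Hr rB] := reach_spec B pd.
have hl := lt_le_trans hr rl.
have [H1 H2 H3] := ray_shift pd h0 hl.
have [H4 H5 H6] := ray_rev pd h0 (ltW hl).
split=> //; first by apply: Hr; rewrite h0.
split.
  apply: reach_unique => //; first by rewrite subr_gt0.
  - by rewrite H2 lerD2r.
  - by move=> k hk; rewrite H3 Hr //; lra.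
  - by rewrite H3 addrC subrK.
apply: reach_unique => //.
- by move=> k hk; rewrite H6 Hr //; lra.
- by rewrite H6 subrr ray0 //; exact: ssvalP.
Qed.

(** [segment_ext] reads the two ends in the order given by the orientation of the edge, the
    right-hand side in the order of travel along [d]; the symmetry of [f] reconciles them. *)
Lemma segment_ext_ray c f p d h : (forall x y h k, f x y h k = f y x k h) ->
  dir_at (val p) d -> 0 < h -> h < reach B (val p) d ->
  segment_ext B c f (ray (val p) d h) =
  f (val p) (val (neighbor p d)) h (reach B (val p) d - h).
Proof.
move=> fC pd h0 hr; have [H1 H2 H3 [H4 H5] [H6 H7]] := reach_shift pd h0 hr.
rewrite /segment_ext (negPf H3); set z := ray (val p) d h in H1 H2 H3 H4 H5 H6 H7 *.
have zb : ray z (rev_dir d) h = val p by rewrite H7 subrr ray0.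
have zf : ray z d (reach B (val p) d - h) = val (neighbor p d).
  by rewrite H6 addrC subrK val_neighbor.
clearbody z; case E : z H3 => [v|e t]; first by rewrite vertex_sub_verts.
move=> _; rewrite -E.
have de : d.1 = e by move: H1; rewrite E => /eqP.
case: d de {pd hr H1 H6 H7} H2 H4 H5 zb zf => e' [] /= -> H2 H4 H5 zb zf.
  by rewrite /rev_dir /= in H5 zb; rewrite H4 H5 zb zf.
by rewrite /rev_dir /= in H5 zb; rewrite H4 H5 zb zf fC.
Qed.

Lemma segment_of e u : 0 <= u -> u < len e ->
  exists p, exists h, [/\ dir_at (val p) (e, true), 0 <= h, h < reach B (val p) (e, true) &
    u = pos (val p) (e, true) + h].
Proof.
move=> u0 ul.
have [||_|] := @pos_edge_pt _ G (e, true) u; rewrite /=; [lra|by move=> /eqP; lra|by []|].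
set z := edge_pt e u => zd zu.
have [zB|zB] := boolP (z \in sub_verts B).
  have [r0 _ _ _] := reach_spec B zd.
  by exists (SeqSub zB), 0; split=> //=; rewrite zu addr0.
have u0' : 0 < u.
  rewrite lt_neqAle u0 andbT; apply: contraNneq zB => uE.
  by rewrite /z -uE edge_pt_src // vertex_sub_verts.
have uu : 0 < u < len e by rewrite u0'.
have zd' : dir_at z (e, false) by rewrite dir_at_inner.
have [r0 rl Hr rB] := reach_spec B zd'.
have [H1 H2 H3] := ray_rev zd' r0 rl.
have rl' : reach B z (e, false) <= u by move: rl; rewrite /ray_len pos_inner.
have pE : ray z (e, false) (reach B z (e, false)) = edge_pt e (u - reach B z (e, false)).
  by rewrite /ray pos_inner.
set r := reach B z (e, false) in r0 rl Hr rB H1 H2 H3 rl' pE *.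
have [||_|_ pp] := @pos_edge_pt _ G (e, true) (u - r); rewrite /=; [lra|by move=> /eqP; lra|by []|].
exists (SeqSub rB), r; split=> //=; first exact: ltW.
- have [s0 sl Hs sB] := reach_spec B H1.
  rewrite ltNge le_eqVlt; apply/negP => /orP[/eqP E|sr].
    by move: sB; rewrite E H3 subrr ray0 // (negPf zB).
  have := Hr (r - reach B (ray z (e, false) r) (rev_dir (e, false))).
  by rewrite -H3 sB => H; have : false by apply: H; lra.
- by rewrite pE pp subrK.
Qed.

Lemma segment_ext_pl c f : (forall x y h k, f x y h k = f y x k h) ->
  (forall p d, dir_at (val p) d ->
     let l := reach B (val p) d in let q := val (neighbor p d) in
     f (val p) q 0 l = c (val p) /\ forall a, pl a (a + l) (fun t => f (val p) q (t - a) (a + l - t))) ->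
  forall e, pl 0 (len e) (segment_ext B c f \o edge_pt e).
Proof.
move=> fC Hf e; apply: (pl_local (s := B e)) => u v u0 uv vl Hs.
have [p [h [pd h0 hr uE]]] := segment_of u0 (lt_le_trans uv vl).
have [r0 rl Hr rB] := reach_spec B pd.
have /andP[p0 _] := pos_bound pd.
set a := pos (val p) (e, true) in uE p0.
set l := reach B (val p) (e, true) in hr r0 rl Hr rB.
have vr : v <= a + l.
  rewrite leNgt; apply/negP => rv.
  have al : 0 < a + l < len e by lra.
  have := rB; rewrite /ray /= -/a mem_sub_verts // => /Hs/negP; apply; lra.
have [c0 pf] := Hf p (e, true) pd.
apply: pl_eq (pl_sub _ vr (pf a)); last by lra.
move=> t tuv; rewrite /= -/l.
have tE : edge_pt e t = ray (val p) (e, true) (t - a) by rewrite /ray /= -/a; congr edge_pt; ring.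
have [ta|ta] := eqVneq t a.
  rewrite tE ta subrr ray0 // addrAC subrr add0r c0 /segment_ext ssvalP //.
have [tl|tl] := eqVneq t (a + l).
  rewrite tE tl addrAC subrr add0r subrr -val_neighbor // /segment_ext ssvalP fC.
  have [H1 H2 H3] := neighbor_rev pd.
  have [] := Hf (neighbor p (e, true)) (rev_dir (e, true)) H1.
  by rewrite H2 H3 => -> _.
have t1 : a < t by rewrite lt_neqAle eq_sym ta; lra.
have t2 : t < a + l by rewrite lt_neqAle tl; lra.
rewrite tE segment_ext_ray //; [|by rewrite subr_gt0|by rewrite -/l; lra].
congr f; rewrite -/l; ring.
Qed.

Lemma adj_ge0 p q : 0 <= adj p q.
Proof. by apply: sumr_ge0 => d _; rewrite ler0n. Qed.

Lemma adj_sym p q : adj p q = adj q p.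
Proof.
have E (a b : sub_vert B) : adj a b =
    \sum_(x : sub_vert B) \sum_(d | dir_at (val x) d) ((x == a) && (neighbor x d == b))%:R.
  rewrite (bigD1 a) //= [X in _ = _ + X]big1 ?addr0 => [|x /negPf xa].
    by apply: eq_bigr => d _; rewrite eqxx.
  by rewrite big1 // => d _; rewrite xa.
rewrite E sum_flip E; apply: eq_bigr => x _; apply: eq_bigr => d xd.
by have [_ _ ->] := neighbor_rev xd; rewrite andbC.
Qed.

Lemma sum_adj p (Q : pred (sub_vert B)) :
  \sum_(q | Q q) adj p q = \sum_(d | dir_at (val p) d) (Q (neighbor p d))%:R.
Proof.
rewrite exchange_big /=; apply: eq_bigr => d _.
have [Qn|Qn] := boolP (Q (neighbor p d)).
  by rewrite (bigD1 (neighbor p d)) //= eqxx big1 ?addr0 // => q /andP[_ /negPf]; rewrite eq_sym => ->.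
by rewrite big1 // => q Qq; case: eqP => // qE; rewrite qE Qq in Qn.
Qed.

Lemma slope_ge0_min F z d : rational_function F -> dir_at z d ->
  (forall x, F z <= F x) -> 0 <= slope F z d.
Proof.
move=> rF zd Fz; have [r [r0 rl Hr]] := slopeP rF zd.
have := Fz (ray z d r); rewrite Hr; last by rewrite lexx ltW.
by rewrite -(@ler_int R) lerDl pmulr_lge0.
Qed.

(** Profile of the firing function on a segment, at distances [h] and [k] from its ends; [a] and [b]
    tell which ends are fired. Between a fired and an unfired end it descends with slope -1 to the
    level [- eps], as a maximum of two affine functions, hence convexly. *)
Definition ramp (eps : R) (a b : bool) (h k : R) : R :=
  if a then (if b then 0 else Num.max (- eps) (- h))
  else (if b then Num.max (- eps) (- k) else - eps).

Lemma ramp_convex eps a b h k r : 0 <= r ->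
  2 * ramp eps a b h k <= ramp eps a b (h + r) (k - r) + ramp eps a b (h - r) (k + r).
Proof.
move=> r0; rewrite /ramp /Num.max; case: a; case: b; try lra;
 by case: ltP => ?; case: ltP => ?; case: ltP => ?; lra.
Qed.

Lemma pl_max2 a b t0 eps (n : int) : n != 0 ->
  pl a b (fun t : R => Num.max (- eps) (n%:~R * (t - t0))).
Proof.
move=> n0; apply: (@pl_max_lines _ _ _ _ (fun m => if m == 0 then - eps else - (n%:~R * t0)) [:: 0; n]).
  move=> t m _; rewrite !inE => /orP[]/eqP->; rewrite le_max /=.
    by rewrite mul0r addr0 lexx.
  by rewrite (negPf n0); apply/orP; right; lra.
move=> t _; rewrite /Num.max; case: ltP => _.
  by exists n; rewrite ?inE ?eqxx ?orbT // (negPf n0); ring.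
by exists 0; rewrite ?inE ?eqxx //= mul0r addr0.
Qed.

Lemma point_segment z : z \in sub_verts B \/
  exists p d h, [/\ dir_at (val p) d, 0 < h, h < reach B (val p) d & z = ray (val p) d h].
Proof.
have [zB|zB] := boolP (z \in sub_verts B); [by left|right].
case: z zB => [v|e [t H]]; first by rewrite vertex_sub_verts.
rewrite -(edge_pt_inner H); case/andP: (H) => t0 tl zB.
have [p [h [pd h0 hr tE]]] := segment_of (ltW t0) tl.
have zE : edge_pt e t = ray (val p) (e, true) h by rewrite /ray /= -tE.
exists p, (e, true), h; split=> //; rewrite lt_neqAle h0 andbT.
by apply: contraNneq zB => hE; rewrite zE -hE ray0 // ssvalP.
Qed.

Lemma ord_ray F p d h : dir_at (val p) d -> 0 < h -> h < reach B (val p) d ->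
  ord F (ray (val p) d h) = slope F (ray (val p) d h) d + slope F (ray (val p) d h) (rev_dir d).
Proof.
move=> pd h0 hr; have [r0 rl _ _] := reach_spec B pd.
rewrite {1}/ray ord_inner; last exact: ray_inner pd h0 (lt_le_trans hr rl).
by rewrite -/(ray _ _ _); case: d {pd hr r0 rl} => e []; rewrite //= addrC.
Qed.

(* Otherwise [Z] could be fired by a small amount. *)
Lemma reduced_burn D (y p0 : sub_vert B) (Z : {set sub_vert B}) :
  effective D -> {subset dom D <= sub_verts B} -> reduced D (val y) ->
  p0 \in Z -> y \notin Z ->
  exists2 p, p \in Z & coeff (val p) D < \sum_(q | q \notin Z) adj p q.
Proof.
move=> eD DB redD p0Z yZ; apply: contrapT => H.
have {}H p : p \in Z -> \sum_(q | q \notin Z) adj p q <= coeff (val p) D.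
  by move=> pZ; rewrite leNgt; apply/negP => H'; apply: H; exists p.
(* [eps] is at most the length of every segment, so a ramp has reached [- eps] by the other end. *)
have [eps eps0 Heps] : exists2 r : R, 0 < r & forall r', 0 < r' -> r' <= r ->
    forall x : sub_vert B * (edge G * bool), dir_at (val x.1) x.2 -> r' <= reach B (val x.1) x.2.
  apply: pos_common => -[p d] /= pd; have [r0 _ _ _] := reach_spec B pd.
  by exists (reach B (val p) d).
have {}Heps p d : dir_at (val p) d -> eps <= reach B (val p) d.
  by move=> pd; apply: (Heps eps eps0 (lexx _) (p, d)).
pose inZ x := [exists p in Z, val p == x].
have inZE p : inZ (val p) = (p \in Z).
  apply/exists_inP/idP => [[q qZ /eqP/val_inj <-]//|pZ]; by exists p.
pose c x : R := if inZ x then 0 else - eps.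
pose f x x' := ramp eps (inZ x) (inZ x').
pose F := segment_ext B c f.
have fC x x' h k : f x x' h k = f x' x k h.
  by rewrite /f /ramp; case: (inZ x); case: (inZ x').
have max0 : Num.max (- eps) (- 0) = 0 by rewrite /Num.max oppr0; case: ltP => //; lra.
have max1 h : eps <= h -> Num.max (- eps) (- h) = - eps.
  by move=> eh; rewrite /Num.max; case: ltP => //; lra.
have rF : rational_function F.
  apply/rationalP; apply: segment_ext_pl => // p d pd /=; split.
    rewrite /f /c /ramp; case: (inZ _); case: (inZ _) => //.
    exact: max1 (Heps p d pd).
  move=> a; rewrite /f /ramp; case: (inZ _); case: (inZ _); try exact: pl_cst.
    rewrite (_ : (fun t => _) = fun t => Num.max (- eps) ((-1)%:~R * (t - a))); last first.
      by apply: funext => t; congr Num.max; rewrite intrN; ring.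
    exact: pl_max2.
  rewrite (_ : (fun t => _) = fun t => Num.max (- eps) (1%:~R * (t - (a + reach B (val p) d)))).
    exact: pl_max2.
  by apply: funext => t; congr Num.max; ring.
have FV p : F (val p) = c (val p) by rewrite /F /segment_ext ssvalP.
have f0 p d : dir_at (val p) d ->
    f (val p) (val (neighbor p d)) 0 (reach B (val p) d) = c (val p).
  move=> pd; rewrite /f /c /ramp; case: (inZ _); case: (inZ _) => //.
  exact: max1 (Heps p d pd).
have Fray p d h : dir_at (val p) d -> 0 <= h -> h < reach B (val p) d ->
    F (ray (val p) d h) = f (val p) (val (neighbor p d)) h (reach B (val p) d - h).
  move=> pd; rewrite le_eqVlt => /orP[/eqP<- _|h0 hr]; last exact: segment_ext_ray.
  by rewrite subr0 ray0 // FV f0.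
have Fge z : - eps <= F z.
  have [zB|[p [d [h [pd h0 hr ->]]]]] := point_segment z.
    have -> : z = val (SeqSub zB : sub_vert B) by [].
    by rewrite FV /c; case: ifP => _; lra.
  rewrite Fray ?(ltW h0) // /f /ramp; case: (inZ _); case: (inZ _); rewrite ?le_max ?lexx //.
  by lra.
have Fslope p d : p \in Z -> dir_at (val p) d ->
    slope F (val p) d = - (neighbor p d \notin Z)%:R.
  move=> pZ pd; have el := Heps p d pd.
  apply: (slope_eq (r := eps / 2) pd); first by rewrite divr_gt0.
  move=> h he; rewrite Fray //; [|lra|lra].
  rewrite FV /c /f /ramp !inZE pZ; case: (neighbor p d \in Z); first by rewrite oppr0 mul0r addr0.
  rewrite /= intrN mulN1r add0r /Num.max; case: ltP => //; lra.
(* On [Z] the chips pay for the descending ramps, by the negated conclusion. No chip is lost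
   elsewhere: the other vertices are minima of [F], and [F] is convex inside segments. *)
have FD : lsection D F.
  split=> // z; have [zB|[p [d [h [pd h0 hr ->]]]]] := point_segment z.
    have zE : z = val (SeqSub zB : sub_vert B) by [].
    rewrite zE; set p : sub_vert B := SeqSub zB.
    have [pZ|pZ] := boolP (p \in Z).
      rewrite ordE (eq_bigr (fun d => - (neighbor p d \notin Z)%:R)); last first.
        by move=> d pd; exact: Fslope.
      rewrite sumrN subr_ge0; apply: le_trans (H p pZ).
      by rewrite (sum_adj p (fun q => q \notin Z)).
    apply: addr_ge0; first exact: eD.
    rewrite ordE; apply: sumr_ge0 => d pd; apply: slope_ge0_min => // x.
    by rewrite FV /c inZE (negPf pZ).
  apply: addr_ge0; first exact: eD.
  have [H1 H2 H3 [H4 H5] [H6 H7]] := reach_shift pd h0 hr.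
  rewrite ord_ray //; set x := ray (val p) d h in H1 H2 H3 H4 H5 H6 H7 *.
  have [r1 [r10 r1l Hr1]] := slopeP rF H1; have [r2 [r20 r2l Hr2]] := slopeP rF H2.
  have [m1 m2] := min_le2 r1 r2.
  have [m3 m4] := min_le2 (Num.min r1 r2) (Num.min (h / 2) ((reach B (val p) d - h) / 2)).
  have [m5 m6] := min_le2 (h / 2) ((reach B (val p) d - h) / 2).
  set r := Num.min (Num.min r1 r2) _ in m3 m4.
  have r0 : 0 < r by rewrite /r !lt_min r10 r20 /=; apply/andP; split; lra.
  have := ramp_convex eps (inZ (val p)) (inZ (val (neighbor p d))) h (reach B (val p) d - h) (ltW r0).
  have -> : reach B (val p) d - h - r = reach B (val p) d - (h + r) by ring.
  have -> : reach B (val p) d - h + r = reach B (val p) d - (h - r) by ring.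
  have b1 : h + r < reach B (val p) d by clear -m4 m6 h0 hr r0; lra.
  have b2 : 0 <= h - r by clear -m4 m5 h0 hr r0; lra.
  have b3 : 0 <= h + r by clear -h0 r0; lra.
  have b4 : h - r < reach B (val p) d by clear -hr r0; lra.
  rewrite -!/(f _ _ _ _) -!Fray ?(ltW h0) // -H6 -H7 -/x.
  have r1' : 0 <= r <= r1 by clear -m1 m3 r0; lra.
  have r2' : 0 <= r <= r2 by clear -m2 m3 r0; lra.
  rewrite Hr1 // Hr2 //.
  rewrite -(@ler_int R) intrD => E.
  rewrite -(pmulr_lge0 _ r0); lra.
have := redD F FD (val p0); rewrite !FV /c !inZE p0Z (negPf yZ); lra.
Qed.

End Segments.

(** * Special open sets *)

(* For an open set [U] of a graph that is a component of the complement of a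
   finite set and [v] outside [U], this says that at least two rays issuing from
   [v] start inside [U]. *)
Definition two_sided (T : topologicalType) (U : set T) (v : T) : Prop :=
  exists2 W, nbhs v W &
    forall C, connected C -> C `<=` W `&` U -> ~ nbhs v (C `|` ~` U).

(** A component of the complement of a finite set, with maximality stated against connected sets off
    [S]: every clause is visibly preserved by homeomorphisms. *)
Definition component_off (T : topologicalType) (S : seq T) (U : set T) : Prop :=
  [/\ open U, connected U, U !=set0, forall x, U x -> x \notin S &
      forall C, connected C -> (forall x, C x -> x \notin S) -> C `&` U !=set0 -> C `<=` U].

(* The condition on components of the complement is stated for relatively clopen
   subsets [Z] of the complement. *)
Definition special_open (T : topologicalType) (U : set T) : Prop :=
  (exists S, component_off S U) /\
  forall Z, Z !=set0 -> Z `<=` ~` U -> closed Z -> closed (~` U `\` Z) ->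
    exists2 v, Z v & two_sided U v.

Section Germs.
Context (R : realType) (G : metricGraph R).
Implicit Types (x y z v : gpoint G) (d : edge G * bool) (e : edge G)
  (t h k r : R) (F : gpoint G -> R) (D : divisor G) (U : set (gpoint G)).

Lemma slope_le0_max F z d : rational_function F -> dir_at z d ->
  (forall x, F x <= F z) -> slope F z d <= 0.
Proof.
move=> rF zd Fz; have [r [r0 rl Hr]] := slopeP rF zd.
have := Fz (ray z d r); rewrite Hr; last by rewrite lexx ltW.
by rewrite -(@ler_int R) gerDl pmulr_lle0.
Qed.

Lemma ord_le0_max F z : rational_function F -> (forall x, F x <= F z) -> ord F z <= 0.
Proof. by move=> rF Fz; rewrite ordE; apply: sumr_le0 => d zd; exact: slope_le0_max. Qed.

(** Maximum principle: where [D] has no chips [ord F >= 0], while at a maximum every outgoing slope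
    is nonpositive. All of them vanish there, so the set of maxima is open in [U]; it is closed by
    continuity. *)
Lemma max_constant U D F x : lsection D F -> connected U -> open U ->
  (forall z, U z -> coeff z D = 0) -> U x -> (forall z, F z <= F x) ->
  forall z, U z -> F z = F x.
Proof.
move=> [rF HF] cU oU DU Ux Fx z Uz.
suff E : U `&` [set z | F x <= F z] = U.
  by have : U z by []; rewrite -E => -[_ Fz]; apply/eqP; rewrite eq_le Fx.
apply: cU.
- by exists x; split=> //=; exact: lexx.
- exists ([set z | F z = F x]°); first exact: open_interior.
  apply/seteqP; split=> y [Uy Fy]; split=> //; last first.
    by have /= -> := interior_subset Fy.
  have {}Fy : F y = F x by apply/eqP; rewrite eq_le Fx.
  apply: nbhs_ray => // d yd.
  have Fy' w : F w <= F y by rewrite Fy.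
  have s0 : slope F y d = 0.
    apply/eqP; rewrite eq_le slope_le0_max //=.
    have := HF y; rewrite DU // add0r ordE (bigD1 d) //= => /le_trans; apply.
    rewrite gerDl; apply: sumr_le0 => d' /andP[yd' _]; exact: slope_le0_max.
  have [r [r0 rl Hr]] := slopeP rF yd; exists r => // h hr.
  by rewrite /= Hr ?s0 ?mul0r ?addr0 //; lra.
- exists [set z | F x <= F z] => //.
  apply: (preimage_closed (f := F) (D := [set r | F x <= r])); last exact: closed_ge.
  by move=> y _; exact: rF.1.
Qed.

Lemma max_not_covered U D F x : lsection D F -> connected U -> open U ->
  (forall z, U z -> coeff z D = 0) -> U x -> (forall z, F z <= F x) ->
  forall z, U z -> coeff z D + ord F z <= 0.
Proof.
move=> FD cU oU DU Ux Fx z Uz; rewrite DU // add0r.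
have Fz := max_constant FD cU oU DU Ux Fx Uz.
by apply: ord_le0_max; [exact: FD.1|move=> y; rewrite Fz].
Qed.

Lemma ray_connected z d (i : interval R) : connected (ray z d @` [set` i]).
Proof.
apply: connected_continuous_connected.
  by apply/connected_intervalP; exact: interval_is_interval.
by apply: continuous_subspaceT; exact: ray_continuous.
Qed.

Definition germ_in U z d := exists2 r, 0 < r & forall h, 0 < h < r -> U (ray z d h).

(** A third of each ray length keeps the beginnings of two rays apart even when they run on the same
    edge. *)
Lemma ray_eq_dir v d d' h h' : dir_at v d -> dir_at v d' ->
  0 < h -> h <= ray_len v d / 3 -> 0 < h' -> h' <= ray_len v d' / 3 ->
  ray v d h = ray v d' h' -> d = d'.
Proof.
move=> vd vd' h0 hl h0' hl'.
have l1 := ray_len_gt0 vd; have l2 := ray_len_gt0 vd'.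
have H1 : 0 < (if d.2 then pos v d + h else pos v d - h) < len d.1.
  by apply: ray_inner => //; lra.
have H2 : 0 < (if d'.2 then pos v d' + h' else pos v d' - h') < len d'.1.
  by apply: ray_inner => //; lra.
rewrite /ray => E.
have := dir_at_inner (d'.1, true) H1; rewrite E dir_at_inner //= eqxx => /esym/eqP E1.
case: d d' E1 vd vd' hl hl' l1 l2 E H1 H2 => e b [e' b'] /= E1; subst e'.
move=> vd vd' hl hl' l1 l2 E H1 H2.
have {E} := edge_pt_inj _ _ E.
move: H1 H2 => /andP[H1 H1'] /andP[H2 H2'].
rewrite !ltW // => /(_ isT isT).
move: vd vd' hl hl' l1 l2 H1 H1' H2 H2'; rewrite /ray_len.
case: v => [v|e' t] /=; have l0 := len_gt0 e.
  by case: b; case: b' => //= *; exfalso; lra.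
by case: b; case: b' => //= *; exfalso; lra.
Qed.

Lemma branch_nbhs v d r h : dir_at v d -> 0 < h -> h < r -> r <= ray_len v d ->
  nbhs (ray v d h) [set ray v d k | k in [set k | 0 < k < r]].
Proof.
move=> vd h0 hr rl; have hl := lt_le_trans hr rl.
have [H1 H2 H3] := ray_shift vd h0 hl.
have [H4 H5 H6] := ray_rev vd h0 (ltW hl).
apply: nbhs_ray; first by exists h => //=; rewrite h0.
move=> d'; rewrite {1}/ray dir_at_inner; last exact: ray_inner.
move=> /eqP d'd; have [->|->] : d' = d \/ d' = rev_dir d.
- case: d d' d'd {vd rl hl H1 H2 H3 H4 H5 H6} => e b [e' b'] /= ->.
  by case: b; case: b'; [left|right|right|left].
- exists (r - h); first by rewrite subr_gt0.
  by move=> k hk; rewrite H3; exists (h + k) => //=; lra.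
- exists h => // k hk; rewrite H6; exists (h - k) => //=; lra.
Qed.

(** In a small star without [v] the branches are disjoint open sets, so a connected subset lies in
    one of them. If [C] and the complement of [U] made up a neighborhood of [v], then [C] would meet
    the branches along both germs. *)
Lemma germs_two_sided U v d1 d2 : ~ U v -> d1 != d2 -> dir_at v d1 -> dir_at v d2 ->
  germ_in U v d1 -> germ_in U v d2 -> two_sided U v.
Proof.
move=> nUv d12 vd1 vd2 [r1 r10 g1] [r2 r20 g2].
have [eps eps0 He] : exists2 r : R, 0 < r & forall r', 0 < r' -> r' <= r ->
    forall d, dir_at v d -> r' <= ray_len v d / 3.
  apply: pos_common => d vd; exists (ray_len v d / 3); last by [].
  by rewrite divr_gt0 // ray_len_gt0.
have {}He d : dir_at v d -> eps <= ray_len v d / 3 by exact: (He eps eps0 (lexx _)).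
pose br d := [set ray v d k | k in [set k | 0 < k < eps]].
have br_open d : dir_at v d -> open (br d).
  move=> vd; rewrite openE => _ [k /= /andP[k0 ke] <-].
  apply: branch_nbhs => //; have := He d vd; have := ray_len_gt0 vd; lra.
have br_disj d d' z : dir_at v d -> dir_at v d' -> br d z -> br d' z -> d = d'.
  move=> vd vd' [h /= /andP[h0 he] <-] [h' /= /andP[h0' he'] E].
  have := He d vd; have := He d' vd' => ? ?.
  by apply: (ray_eq_dir vd vd' h0 _ h0' _ (esym E)); lra.
pose O2 := \bigcup_(d in [set d | dir_at v d && (d != d1)]) br d.
exists (v |` (br d1 `|` O2)).
  apply: nbhs_ray; first by left.
  move=> d vd; exists eps => // h hr; right.
  have [->|dd1] := eqVneq d d1; first by left; exists h.
  by right; exists d => /=; [rewrite vd|exists h].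
move=> C cC CW nC.
have Cbr d r : dir_at v d -> 0 < r -> (forall h, 0 < h < r -> U (ray v d h)) ->
    exists2 z, C z & br d z.
  move=> vd r0 g; have [s s0 Hs] := ray_nbhs vd nC.
  pose h := Num.min (Num.min (r / 2) (s / 2)) (eps / 2).
  have [m1 m2] := min_le2 (Num.min (r / 2) (s / 2)) (eps / 2).
  have [m3 m4] := min_le2 (r / 2) (s / 2).
  have h0 : 0 < h by rewrite /h !lt_min !divr_gt0.
  have Uh : U (ray v d h) by apply: g; rewrite /h in h0 *; lra.
  exists (ray v d h); last by exists h => //=; rewrite /h in h0 *; lra.
  by case: (Hs h) => [|//|//]; rewrite /h in h0 *; lra.
have [z1 Cz1 b1] := Cbr d1 r1 vd1 r10 g1.
have [z2 Cz2 b2] := Cbr d2 r2 vd2 r20 g2.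
have E : C `&` br d1 = C.
  apply: cC; first by exists z1.
    by exists (br d1) => //; exact: br_open.
  exists (~` O2).
    by apply: open_closedC; apply: bigcup_open => d /= /andP[vd _]; exact: br_open.
  apply/seteqP; split=> z [Cz zb]; split=> //.
    by move=> [d /= /andP[vd /eqP dd1] zd]; apply: dd1; exact: br_disj zd zb.
  have [[zv|[//|//]] Uz] := CW z Cz.
  by rewrite zv in Uz.
have : (C `&` br d1) z2 by rewrite E.
by move=> [_ b12]; move/eqP: d12; apply; exact: br_disj b12 b2.
Qed.

Context (S : seq (gpoint G)) (U : set (gpoint G)).
Context (compU : component_off S U).

Lemma component_segment (B : edge G -> seq R) z d h k :
  (forall e, {subset point_breaks S e <= B e}) -> dir_at z d ->
  0 < h < reach B z d -> 0 < k < reach B z d -> U (ray z d h) -> U (ray z d k).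
Proof.
move=> SB zd hr kr Uh; have [_ _ _ _ maxU] := compU.
have [r0 rl Hr _] := reach_spec B zd.
apply: (maxU (ray z d @` [set` `]0, reach B z d[])).
- exact: ray_connected.
- move=> x [s /=]; rewrite in_itv /= => sr <-.
  by apply: contra (Hr s sr); exact: mem_point_breaks.
- by exists (ray z d h); split=> //; exists h => //=; rewrite in_itv.
- by exists k => //=; rewrite in_itv.
Qed.

Lemma component_germ (B : edge G -> seq R) z d h :
  (forall e, {subset point_breaks S e <= B e}) -> dir_at z d ->
  0 < h < reach B z d -> U (ray z d h) -> germ_in U z d.
Proof.
move=> SB zd hr Uh; have [r0 _ _ _] := reach_spec B zd.
by exists (reach B z d) => // k kr; exact: component_segment SB zd hr kr Uh.
Qed.

(** Otherwise the half-open ray starting at [z] would be a connected set off [S] meeting [U], hence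
    contained in it. *)
Lemma component_boundary z d : dir_at z d -> germ_in U z d -> ~ U z -> z \in S.
Proof.
move=> zd [r r0 g] nUz; apply: contrapT => /negP zS; apply: nUz.
have [_ _ _ US maxU] := compU.
apply: (maxU (ray z d @` [set` `[0, r[])).
- exact: ray_connected.
- move=> x [s /=]; rewrite in_itv /= => /andP[]; rewrite le_eqVlt => /orP[/eqP<- _ <-|s0 sr <-].
    by rewrite ray0.
  by apply: US; apply: g; rewrite s0.
- exists (ray z d (r / 2)); split; last by apply: g; lra.
  by exists (r / 2) => //=; rewrite in_itv /=; lra.
- by exists 0; rewrite ?ray0 //= in_itv /= lexx r0.
Qed.

(** With at most one germ in [U], the beginning of that ray, or else the empty set, is a connected
    [C] violating [two_sided]: near [v] all other rays are outside [U]. *)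
Lemma two_sided_germs v : ~ U v -> two_sided U v ->
  exists d1 d2, [/\ d1 != d2, dir_at v d1, dir_at v d2, germ_in U v d1 & germ_in U v d2].
Proof.
move=> nUv [W nW HW]; apply: contrapT => nd.
pose B := point_breaks S.
have SB e : {subset point_breaks S e <= B e} by [].
have out d : dir_at v d -> ~ germ_in U v d -> exists2 r, 0 < r &
    forall h, 0 < h < r -> ~ U (ray v d h).
  move=> vd ng; have [r0 _ _ _] := reach_spec B vd.
  by exists (reach B v d) => // h hr Uh; apply: ng; exact: component_germ SB vd hr Uh.
have [[d1 vd1 g1]|ng] := pselect (exists2 d, dir_at v d & germ_in U v d).
  have [r r0 g] := g1; have [s s0 Hs] := ray_nbhs vd1 nW.
  have [m1 m2] := min_le2 r s; have m0 : 0 < Num.min r s by rewrite lt_min r0.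
  apply: (HW (ray v d1 @` [set` `]0, (Num.min r s)[])).
  - exact: ray_connected.
  - move=> x [h /=]; rewrite in_itv /= => hm <-; split; [apply: Hs|apply: g]; lra.
  - apply: nbhs_ray; first by right.
    move=> d vd; have [->|dd1] := eqVneq d d1.
      by exists (Num.min r s) => // h hm; left; exists h => //=; rewrite in_itv.
    have [|q q0 Hq] := out d vd.
      by move=> g2; apply: nd; exists d, d1.
    by exists q => // h hq; right; exact: Hq.
apply: (HW set0); [exact: connected0|exact: sub0set|].
apply: nbhs_ray; first by right.
move=> d vd; have [|q q0 Hq] := out d vd; first by move=> g; apply: ng; exists d.
by exists q => // h hq; right; exact: Hq.
Qed.

End Germs.

Lemma sum_nat_gt0 (T : finType) (P Q : pred T) : 0 < \sum_(x | P x) (Q x)%:R :> int ->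
  exists2 x, P x & Q x.
Proof.
move=> H; have [/exists_inP//|/exists_inPn nQ] := boolP [exists x in P, Q x].
by move: H; rewrite big1 ?ltxx // => x /nQ/negPf ->.
Qed.

Lemma sum_nat_ge2 (T : finType) (P Q : pred T) x y : P x -> P y -> Q x -> Q y -> x != y ->
  2 <= \sum_(z | P z) (Q z)%:R :> int.
Proof.
move=> Px Py Qx Qy xy; rewrite (bigD1 x) //= (bigD1 y) /=; last by rewrite Py eq_sym.
by rewrite Qx Qy addrA lerDl; apply: sumr_ge0 => z _; rewrite ler0n.
Qed.

(** * From uncovered points to special open sets *)

Section ReducedToSpecial.
Context (R : realType) (G : metricGraph R).
Implicit Types (x y z v : gpoint G) (d : edge G * bool) (e : edge G)
  (t h k r : R) (F : gpoint G -> R) (D : divisor G) (U A : set (gpoint G)).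

(** An open segment is inside [U] or disjoint from it, and an end in the open set [U] would bring
    nearby inner points with it. *)
Lemma segment_avoids (S : seq (gpoint G)) U (B : edge G -> seq R) z d h k :
  component_off S U -> (forall e, {subset point_breaks S e <= B e}) -> dir_at z d ->
  0 < h < reach B z d -> 0 <= k <= reach B z d -> ~ U (ray z d h) -> ~ U (ray z d k).
Proof.
move=> cU SB zd hr kr nU Uk; apply: nU.
have [oU _ _ _ _] := cU; have [r0 _ _ _] := reach_spec B zd.
have [s sr Us] : exists2 s, 0 < s < reach B z d & U (ray z d s).
  have := @ray_continuous _ _ z d k U (open_nbhs_nbhs (conj oU Uk)).
  move=> /nbhs_ballP[eps /= eps0 Heps].
  pose c := Num.min (eps / 2) (reach B z d / 4).
  have [m1 m2] := min_le2 (eps / 2) (reach B z d / 4).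
  have c0 : 0 < c by rewrite /c lt_min !divr_gt0.
  rewrite -/c in m1 m2.
  have [kl|kl] := leP k (reach B z d / 2).
    exists (k + c); first by lra.
    by apply: Heps; rewrite /ball /= opprD addrA subrr add0r normrN gtr0_norm //; lra.
  exists (k - c); first by lra.
  by apply: Heps; rewrite /ball /= opprB addrC subrK gtr0_norm //; lra.
exact: (component_segment cU SB zd sr hr Us).
Qed.

Lemma connected_clopen (T : topologicalType) (U Z C : set T) : closed Z ->
  closed (~` U `\` Z) -> connected C -> C `<=` ~` U -> C `&` Z !=set0 -> C `<=` Z.
Proof.
move=> cZ cY cC CU CZ; suff E : C `&` Z = C by move=> x; rewrite -E => -[].
apply: cC => //; last by exists Z.
exists (~` (~` U `\` Z)); first exact: closed_openC.
apply/seteqP; split=> x [Cx Hx]; split=> //; first by move=> [].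
by apply: contrapT => nZ; apply: Hx; split=> //; exact: CU.
Qed.

Lemma effective_section D F : lsection D F -> effective (D + principal F).
Proof. by move=> [rF H] x; rewrite coeffD coeff_principal. Qed.

Lemma component_off_exists (S : seq (gpoint G)) x : x \notin S ->
  exists2 U, component_off S U & U x.
Proof.
move=> xS; pose O : set (gpoint G) := [set z | z \notin S].
pose U := connected_component O x.
have Ux : U x by exact: connected_component_refl.
have maxU C : connected C -> (forall z, C z -> z \notin S) -> C `&` U !=set0 -> C `<=` U.
  move=> cC CS [w [Cw Uw]]; rewrite /U (same_connected_component Uw).
  exact: connected_component_max.
exists U => //; split => //; last 3 first.
- exact: component_connected.
- by exists x.
- by move=> z /connected_component_sub.
rewrite openE => z Uz; apply: nbhs_ray => // d zd.
have [r0 rl Hr _] := reach_spec (point_breaks S) zd.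
exists (reach (point_breaks S) z d) => // h hr.
apply: (maxU (ray z d @` [set` `[0, reach (point_breaks S) z d[])).
- exact: ray_connected.
- move=> y [s /=]; rewrite in_itv /= => /andP[]; rewrite le_eqVlt => /orP[/eqP<- _ <-|s0 sr <-].
    by rewrite ray0 //; exact: connected_component_sub Uz.
  have := Hr s; rewrite s0 sr => /(_ isT); apply: contra.
  by apply: mem_point_breaks => e w.
- by exists z; split=> //; exists 0; rewrite ?ray0 //= in_itv /= lexx.
- by exists h => //=; rewrite in_itv /=; lra.
Qed.

(* With [D] replaced by an [x]-reduced divisor, [U] is the component of [x] in the
   complement of its support; a set violating specialness could be fired. *)
Lemma special_of_uncovered A D x : A !=set0 -> (forall a, A a -> covers D a) ->
  ~ covers D x -> exists2 U, special_open U & forall a, A a -> ~ U a.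
Proof.
move=> [a0 Aa0] HA nDx.
have [F1 FD1 _] := HA a0 Aa0.
have [F [FD red]] := reduced_exists x FD1.
set D0 := D + principal F in red.
have eD : effective D0 by exact: effective_section.
have cov z : covers D0 z <-> covers D z by apply: covers_shift; exact: FD.1.
have xS : x \notin dom D0.
  rewrite mem_dom; apply/negP => D0x; apply/nDx/cov.
  exists (fun=> 0); last by rewrite ord_cst addr0 -gtz0_ge1 lt_neqAle eq_sym D0x eD.
  by split=> [|z]; [exact: rational_cst|rewrite ord_cst addr0; exact: eD].
have [U cU Ux] := component_off_exists xS.
have [oU conU _ US maxU] := cU.
exists U; last first.
  (* By reducedness every section is largest at [x], so the maximum principle lets no point of [U]
     be covered. *)
  move=> a Aa Ua; have /cov[F' F'D Ha] := HA a Aa.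
  have := max_not_covered F'D conU oU _ Ux (red F' F'D) Ua.
  by rewrite leNgt gtz0_ge1 Ha => H; have : false by apply: H => z /US/coeff_outdom.
split; first by exists (dom D0).
move=> Z [z Zz] ZU cZ cY.
pose B := point_breaks (x :: dom D0).
have SB e : {subset point_breaks (dom D0) e <= B e} by move=> w; rewrite inE orbC => ->.
have xB : x \in sub_verts B by apply: (mem_point_breaks (s := x :: dom D0)) => [e w //|]; exact: mem_head.
have DB : {subset dom D0 <= sub_verts B} by move=> w; exact: mem_point_breaks SB.
pose X : sub_vert B := SeqSub xB.
pose Zd := finset (fun p : sub_vert B => `[< Z (val p) >]).
have ZdE p : (p \in Zd) = `[< Z (val p) >] by rewrite inE.
(* [Z] contains a vertex: a segment with an inner point in [Z] avoids [U], and connected sets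
   outside [U] that meet [Z] stay in [Z]. *)
have [p0 p0Z] : exists p0, p0 \in Zd.
  have [zB|[p [d [h [pd h0 hr zE]]]]] := point_segment B z.
    by exists (SeqSub zB); rewrite ZdE; apply/asboolP.
  exists p; rewrite ZdE; apply/asboolP.
  have nUz : ~ U (ray (val p) d h) by rewrite -zE; exact: ZU.
  have hr' : 0 < h < reach B (val p) d by rewrite h0.
  have cl := connected_clopen cZ cY (@ray_connected _ _ (val p) d `[0, h]).
  apply: cl.
  - move=> y [s /=]; rewrite in_itv /= => sh <-.
    by apply: (segment_avoids cU SB pd hr' _ nUz); lra.
  - by exists z; split=> //; exists h; [rewrite /= in_itv /= lexx ltW|].
  - by exists 0; rewrite ?ray0 //= in_itv /= lexx ltW.
have XZ : X \notin Zd by rewrite ZdE; apply/asboolP => /ZU.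
have [p pZ] := reduced_burn (y := X) eD DB red p0Z XZ.
rewrite (sum_adj p (fun q => q \notin Zd)) => Hp.
have Zp : Z (val p) by move: pZ; rewrite ZdE => /asboolP.
(* A direction leaving [Zd] must start inside [U]: otherwise its closed segment would avoid [U], and
   its far end would be in [Z] together with [p]. *)
have germ d : dir_at (val p) d -> neighbor p d \notin Zd -> germ_in U (val p) d.
  move=> pd; rewrite ZdE => /asboolP nZ; have [r0 _ _ _] := reach_spec B pd.
  have hr : 0 < reach B (val p) d / 2 < reach B (val p) d by lra.
  apply: contrapT => ng; apply: nZ.
  have nU : ~ U (ray (val p) d (reach B (val p) d / 2)).
    by move=> Uh; apply: ng; exact: (component_germ cU SB pd hr Uh).
  have cl := connected_clopen cZ cY (@ray_connected _ _ (val p) d `[0, reach B (val p) d]).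
  apply: cl.
  - move=> y [s /=]; rewrite in_itv /= => sh <-.
    exact: (segment_avoids cU SB pd hr sh nU).
  - by exists (val p); split=> //; exists 0; rewrite ?ray0 //= in_itv /= lexx ltW.
  - exists (reach B (val p) d); first by rewrite /= in_itv /= lexx ltW.
    by rewrite val_neighbor.
(* Effectiveness of [D0] gives one leaving direction. It makes [val p] a boundary point of [U],
   hence a point with a chip, and the chip forces a second direction. *)
have [d1 pd1 nd1] : exists2 d, dir_at (val p) d & neighbor p d \notin Zd.
  by apply: sum_nat_gt0; apply: le_lt_trans Hp; exact: eD.
have nUp : ~ U (val p) by exact: ZU.
have g1 := germ d1 pd1 nd1.
have pS := component_boundary cU pd1 g1 nUp.
have Dp : 1 <= coeff (val p) D0.
  by rewrite -gtz0_ge1 lt_neqAle eD andbT eq_sym -mem_dom.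
have [d2 /andP[pd2 d21] nd2] : exists2 d, dir_at (val p) d && (d != d1) & neighbor p d \notin Zd.
  apply: sum_nat_gt0; have := le_lt_trans Dp Hp.
  by rewrite (bigD1 d1) //= nd1 ltrDl.
exists (val p) => //.
by apply: (@germs_two_sided _ _ U (val p) d1 d2) => //; [rewrite eq_sym|exact: germ].
Qed.

End ReducedToSpecial.

(** * The height function and the divisor of a burning order *)

Section BurningHeight.
Context (R : realType) (G : metricGraph R).
Implicit Types (x y z v : gpoint G) (d : edge G * bool) (e : edge G)
  (t h k r : R) (F : gpoint G -> R).

Lemma neighbor_neq (B : edge G -> seq R) (p : sub_vert B) d : dir_at (val p) d ->
  neighbor p d != p.
Proof.
move=> pd; have [r0 rl _ _] := reach_spec B pd.
apply/eqP => /(congr1 val); rewrite val_neighbor // -{3}(ray0 pd) /ray.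
have /andP[p0 pl] := pos_bound pd.
move: rl; rewrite /ray_len; case: d.2 => rl.
  by move=> /edge_pt_inj H; have : pos (val p) d + reach B (val p) d = pos (val p) d + 0; [apply: H; lra|lra].
by move=> /edge_pt_inj H; have : pos (val p) d - reach B (val p) d = pos (val p) d - 0; [apply: H; lra|lra].
Qed.

Lemma sum_dir_ray (B : edge G -> seq R) (p : sub_vert B) d h (f : edge G * bool -> int) :
  dir_at (val p) d -> 0 < h -> h < reach B (val p) d ->
  \sum_(d' | dir_at (ray (val p) d h) d') f d' = f d + f (rev_dir d).
Proof.
move=> pd h0 hr; have [r0 rl _ _] := reach_spec B pd.
have H := ray_inner pd h0 (lt_le_trans hr rl).
rewrite sum_dirE /ray (big_pred1 d.1) ?(big_pred1 d.1) => [|e|e]; rewrite ?dir_at_inner //.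
by case: d {pd hr r0 rl H} => e []; rewrite //= addrC.
Qed.

Lemma dir_ray (B : edge G -> seq R) (p : sub_vert B) d h d' :
  dir_at (val p) d -> 0 < h -> h < reach B (val p) d ->
  dir_at (ray (val p) d h) d' -> d' = d \/ d' = rev_dir d.
Proof.
move=> pd h0 hr; have [r0 rl _ _] := reach_spec B pd.
rewrite /ray dir_at_inner; last exact: ray_inner pd h0 (lt_le_trans hr rl).
case: d {pd hr r0 rl} => e b; case: d' => e' b' /= /eqP->.
by case: b; case: b'; [left|right|right|left].
Qed.

Context (S : seq (gpoint G)) (U : set (gpoint G)) (B : edge G -> seq R).
Context (compU : component_off S U).
Context (SB : forall e, {subset point_breaks S e <= B e}).
Context (germ_neighbor : forall (p : sub_vert B) d, dir_at (val p) d -> ~ U (val p) ->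
  germ_in U (val p) d -> U (val (neighbor p d))).

Lemma segment_in (p : sub_vert B) d : dir_at (val p) d -> ~ U (val p) ->
  U (val (neighbor p d)) -> forall h, 0 < h <= reach B (val p) d -> U (ray (val p) d h).
Proof.
move=> pd nU Un h hr; have [r0 _ _ _] := reach_spec B pd.
have [hl|lh] := ltP h (reach B (val p) d); last first.
  by rewrite (_ : h = reach B (val p) d) -?val_neighbor //; lra.
apply: contrapT => nUh.
have hr' : 0 < h < reach B (val p) d by lra.
have rr : 0 <= reach B (val p) d <= reach B (val p) d by lra.
by apply: (segment_avoids compU SB pd hr' rr nUh); rewrite -val_neighbor.
Qed.

(** An inner point in [U] would give a germ at [p], and [germ_neighbor] would then put the other end
    in [U]. *)
Lemma segment_out (p : sub_vert B) d : dir_at (val p) d -> ~ U (val p) ->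
  ~ U (val (neighbor p d)) -> forall h, 0 <= h <= reach B (val p) d -> ~ U (ray (val p) d h).
Proof.
move=> pd nU nUn h hr; have [r0 _ _ _] := reach_spec B pd.
have [hl|lh] := ltP h (reach B (val p) d); last first.
  by rewrite (_ : h = reach B (val p) d) -?val_neighbor //; lra.
have [h0|h0] := ltP 0 h; last by rewrite (_ : h = 0) ?ray0 //; lra.
move=> Uh; apply/nUn/germ_neighbor => //; apply: (component_germ (h := h) compU SB pd) => //.
by rewrite h0.
Qed.

Context (rho : sub_vert B -> nat) (p0 : sub_vert B).
Context (rho0 : forall p, rho p = 0%N <-> U (val p)).
Context (rho_inj : forall p q, ~ U (val p) -> rho p = rho q -> p = q).

Let rhoz z : R := (rho (insubd p0 z))%:R.
Let weight x y h k : R := (k * rhoz x + h * rhoz y) / (h + k).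

(** Linear interpolation of [rho] on the segments outside [U]; it carries the burning order over to
    the vertices of every refinement. *)
Definition height z : R :=
  if `[< U z >] then 0 else segment_ext B rhoz weight z.

Lemma height_in z : U z -> height z = 0.
Proof. by move=> Uz; rewrite /height asboolT. Qed.

Lemma height_val (p : sub_vert B) : height (val p) = (rho p)%:R.
Proof.
rewrite /height; case: asboolP => [/rho0 ->//|nU].
by rewrite /segment_ext ssvalP /rhoz valKd.
Qed.

Lemma rho_neighbor (p : sub_vert B) d : dir_at (val p) d -> ~ U (val p) ->
  (rho (neighbor p d))%:R != (rho p)%:R :> R.
Proof.
move=> pd nU; rewrite eqr_nat; apply/eqP => E.
by move/eqP: (neighbor_neq pd); apply; apply/esym/rho_inj.
Qed.

Lemma height_ray_val (p : sub_vert B) d h : dir_at (val p) d -> ~ U (val p) ->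
  ~ U (val (neighbor p d)) -> 0 <= h <= reach B (val p) d ->
  height (ray (val p) d h) =
    (rho p)%:R + h / reach B (val p) d * ((rho (neighbor p d))%:R - (rho p)%:R).
Proof.
move=> pd nU nUn hr; have [r0 _ _ _] := reach_spec B pd.
have [hl|lh] := ltP h (reach B (val p) d); last first.
  have -> : h = reach B (val p) d by lra.
  by rewrite -val_neighbor // height_val divff ?gt_eqF //; ring.
have [h0|h0] := ltP 0 h; last first.
  have -> : h = 0 by lra.
  by rewrite ray0 // height_val mul0r mul0r addr0.
rewrite /height asboolF; last exact: segment_out hr.
rewrite segment_ext_ray //; last by move=> x y a b; rewrite /weight addrC (addrC a).
rewrite /weight /rhoz !valKd; field.
by rewrite gt_eqF // gt_eqF //; lra.
Qed.

(** The point [z] may be inside a segment. The height is not constant on a segment outside [U]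
    because its ends are distinct and [rho] separates them. *)
Lemma height_ray z d : ~ U z -> dir_at z d ->
  let l := reach B z d in let w := ray z d l in
  (U w /\ forall h, 0 < h <= l -> U (ray z d h)) \/
  [/\ ~ U w, height w != height z &
    forall h, 0 <= h <= l -> ~ U (ray z d h) /\
      height (ray z d h) = height z + h / l * (height w - height z)].
Proof.
move=> nUz zd /=; have [r0 _ _ _] := reach_spec B zd.
have [zB|[p [d0 [h0 [pd h00 h0r zE]]]]] := point_segment B z.
  pose p : sub_vert B := SeqSub zB; have -> : z = val p by [].
  rewrite -val_neighbor //; have [Un|nUn] := pselect (U (val (neighbor p d))).
    by left; split=> //; exact: segment_in.
  right; split=> //; first by rewrite !height_val rho_neighbor.
  move=> h hr; split; first exact: segment_out hr.
  by rewrite !height_val; exact: height_ray_val.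
right; have [s0 _ _ _] := reach_spec B pd.
have hr' : 0 < h0 < reach B (val p) d0 by lra.
have out k : 0 <= k <= reach B (val p) d0 -> ~ U (ray (val p) d0 k).
  by move=> kr; apply: (segment_avoids compU SB pd hr' kr); rewrite -zE.
have nUp : ~ U (val p) by rewrite -(ray0 pd); apply: out; lra.
have nUn : ~ U (val (neighbor p d0)) by rewrite val_neighbor //; apply: out; lra.
have Hk k : 0 <= k <= reach B (val p) d0 -> height (ray (val p) d0 k) =
    (rho p)%:R + k / reach B (val p) d0 * ((rho (neighbor p d0))%:R - (rho p)%:R).
  by move=> kr; exact: height_ray_val.
have neq := rho_neighbor pd nUp; rewrite -subr_eq0 in neq.
have [H1 H2 H3 [H4 H5] [H6 H7]] := reach_shift pd h00 h0r.
rewrite zE in zd *; set l := reach B (val p) d0 in s0 h0r hr' out Hk H4.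
have [->|->] := dir_ray pd h00 h0r zd.
  rewrite H4 !H6 (addrC h0) subrK; split; first by apply: out; lra.
    rewrite !Hk; [|lra|lra].
    rewrite divff; last by rewrite gt_eqF.
    rewrite -subr_eq0.
    rewrite (_ : _ - _ = (1 - h0 / l) * ((rho (neighbor p d0))%:R - (rho p)%:R)); last by ring.
    by rewrite mulf_neq0 // subr_eq0 eq_sym lt_eqF // ltr_pdivrMr // mul1r.
  move=> h hr; rewrite H6 !Hk; [|lra|lra|lra].
  split; first by apply: out; lra.
  by field; rewrite gt_eqF // gt_eqF //; lra.
rewrite H5 !H7 subrr; split; first by apply: out; lra.
  rewrite !Hk; [|lra|lra].
  rewrite -subr_eq0 (_ : _ - _ = - (h0 / l) * ((rho (neighbor p d0))%:R - (rho p)%:R)); last by ring.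
  by rewrite mulf_neq0 // oppr_eq0 mulf_neq0 ?invr_neq0 // gt_eqF.
move=> h hr; rewrite H7 !Hk; [|lra|lra|lra].
split; first by apply: out; lra.
by field; rewrite gt_eqF // gt_eqF //; lra.
Qed.

Lemma height_gt0 z : ~ U z -> 0 < height z.
Proof.
move=> nUz; have rho_gt0 p : ~ U (val p) -> 0 < (rho p)%:R :> R.
  by move=> nU; rewrite ltr0n lt0n; apply/eqP => /rho0.
have [zB|[p [d [h [pd h0 hr zE]]]]] := point_segment B z.
  have -> : z = val (SeqSub zB : sub_vert B) by [].
  by rewrite height_val; exact: rho_gt0.
have [s0 _ _ _] := reach_spec B pd.
have hr' : 0 < h < reach B (val p) d by lra.
have out k : 0 <= k <= reach B (val p) d -> ~ U (ray (val p) d k).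
  by move=> kr; apply: (segment_avoids compU SB pd hr' kr); rewrite -zE.
have nUp : ~ U (val p) by rewrite -(ray0 pd); apply: out; lra.
have nUn : ~ U (val (neighbor p d)) by rewrite val_neighbor //; apply: out; lra.
rewrite zE height_ray_val //; last by lra.
have := rho_gt0 p nUp; have := rho_gt0 _ nUn.
set a := (rho p)%:R; set b := (rho _)%:R => b0 a0.
have -> : a + h / reach B (val p) d * (b - a) =
  (1 - h / reach B (val p) d) * a + h / reach B (val p) d * b by ring.
have l1 : 0 < h / reach B (val p) d by rewrite divr_gt0.
have l2 : h / reach B (val p) d < 1 by rewrite ltr_pdivrMr // mul1r.
by rewrite addr_gt0 // mulr_gt0 // subr_gt0.
Qed.

Lemma ray_reach z d : dir_at z d -> exists q : sub_vert B, ray z d (reach B z d) = val q.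
Proof. by move=> zd; have [_ _ _ rB] := reach_spec B zd; exists (SeqSub rB). Qed.

(* The burning orientation: fire arrives at [p] along the rays that start by
   descending along [height]. *)
Definition indegree (p : sub_vert B) : int :=
  \sum_(d | dir_at (val p) d) (rho (neighbor p d) < rho p)%N%:R.

(** The usual divisor of an acyclic orientation, indegree minus one, with no chips on the source
    [U]. *)
Definition burning_divisor : divisor G :=
  \sum_p << (if `[< U (val p) >] then 0 else indegree p - 1) *g val p >>.

Context (rho_burn : forall p, ~ U (val p) ->
  2 <= \sum_(d | dir_at (val p) d) `[< U (val (neighbor p d)) >]%:R :> int \/
  exists d, [/\ dir_at (val p) d, ~ U (val (neighbor p d)) & (rho (neighbor p d) < rho p)%N]).

Lemma burning_divisor_val p : ~ U (val p) -> coeff (val p) burning_divisor = indegree p - 1.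
Proof.
by move=> nU; rewrite (coeff_sum_sub_val (fun p => if `[< U (val p) >] then 0 else indegree p - 1)) asboolF.
Qed.

Lemma burning_divisor_off x : x \notin sub_verts B -> coeff x burning_divisor = 0.
Proof. exact: coeff_sum_sub_off. Qed.

Lemma burning_divisor_in x : U x -> coeff x burning_divisor = 0.
Proof.
move=> Ux; have [xB|/burning_divisor_off//] := boolP (x \in sub_verts B).
rewrite (_ : x = val (SeqSub xB : sub_vert B)) //.
by rewrite (coeff_sum_sub_val (fun p => if `[< U (val p) >] then 0 else indegree p - 1)) asboolT.
Qed.

Lemma rho_neighbor_in p d : ~ U (val p) -> U (val (neighbor p d)) ->
  (rho (neighbor p d) < rho p)%N.
Proof.
move=> nU /rho0 ->; rewrite lt0n; apply/eqP => /rho0; exact: nU.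
Qed.

Lemma indegree_ge1 p : ~ U (val p) -> 1 <= indegree p.
Proof.
move=> nU; have [H|[d [pd _ rd]]] := rho_burn nU.
  apply: le_trans (le_trans (_ : 1 <= 2) H) _ => //.
  apply: ler_sum => d pd; case: asboolP => [Un|_]; last by rewrite ler0n.
  by rewrite rho_neighbor_in.
rewrite /indegree (bigD1 d) //= rd lerDl.
by apply: sumr_ge0 => d' _; rewrite ler0n.
Qed.

Lemma burning_divisor_effective : effective burning_divisor.
Proof.
move=> x; have [Ux|nU] := pselect (U x); first by rewrite burning_divisor_in.
have [xB|/burning_divisor_off-> //] := boolP (x \in sub_verts B).
have xE : x = val (SeqSub xB : sub_vert B) by [].
by rewrite xE burning_divisor_val ?subr_ge0 ?indegree_ge1 -?xE.
Qed.

(** Let [M] be the set of vertices where a section [F] is maximal. If [M] meets [U], the maximum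
    principle applies on [U]. Otherwise some vertex of [M] has fewer chips than edges leaving [M],
    and [F] takes away at least one chip for each of these edges. *)
Lemma burning_divisor_uncovered x : U x -> ~ covers burning_divisor x.
Proof.
move=> Ux [F FD Fx]; have rF := FD.1; have [oU cU _ _ _] := compU.
have [P _ HP] := @Order.TotalTheory.arg_maxP _ _ _ p0 xpredT (fun p => F (val p)) isT.
have ord_off z : z \notin sub_verts B -> 0 <= ord F z.
  by move=> zB; have := FD.2 z; rewrite burning_divisor_off // add0r.
(* Inside a segment [F] is convex, so in one of the two directions it does not decrease until the
   next vertex. *)
have Fmax z : F z <= F (val P).
  have [zB|[p [d [h [pd h0 hr ->]]]]] := point_segment B z.
    exact: (HP (SeqSub zB)).
  have [H1 H2 H3 [H4 H5] [H6 H7]] := reach_shift pd h0 hr.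
  set w := ray (val p) d h in H1 H2 H3 H4 H5 H6 H7 *.
  have up d' : dir_at w d' -> 0 <= slope F w d' -> F w <= F (val P).
    move=> wd s0; have [r0 rl Hr _] := reach_spec B wd.
    have [q qE] := ray_reach wd.
    apply: le_trans (HP q isT); rewrite /= -qE.
    have H : F w + (slope F w d')%:~R * reach B w d' <= F (ray w d' (reach B w d')).
      by apply: (ray_convex rF wd rl); [move=> k kr; apply: ord_off; exact: Hr|rewrite lexx ltW].
    by apply: le_trans H; rewrite lerDl mulr_ge0 ?ler0z // ltW.
  have := ord_off w H3; rewrite ord_ray // -/w => s12.
  have [s1|s1] := leP 0 (slope F w d); first exact: up H1 s1.
  by apply: up H2 _; lia.
pose M := finset (fun p : sub_vert B => F (val p) == F (val P)).
have PM : P \in M by rewrite inE.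
pose Ud := finset (fun p : sub_vert B => `[< U (val p) >]).
have UdE p : (p \in Ud) = `[< U (val p) >] by rewrite inE.
have ME p : p \in M -> forall z, F z <= F (val p).
  by rewrite inE => /eqP ->.
have [MU|/pred0Pn[p /= /andP[pM]]] := boolP [disjoint M & Ud]; last first.
  rewrite UdE => /asboolP Up.
  have := max_not_covered FD cU oU (fun z => @burning_divisor_in z) Up (ME p pM) Ux.
  by rewrite leNgt gtz0_ge1 Fx.
have [||p pM] := @indegree_burns _ (adj (B := B)) Ud (@adj_ge0 _ _ B) R
    (fun p => (rho p)%:R) (fun p => coeff (val p) burning_divisor) _ M _ MU.
- move=> p; rewrite UdE => /asboolP nU; rewrite burning_divisor_val //.
  by rewrite sum_adj; congr (_ - 1); apply: eq_bigr => d _; rewrite ltr_nat.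
- by apply/finset.set0Pn; exists P.
rewrite (sum_adj p (fun q => q \notin M)) ltNge => /negP; apply.
have := FD.2 (val p); rewrite -lerBlDr sub0r; apply: le_trans.
rewrite ordE -sumrN; apply: ler_sum => d pd.
have s0 := slope_le0_max rF pd (ME p pM).
case: (boolP (neighbor p d \in M)) => [_|nM]; first by rewrite oppr_ge0.
suff sn0 : slope F (val p) d != 0.
  by rewrite -[leLHS]/(1 : int); move: (slope F (val p) d) s0 sn0 => s; lia.
apply: contraNneq nM => s00; have [r0 rl Hr _] := reach_spec B pd.
have : F (val p) + (slope F (val p) d)%:~R * reach B (val p) d <= F (ray (val p) d (reach B (val p) d)).
  by apply: (ray_convex rF pd rl); [move=> k kr; apply: ord_off; exact: Hr|rewrite lexx ltW].
rewrite s00 mul0r addr0 -val_neighbor // => Fn.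
rewrite inE eq_le Fmax /=; apply: le_trans Fn; by move: pM; rewrite inE => /eqP ->.
Qed.

Section Refinement.
Context (B2 : edge G -> seq R).
Context (BB2 : forall e, {subset B e <= B2 e}).
Implicit Types p q : sub_vert B2.

Lemma reach_refine z d : dir_at z d -> reach B2 z d <= reach B z d.
Proof.
move=> zd; have [r0 rl Hr rB] := reach_spec B zd; have [s0 sl Hs sB] := reach_spec B2 zd.
rewrite leNgt; apply/negP => rs; have := Hs (reach B z d).
by rewrite r0 rs (sub_verts_sub BB2 rB) => /(_ isT).
Qed.

(** The height is affine on the old segment, so the nearer new neighbor is lower exactly when the
    old end [w] is. *)
Lemma neighbor_refine p d : ~ U (val p) -> dir_at (val p) d ->
  let w := ray (val p) d (reach B (val p) d) in
  (U w /\ U (val (neighbor p d))) \/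
  [/\ ~ U w, ~ U (val (neighbor p d)), height (val (neighbor p d)) != height (val p) &
     (height (val (neighbor p d)) < height (val p)) = (height w < height (val p))].
Proof.
move=> nU pd /=; have [r0 _ _ _] := reach_spec B pd; have [s0 _ _ _] := reach_spec B2 pd.
have rs := reach_refine pd; rewrite val_neighbor //.
have [[Uw Uh]|[nUw Hneq Hh]] := height_ray nU pd.
  by left; split=> //; apply: Uh; rewrite s0.
right; have [|nUn ->] := Hh (reach B2 (val p) d); first by rewrite (ltW s0).
have q0 : 0 < reach B2 (val p) d / reach B (val p) d by rewrite divr_gt0.
split=> //; first by rewrite -subr_eq0 addrAC subrr add0r mulf_neq0 // ?subr_eq0 // gt_eqF.
by rewrite -[X in _ < X]addr0 ltrD2l pmulr_rlt0 // subr_lt0.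
Qed.

(** An old vertex keeps its descending directions. An inserted one outside [U] lies on a segment of
    strictly monotone height: exactly one of its two directions descends, which matches the absence
    of a chip. *)
Lemma indegree_refine p : ~ U (val p) ->
  coeff (val p) burning_divisor =
  \sum_(q | height (val q) < height (val p)) adj p q - 1.
Proof.
move=> nU; rewrite (sum_adj p (fun q => height (val q) < height (val p))).
have hU q : U (val q) -> height (val q) < height (val p).
  by move=> Uq; rewrite height_in // height_gt0.
pose w d := ray (val p) d (reach B (val p) d).
have -> : \sum_(d | dir_at (val p) d) (height (val (neighbor p d)) < height (val p))%R%:R =
    \sum_(d | dir_at (val p) d) (height (w d) < height (val p))%R%:R :> int.
  apply: eq_bigr => d pd; have [[Uw Un]|[_ _ _ ->//]] := neighbor_refine nU pd.
  by rewrite hU // /w height_in // height_gt0.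
have [pB|[a [d [h [ad h0 hr pE]]]]] := point_segment B (val p).
  have [a aE] : exists a : sub_vert B, val p = val a by exists (SeqSub pB).
  rewrite /w aE in nU *; rewrite burning_divisor_val //; congr (_ - 1).
  by apply: eq_bigr => d ad; rewrite -val_neighbor // !height_val ltr_nat.
rewrite burning_divisor_off; last by rewrite pE; have [] := reach_shift ad h0 hr.
have [r0 _ _ _] := reach_spec B ad.
have [H1 H2 H3 [H4 H5] [H6 H7]] := reach_shift ad h0 hr.
have hr' : 0 < h < reach B (val a) d by lra.
have out k : 0 <= k <= reach B (val a) d -> ~ U (ray (val a) d k).
  by move=> kr; apply: (segment_avoids compU SB ad hr' kr); rewrite -pE.
have nUa : ~ U (val a) by rewrite -(ray0 ad); apply: out; lra.
have nUn : ~ U (val (neighbor a d)) by rewrite val_neighbor //; apply: out; lra.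
have hp : height (val p) = (rho a)%:R + h / reach B (val a) d *
    ((rho (neighbor a d))%:R - (rho a)%:R) by rewrite pE; apply: height_ray_val => //; lra.
have neq := rho_neighbor ad nUa.
have wd : w d = val (neighbor a d) by rewrite /w pE H4 H6 addrC subrK val_neighbor.
have wr : w (rev_dir d) = val a by rewrite /w pE H5 H7 subrr ray0.
rewrite {1}pE (sum_dir_ray _ ad h0 hr) wd wr !height_val hp.
have l1 : 0 < h / reach B (val a) d by rewrite divr_gt0.
have l2 : h / reach B (val a) d < 1 by rewrite ltr_pdivrMr // mul1r.
set l := h / _ in l1 l2 *; move: neq.
set x := (rho a)%:R; set y := (rho _)%:R => neq.
have [xy|yx|E] := ltgtP x y; last by rewrite E eqxx in neq.
  have -> : y < x + l * (y - x) = false by apply/negbTE; rewrite -leNgt; nra.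
  by have -> : x < x + l * (y - x) by nra.
have -> : y < x + l * (y - x) by nra.
by have -> : x < x + l * (y - x) = false by apply/negbTE; rewrite -leNgt; nra.
Qed.

End Refinement.

End BurningHeight.

(** * From special open sets to divisors *)

Section SpecialToDivisor.
Context (R : realType) (G : metricGraph R).
Implicit Types (x y z v : gpoint G) (d : edge G * bool) (e : edge G)
  (t h k r : R) (F : gpoint G -> R).
Context (S : seq (gpoint G)) (U : set (gpoint G)) (B : edge G -> seq R).
Context (compU : component_off S U).
Context (SB : forall e, {subset point_breaks S e <= B e}).
Context (germ_neighbor : forall (p : sub_vert B) d, dir_at (val p) d -> ~ U (val p) ->
  germ_in U (val p) d -> U (val (neighbor p d))).

Lemma adj_neighbor (B' : edge G -> seq R) (p : sub_vert B') d : dir_at (val p) d ->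
  0 < adj p (neighbor p d).
Proof.
move=> pd; rewrite /adj (bigD1 d) //= eqxx; apply: ltr_pwDl => //.
by apply: sumr_ge0 => d' _; rewrite ler0n.
Qed.

Section Covers.
Context (rho : sub_vert B -> nat) (p0 : sub_vert B).
Context (rho0 : forall p, rho p = 0%N <-> U (val p)).
Context (rho_inj : forall p q, ~ U (val p) -> rho p = rho q -> p = q).
Context (rho_burn : forall p, ~ U (val p) ->
  2 <= \sum_(d | dir_at (val p) d) `[< U (val (neighbor p d)) >]%:R :> int \/
  exists d, [/\ dir_at (val p) d, ~ U (val (neighbor p d)) & (rho (neighbor p d) < rho p)%N]).

Let D := burning_divisor U rho.
Let H := height U rho p0.

(** An inserted vertex has indegree 1 by [indegree_refine], hence a lower neighbor, which is not in
    [U] because the whole old segment is outside [U]. *)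
Lemma burn_refine (B2 : edge G -> seq R) (p : sub_vert B2) :
  (forall e, {subset B e <= B2 e}) -> ~ U (val p) ->
  2 <= \sum_(q in finset (fun q : sub_vert B2 => `[< U (val q) >])) adj p q \/
  exists q, [/\ ~ U (val q), H (val q) < H (val p) & 0 < adj p q].
Proof.
move=> BB2 nU.
have nb := @neighbor_refine _ _ _ _ _ compU SB germ_neighbor rho p0 rho0 rho_inj _ BB2.
have [pB|[a [d [h [ad h0 hr pE]]]]] := point_segment B (val p).
  have [a aE] : exists a : sub_vert B, val p = val a by exists (SeqSub pB).
  have nUa : ~ U (val a) by rewrite -aE.
  have [H2|[d [ad nUn rd]]] := rho_burn nUa; [left|right].
    apply: le_trans H2 _; rewrite (sum_adj p (fun q => q \in _)) aE; apply: ler_sum => d ad.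
    case: asboolP => Un; last by rewrite ler0n.
    rewrite inE asboolT //; have pd : dir_at (val p) d by rewrite aE.
    have [[]//|[nUw _ _ _]] := nb p d nU pd.
    by case: nUw; rewrite aE -val_neighbor.
  have pd : dir_at (val p) d by rewrite aE.
  have [[Uw _]|[_ nUn2 _ E]] := nb p d nU pd.
    by case: nUn; rewrite val_neighbor // -aE.
  exists (neighbor p d); split=> //; last exact: adj_neighbor.
  by rewrite /H E aE -val_neighbor // !(height_val _ rho0) ltr_nat.
right; have pB : val p \notin sub_verts B by rewrite pE; have [] := reach_shift ad h0 hr.
have := indegree_refine compU SB germ_neighbor p0 rho0 rho_inj BB2 nU.
rewrite burning_divisor_off // => /eqP; rewrite eq_sym subr_eq0 => /eqP E.
have [q Hq aq] : exists2 q, H (val q) < H (val p) & 0 < adj p q.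
  apply: contrapT => nq; suff : \sum_(q | H (val q) < H (val p)) adj p q <= 0 by rewrite E.
  apply: sumr_le0 => q Hq; rewrite leNgt; apply/negP => aq; apply: nq; by exists q.
exists q; split=> // Uq.
have [d' pd' /eqP qE] := sum_nat_gt0 aq.
have [[Uw _]|[_ nUn2 _ _]] := nb p d' nU pd'; last by apply: nUn2; rewrite qE.
have hr' : 0 < h < reach B (val a) d by rewrite h0.
have [s0 _ _ _] := reach_spec B ad.
have out k : 0 <= k <= reach B (val a) d -> ~ U (ray (val a) d k).
  by move=> kr; apply: (segment_avoids compU SB ad hr' kr); rewrite -pE.
have [_ _ _ [H4 H5] [H6 H7]] := reach_shift ad h0 hr.
rewrite pE in pd' Uw; have [d'E|d'E] := dir_ray ad h0 hr pd'; rewrite d'E in Uw.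
  by rewrite H4 H6 addrC subrK in Uw; apply: out Uw; lra.
by rewrite H5 H7 subrr in Uw; apply: out Uw; lra.
Qed.

(** Let [D1 = D + (F)] be [y]-reduced, and [N] the set of vertices where [F] is minimal. Passing
    from [D] to [D1] adds at least one chip on [N] for each edge leaving it, so if [D1] had no chip
    at [y], burning it from [y] would contradict [no_double_burning]. *)
Lemma burning_divisor_covers x y : U x -> ~ U y -> covers D y.
Proof.
move=> Ux nUy.
have eD : effective D by exact: burning_divisor_effective.
have D0 : lsection D (fun=> 0).
  by split=> [|z]; [exact: rational_cst|rewrite ord_cst addr0; exact: eD].
have [F [FD red]] := reduced_exists y D0.
have rF := FD.1.
set D1 := D + principal F in red.
have eD1 : effective D1 by exact: effective_section.
have D1E z : coeff z D1 = coeff z D + ord F z by rewrite coeffD coeff_principal.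
have [y1|y0] := leP 1 (coeff y D1); first by exists F => //; rewrite -D1E.
exfalso.
(* The function [- F] leads back from [D1] to the effective [D], so it is a section of [D1], largest
   at [y]. *)
have Fmin z : F y <= F z.
  rewrite -lerN2; apply: (red (fun x => - F x)).
  split=> [|w]; first exact: rationalN.
  by rewrite D1E ordN // addrK; exact: eD.
have [B0 aF0] := adapted_exists rF.
(* One refinement for the burning order, the breakpoints of [F] and the support of [D1], with [x]
   and [y] among its vertices. *)
pose B2 e := B e ++ B0 e ++ point_breaks (y :: x :: dom D1) e.
have BB2 e : {subset B e <= B2 e} by move=> w; rewrite mem_cat => ->.
have aF : adapted B2 F by apply: adapted_sub aF0 => e w; rewrite !mem_cat orbCA => ->.
have PB2 e : {subset point_breaks (y :: x :: dom D1) e <= B2 e}.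
  by move=> w; rewrite !mem_cat => ->; rewrite !orbT.
have yB : y \in sub_verts B2 by apply: (mem_point_breaks PB2); rewrite mem_head.
have xB : x \in sub_verts B2 by apply: (mem_point_breaks PB2); rewrite !inE eqxx orbT.
have DB : {subset dom D1 <= sub_verts B2}.
  by move=> w wD; apply: (mem_point_breaks PB2); rewrite !inE wD !orbT.
pose Y : sub_vert B2 := SeqSub yB.
pose U2 := finset (fun q : sub_vert B2 => `[< U (val q) >]).
have U2E q : (q \in U2) = `[< U (val q) >] by rewrite inE.
pose N := finset (fun q : sub_vert B2 => F (val q) == F y).
have NE q : q \in N -> forall z, F (val q) <= F z by rewrite inE => /eqP->.
have nb := @neighbor_refine _ _ _ _ _ compU SB germ_neighbor rho p0 rho0 rho_inj _ BB2.
apply: (@no_double_burning _ (adj (B := B2)) U2 (@adj_ge0 _ _ B2) R (fun p => H (val p))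
  _ _ (fun p => coeff (val p) D) (fun p => coeff (val p) D1) Y N).
- move=> p q; rewrite !U2E => /asboolP Up /asboolP nUq; rewrite /H height_in //.
  exact: (height_gt0 compU SB germ_neighbor p0 rho0 nUq).
- move=> p; rewrite U2E => /asboolP nUp; have [|[q [nUq Hq aq]]] := burn_refine BB2 nUp; [by left|right].
  by exists q; split=> //; rewrite U2E; apply/asboolP.
- exact: adj_sym.
- move=> p q; rewrite !U2E => /asboolP nUp /asboolP nUq aq.
  have [d pd /eqP qE] := sum_nat_gt0 aq.
  have [[_ Un]|[_ _ + _]] := nb p d nUp pd; first by case: nUq; rewrite -qE.
  by rewrite qE eq_sym.
- by move=> p; rewrite U2E => /asboolP nUp; exact: (indegree_refine compU SB germ_neighbor p0 rho0 rho_inj BB2 nUp).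
- by apply/finset.set0Pn; exists (SeqSub xB); rewrite U2E; apply/asboolP.
- by rewrite U2E; apply/asboolP.
- by rewrite inE /=.
- by move: y0; rewrite /=; lia.
- by move=> p; exact: eD1.
- move=> Z /finset.set0Pn[q qZ] YZ.
  exact: (reduced_burn (y := Y) eD1 DB red qZ YZ).
- move=> p pN pU; rewrite D1E lerD2l (sum_adj p (fun q => q \notin N)) ordE.
  apply: ler_sum => d pd; have s0 := slope_ge0_min rF pd (NE p pN).
  case: (boolP (neighbor p d \in N)) => [//|nN].
  suff sn0 : slope F (val p) d != 0.
    by rewrite -[leLHS]/(1 : int); move: (slope F (val p) d) s0 sn0 => s; lia.
  apply: contraNneq nN => s00; rewrite inE adapted_neighbor // s00 mul0r addr0.
  by move: pN; rewrite inE.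
Qed.

End Covers.

(** The part of the complement of [U] carried by the vertices in [W] and the open segments issuing
    from them. *)
Let off (W : sub_vert B -> Prop) : set (gpoint G) := [set z | ~ U z /\ exists2 p, W p &
  z = val p \/ exists d h, [/\ dir_at (val p) d, 0 < h, h < reach B (val p) d & z = ray (val p) d h]].

Lemma open_off W : open (U `|` off W).
Proof.
have [oU _ _ _ _] := compU; rewrite openE => z [Uz|[nUz [p Wp pz]]].
  have := oU; rewrite openE => /(_ z Uz); apply: filterS => w; by left.
have rayW d h : dir_at (val p) d -> 0 < h -> h < reach B (val p) d ->
    (U `|` off W) (ray (val p) d h).
  move=> pd h0 hr; have [Uh|nUh] := pselect (U (ray (val p) d h)); [by left|right].
  by split=> //; exists p => //; right; exists d, h.
case: pz => [zE|[d [h [pd h0 hr zE]]]].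
  rewrite zE; apply: nbhs_ray.
    by right; split; [rewrite -zE|exists p => //; left].
  move=> d pd; have [r0 _ _ _] := reach_spec B pd.
  by exists (reach B (val p) d) => // h /andP[h0 hr]; exact: rayW.
rewrite zE; have [_ rl _ _] := reach_spec B pd.
apply: filterS (branch_nbhs pd h0 hr rl) => w [k /= /andP[k0 kr] <-]; exact: rayW.
Qed.

(** [off] turns [Z] and the other vertices outside [U] into two disjoint sets exhausting the
    complement of [U]; each is closed because the other together with [U] is open. Specialness
    yields a point with two germs into [U]; being a boundary point it is in [S], hence a vertex of
    [Z], and each germ is an edge into [U]. *)
Lemma special_discrete (Z : {set sub_vert B}) : special_open U ->
  (exists p, p \in Z) -> (forall p, p \in Z -> ~ U (val p)) ->
  (forall p q, p \in Z -> ~ U (val q) -> q \notin Z -> adj p q = 0) ->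
  exists2 p, p \in Z & 2 <= \sum_(q | `[< U (val q) >]) adj p q.
Proof.
move=> [_ sp] [q0 q0Z] ZU Zadj.
pose WZ (p : sub_vert B) : Prop := p \in Z.
pose WY (p : sub_vert B) : Prop := ~ U (val p) /\ p \notin Z.
have cover z : ~ U z -> off WZ z \/ off WY z.
  move=> nUz; have [p [nUp pz]] : exists p : sub_vert B, ~ U (val p) /\ (z = val p \/ exists d h,
      [/\ dir_at (val p) d, 0 < h, h < reach B (val p) d & z = ray (val p) d h]).
    have [zB|[p [d [h [pd h0 hr zE]]]]] := point_segment B z.
      by exists (SeqSub zB); split=> //; left.
    exists p; split; last by right; exists d, h.
    have hr' : 0 < h < reach B (val p) d by rewrite h0.
    rewrite -(ray0 pd); apply: (segment_avoids compU SB pd hr'); last by rewrite -zE.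
    by rewrite lexx; lra.
  have [pZ|pZ] := boolP (p \in Z); [left|right]; by split=> //; exists p.
have disj z : off WZ z -> off WY z -> False.
  move=> [nUz [p pZ pz]] [_ [q [nUq qZ] qz]].
  case: pz qz => [pE|[d [h [pd h0 hr pE]]]] [qE|[d' [h' [qd h0' hr' qE]]]].
  - by move: qZ; rewrite (_ : q = p) ?pZ //; apply: val_inj; rewrite -qE.
  - have [_ _ + _ _] := reach_shift qd h0' hr'.
    by rewrite -qE pE ssvalP.
  - have [_ _ + _ _] := reach_shift pd h0 hr.
    by rewrite -pE qE ssvalP.
  (* A segment common to both sets would be an edge from [Z] to another vertex outside [U], which
     [Zadj] excludes. *)
  have [_ _ _ [H4 H5] [H6 H7]] := reach_shift pd h0 hr.
  have [_ zd' _ [_ K5] [_ K7]] := reach_shift qd h0' hr'.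
  rewrite -qE pE in zd' K5 K7.
  have qE' : val q = ray (ray (val p) d h) (rev_dir d') (reach B (ray (val p) d h) (rev_dir d')).
    by rewrite K5 K7 subrr ray0.
  have [d'E|d'E] := dir_ray pd h0 hr zd'; rewrite d'E in qE'.
    move: qE'; rewrite H4 H6 addrC subrK -val_neighbor // => /val_inj qn.
    have := adj_neighbor pd; rewrite -qn Zadj //; by rewrite ltxx.
  move: qE'; rewrite H5 H7 subrr ray0 // => /val_inj qp.
  by move: qZ; rewrite qp pZ.
have offC W W' : (forall z, ~ U z -> off W z \/ off W' z) -> (forall z, off W z -> off W' z -> False) ->
    closed (off W).
  move=> cov dis; rewrite (_ : off W = ~` (U `|` off W')); first by apply: open_closedC; exact: open_off.
  apply/seteqP; split=> z.
    by move=> Wz [Uz|]; [case: Wz => /(_ Uz)|exact: dis].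
  by move=> /not_orP[nU nW]; case: (cov z nU).
have Z1 : off WZ !=set0.
  exists (val q0); split; first exact: ZU.
  by exists q0 => //; left.
have ZC : off WZ `<=` ~` U by move=> z [].
have Zcl : closed (off WZ) by exact: offC cover disj.
have Ycl : closed (~` U `\` off WZ).
  rewrite (_ : _ `\` _ = off WY).
    by apply: (offC _ WZ) => z; [move=> /cover[]; [right|left]|move=> Wy Wz; exact: disj Wz Wy].
  apply/seteqP; split=> z; first by move=> [nU nW]; case: (cover z nU).
  by move=> Wz; split; [case: Wz|move=> Wz'; exact: disj Wz' Wz].
have [v [nUv [p pZ pv]] tv] := sp (off WZ) Z1 ZC Zcl Ycl.
have [d1 [d2 [d12 vd1 vd2 g1 g2]]] := two_sided_germs compU nUv tv.
case: pv => [vE|[d [h [pd h0 hr vE]]]]; last first.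
  have vS := component_boundary compU vd1 g1 nUv.
  have [_ _ + _ _] := reach_shift pd h0 hr.
  by rewrite -vE => /negP; case; exact: mem_point_breaks SB vS.
exists p => //; rewrite (sum_adj p (fun q => `[< U (val q) >])).
rewrite vE in vd1 vd2 g1 g2 nUv.
by apply: (sum_nat_ge2 vd1 vd2 _ _ d12); apply/asboolP/germ_neighbor.
Qed.

End SpecialToDivisor.

Lemma divisor_of_special (R : realType) (G : metricGraph R) (U : set (gpoint G)) :
  special_open U -> exists2 D : divisor G, (forall y, ~ U y -> covers D y) &
    forall x, U x -> ~ covers D x.
Proof.
move=> spU; have [[S cU] _] := spU; have [_ _ [x0 Ux0] _ _] := cU.
pose B0 := point_breaks S.
(* Midpoints of the segments issuing from [S]. Germs into [U] from outside start only at points of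
   [S]; once the midpoints are vertices, the neighbor along such a germ is an inner point of a
   segment of [B0], hence in [U]. *)
pose T := [seq ray p d (reach B0 p d / 2) | p <- S, d <- enum {: edge G * bool}].
pose B := point_breaks (x0 :: S ++ T).
have memB z : z \in x0 :: S ++ T -> z \in sub_verts B by apply: mem_point_breaks => e w.
have SB e : {subset point_breaks S e <= B e}.
  by move=> w /mapP[z zS ->]; apply/mapP; exists z => //; rewrite inE mem_cat zS orbT.
have gn (p : sub_vert B) d : dir_at (val p) d -> ~ U (val p) -> germ_in U (val p) d ->
    U (val (neighbor p d)).
  move=> pd nU g; have pS := component_boundary cU pd g nU.
  have [r0 rl _ _] := reach_spec B pd; have [s0 sl Hs _] := reach_spec B0 pd.
  have rB0 : reach B (val p) d <= reach B0 (val p) d / 2.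
    rewrite leNgt; apply/negP => H.
    have hB : ray (val p) d (reach B0 (val p) d / 2) \in sub_verts B.
      apply: memB; rewrite inE mem_cat; apply/orP; right; apply/orP; right.
      by apply/allpairsP; exists (val p, d); split=> //; rewrite mem_enum.
    have [_ _ Hr _] := reach_spec B pd; have := Hr (reach B0 (val p) d / 2).
    by rewrite H hB divr_gt0 // => /(_ isT).
  have [r rr0 gr] := g.
  have [m1 m2] := min_le2 (r / 2) (reach B0 (val p) d / 2).
  have m0 : 0 < Num.min (r / 2) (reach B0 (val p) d / 2) by rewrite lt_min !divr_gt0.
  rewrite val_neighbor //.
  apply: (component_segment (B := B0) (h := Num.min (r / 2) (reach B0 (val p) d / 2)) cU _ pd).
  - by move=> e w.
  - by lra.
  - by lra.
  - by apply: gr; lra.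
pose Ud := finset (fun q : sub_vert B => `[< U (val q) >]).
have UdE q : (q \in Ud) = `[< U (val q) >] by rewrite inE.
have sumUd p : \sum_(q in Ud) adj p q = \sum_(q | `[< U (val q) >]) adj p q.
  by apply: eq_bigl => q; rewrite UdE.
have [|rho [rho0 rho_inj rho_burn]] := @burning_order _ (adj (B := B)) Ud (@adj_ge0 _ _ B).
  move=> Z /finset.set0Pn Z0 ZU Zadj.
  have ZnU p : p \in Z -> ~ U (val p).
    by move=> pZ; have := disjointFr ZU pZ; rewrite UdE => /asboolP.
  have [|p pZ Hp] := special_discrete cU SB gn spU Z0 ZnU.
    by move=> p q pZ nUq qZ; apply: Zadj => //; rewrite UdE; apply/asboolP.
  by exists p; rewrite // sumUd.
have {}rho0 p : rho p = 0%N <-> U (val p).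
  by split=> [/eqP|Up]; [rewrite rho0 UdE => /asboolP|apply/eqP; rewrite rho0 UdE; apply/asboolP].
have {}rho_inj p q : ~ U (val p) -> rho p = rho q -> p = q.
  by move=> nU; apply: rho_inj; rewrite UdE; apply/asboolP.
have {}rho_burn p : ~ U (val p) ->
  2 <= \sum_(d | dir_at (val p) d) `[< U (val (neighbor p d)) >]%:R :> int \/
  exists d, [/\ dir_at (val p) d, ~ U (val (neighbor p d)) & (rho (neighbor p d) < rho p)%N].
  move=> nU; have [|H|[q [qU rq aq]]] := rho_burn p; first by rewrite UdE; apply/asboolP.
    by left; rewrite sumUd (sum_adj p (fun q => `[< U (val q) >])) in H.
  right; have [d pd /eqP qE] := sum_nat_gt0 aq; exists d; rewrite qE; split=> //.
  by move: qU; rewrite UdE => /asboolP.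
have x0B : x0 \in sub_verts B by apply: memB; rewrite mem_head.
exists (burning_divisor U rho).
  move=> y nUy.
  exact: (burning_divisor_covers cU SB gn (SeqSub x0B) rho0 rho_inj rho_burn Ux0 nUy).
move=> x Ux; exact: (burning_divisor_uncovered cU (SeqSub x0B) Ux).
Qed.

(** * Invariance under homeomorphisms, and the theorem *)

Section Homeomorphism.
Context (T T' : topologicalType) (f : T -> T') (g : T' -> T).
Context (fK : cancel f g) (gK : cancel g f) (cf : continuous f) (cg : continuous g).

Lemma preimage_two_sided (U : set T') v : two_sided U v -> two_sided (f @^-1` U) (g v).
Proof.
move=> [W nW HW]; exists (f @^-1` W); first by apply: cf; rewrite gK.
move=> C cC CW nC; apply: (HW (f @` C)).
- by apply: connected_continuous_connected => //; exact: continuous_subspaceT.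
- by move=> _ [x Cx <-]; exact: CW.
- have : nbhs v (g @^-1` (C `|` ~` (f @^-1` U))) by exact: cg.
  apply: filterS => x /= [Cx|nUx]; [left|right].
    by exists (g x).
  by move: nUx; rewrite /preimage /= gK.
Qed.

Lemma preimage_special_open (U : set T') : special_open U -> special_open (f @^-1` U).
Proof.
move=> [[S [oU cU [u Uu] US maxU]] sp]; split.
  exists (map g S); split.
  - by move/continuousP: cf; exact.
  - rewrite (_ : f @^-1` U = g @` U).
      by apply: connected_continuous_connected => //; exact: continuous_subspaceT.
    apply/seteqP; split=> [x Ux|_ [y Uy <-]]; last by rewrite /preimage /= gK.
    by exists (f x).
  - by exists (g u); rewrite /preimage /= gK.
  - move=> x Ux; apply/negP => /mapP[y yS xE].
    by move/negP: (US _ Ux); apply; rewrite xE gK.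
  - move=> C cC CS [w [Cw Uw]] x Cx.
    apply: (maxU (f @` C)); last by exists x.
    + by apply: connected_continuous_connected => //; exact: continuous_subspaceT.
    + move=> _ [y Cy <-]; apply: contra (CS y Cy) => yS.
      by rewrite -(fK y) map_f.
    + by exists (f w); split=> //; exists w.
move=> Z [z Zz] ZU cZ cY.
have Z0 : g @^-1` Z !=set0 by exists (f z); rewrite /preimage /= fK.
have ZC : g @^-1` Z `<=` ~` U.
  by move=> x Zx Ux; apply: (ZU (g x)) => //; rewrite /preimage /= gK.
have Zcl : closed (g @^-1` Z) by apply: preimage_closed => // x _; exact: cg.
have Ycl : closed (~` U `\` g @^-1` Z).
  rewrite (_ : _ `\` _ = g @^-1` (~` (f @^-1` U) `\` Z)); last first.
    by apply/seteqP; split=> x; rewrite /preimage /= gK.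
  by apply: preimage_closed => // x _; exact: cg.
have [v Zv tv] := sp _ Z0 ZC Zcl Ycl.
exists (g v) => //; exact: preimage_two_sided.
Qed.

End Homeomorphism.

Theorem theorem1p8 (R : realType) (G G' : metricGraph R)
    (f : gpoint G -> gpoint G') (A : set (gpoint G)) :
  homeomorphism f -> rank_determining A -> rank_determining (f @` A).
Proof.
move=> [cf [g [fK gK cg]]] /rank_determiningP[[a0 Aa0] HA].
apply/rank_determiningP; split; first by exists (f a0), a0.
(* A point missed by the system of [D] yields a special open set off the image of [A]. Its preimage
   carries a divisor on [G] that covers [A] but no point of this preimage, which [HA] forbids. *)
move=> D HD x; apply: contrapT => nDx.
have fA0 : f @` A !=set0 by exists (f a0), a0.
have [U spU AU] := special_of_uncovered fA0 HD nDx.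
have spU' := preimage_special_open fK gK cf cg spU.
have [D' covD' nD'] := divisor_of_special spU'.
have [[S [_ _ [u Uu] _ _]] _] := spU'.
apply: (nD' u Uu); apply: HA => a Aa; apply: covD' => Ua.
by apply: (AU (f a)) => //; exists a.
Qed.
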